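(* Let $n\ge 2$ be an integer, let $\alpha\in(0,1)$, let $\{\mathcal{E}_0,H_0,\mathcal{E}_1,H_1\}$ be admissible boundary data (with parameters $n,\alpha$), and let $\{\mathcal{E},H\}$ be a $C^n$-solution of the Goursat problem for the Ernst--Maxwell equations in $D$ with data $\{\mathcal{E}_0,H_0,\mathcal{E}_1,H_1\}$. Let $$m_1=\lim_{x\downarrow0}x^\alpha\mathcal{E}_{0x}(x),\quad n_1=\lim_{x\downarrow0}x^\alpha H_{0x}(x),\quad m_2=\lim_{y\downarrow0}y^\alpha\mathcal{E}_{1y}(y),\quad n_2=\lim_{y\downarrow0}y^\alpha H_{1y}(y).$$ Then, for all $y\in[0,1)$ in the $x$-limits (functions with index $1$ evaluated at $y$) and all $x\in[0,1)$ in the $y$-limits (functions $c_2,d_2,e_2,f_0,H_0$ evaluated at $x$), $$\lim_{x\downarrow0}x^\alpha\mathcal{E}_x(x,y)=c_1\frac{(im_1\bar d_1+2\bar e_1n_1)\bar H_1+c_1(e_1m_1+2id_1n_1)}{\sqrt{f_1}\sqrt{1-y}},$$ $$\lim_{y\downarrow0}y^\alpha\mathcal{E}_y(x,y)=c_2\frac{(im_2\bar d_2+2\bar e_2n_2)\bar H_0+c_2(e_2m_2+2id_2n_2)}{\sqrt{f_0}\sqrt{1-x}},$$ $$\lim_{x\downarrow0}x^\alpha H_x(x,y)=c_1\frac{im_1\bar d_1+2\bar e_1n_1}{2\sqrt{f_1}\sqrt{1-y}},\qquad \lim_{y\downarrow0}y^\alpha H_y(x,y)=c_2\frac{im_2\bar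 d_2+2\bar e_2n_2}{2\sqrt{f_0}\sqrt{1-x}},$$ where $$c_1(y)=(\Phi_1(y,0))_{22}=e^{\int_0^yB_1(y')dy'},\quad d_1(y)=(\Phi_1(y,0))_{31},\quad e_1(y)=(\Phi_1(y,0))_{33},$$ $$c_2(x)=(\Phi_0(x,1))_{22}=e^{\int_0^xA_0(x')dx'},\quad d_2(x)=(\Phi_0(x,1))_{31},\quad e_2(x)=(\Phi_0(x,1))_{33}.$$ Moreover, if $\alpha=1/2$, then $$(1-y)\lim_{x\to0}x\left(\frac{|\mathcal{E}_x(x,y)-2\bar H_1(y)H_x(x,y)|^2}{f_1(y)^2}+\frac{4|H_x(x,y)|^2}{f_1(y)}\right)=|m_1|^2+4|n_1|^2,$$ $$(1-x)\lim_{y\to0}y\left(\frac{|\mathcal{E}_y(x,y)-2\bar H_0(x)H_y(x,y)|^2}{f_0(x)^2}+\frac{4|H_y(x,y)|^2}{f_0(x)}\right)=|m_2|^2+4|n_2|^2.$$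
   Context: **Domain and equations.** $D=\{(x,y)\in\mathbb{R}^2: x\ge 0,\ y\ge 0,\ x+y<1\}$. The Ernst--Maxwell equations for complex-valued $\mathcal{E}(x,y)$, $H(x,y)$ are $$(\mathrm{Re}\,\mathcal{E}-H\bar H)\Big(\mathcal{E}_{xy}-\frac{\mathcal{E}_x+\mathcal{E}_y}{2(1-x-y)}\Big)=\mathcal{E}_x\mathcal{E}_y-\bar H(\mathcal{E}_xH_y+\mathcal{E}_yH_x),$$ $$(\mathrm{Re}\,\mathcal{E}-H\bar H)\Big(H_{xy}-\frac{H_x+H_y}{2(1-x-y)}\Big)=\tfrac12(\mathcal{E}_xH_y+\mathcal{E}_yH_x)-2\bar H H_xH_y.$$ **Admissible boundary data** (parameters: integer $n\ge2$, $\alpha\in[0,1)$): complex-valued functions $\mathcal{E}_0(x),H_0(x)$, $x\in[0,1)$, and $\mathcal{E}_1(y),H_1(y)$, $y\in[0,1)$, with: $\mathcal{E}_0,H_0,\mathcal{E}_1,H_1\in C([0,1))\cap C^n((0,1))$; $x^\alpha\mathcal{E}_{0x},x^\alpha H_{0x},y^\alpha\mathcal{E}_{1y},y^\alpha H_{1y}\in C([0,1))$ (i.e. they extend continuously to $0$); $\mathcal{E}_0(0)=\mathcal{E}_1(0)=1$; $H_0(0)=H_1(0)=0$; $f_0:=\mathrm{Re}\,\mathcal{E}_0-|H_0|^2>0$ and $f_1:=\mathrm{Re}\,\mathcal{E}_1-|H_1|^2>0$ on $[0,1)$. **$C^n$-solution.** A $C^n$-solution of the Goursat problem in $D$ with data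 $\{\mathcal{E}_0,H_0,\mathcal{E}_1,H_1\}$ is a pair of complex-valued functions $\{\mathcal{E},H\}$ such that: $\mathcal{E},H\in C(D)\cap C^n(\mathrm{int}\,D)$; $\mathcal{E},H$ satisfy the Ernst--Maxwell equations in $\mathrm{int}\,D$; for some $\beta\in[0,1)$, $x^\beta\mathcal{E}_x,x^\beta H_x,y^\beta\mathcal{E}_y,y^\beta H_y,x^\beta y^\beta\mathcal{E}_{xy},x^\beta y^\beta H_{xy}\in C(D)$ (extend continuously to $D$); $\mathcal{E}(x,0)=\mathcal{E}_0(x)$, $H(x,0)=H_0(x)$ for $x\in[0,1)$; $\mathcal{E}(0,y)=\mathcal{E}_1(y)$, $H(0,y)=H_1(y)$ for $y\in[0,1)$; $\mathrm{Re}\,\mathcal{E}-|H|^2>0$ on $D$. **Eigenfunctions.** Let $A_0=\frac{1}{2f_0}(\mathcal{E}_{0x}-2\overline{H_0}H_{0x})$, $B_1=\frac{1}{2f_1}(\mathcal{E}_{1y}-2\overline{H_1}H_{1y})$. For a parameter $\lambda$ put $$\mathsf{U}_0=\begin{pmatrix}\overline{A_0}&\lambda\overline{A_0}&\frac{i}{\sqrt{f_0}}H_{0x}\\ \lambda A_0&A_0&-\frac{i\lambda}{\sqrt{f_0}}H_{0x}\\ \frac{i}{\sqrt{f_0}}\overline{H_{0x}}&\frac{i\lambda}{\sqrt{f_0}}\overline{H_{0x}}&\frac12(A_0+\overline{A_0})\end{pmatrix},\qquad \mathsf{V}_1=\begin{pmatrix}\overline{B_1}&\frac1\lambda\overline{B_1}&\frac{i}{\sqrt{f_1}}H_{1y}\\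 \frac1\lambda B_1&B_1&-\frac{i}{\lambda\sqrt{f_1}}H_{1y}\\ \frac{i}{\sqrt{f_1}}\overline{H_{1y}}&\frac{i}{\lambda\sqrt{f_1}}\overline{H_{1y}}&\frac12(B_1+\overline{B_1})\end{pmatrix}.$$ In general $\Phi_0(x,k^\pm)$ solves $\Phi_0=I+\int_0^x\mathsf{U}_0\Phi_0\,dx'$ with $\lambda=\lambda(x',0,k^\pm)$ and $\Phi_1(y,k^\pm)$ solves $\Phi_1=I+\int_0^y\mathsf{V}_1\Phi_1\,dy'$ with $\lambda=\lambda(0,y',k^\pm)$, where $\lambda(x,y,k^\pm)=\pm\sqrt{\frac{k-(1-y)}{k-x}}$ (square root with positive real part). At the point $k=0$ one has $1/\lambda(0,y,0)=0$, and $\Phi_1(y,0)$ denotes the solution of $\Phi_1(y,0)=I+\int_0^y\mathsf{V}_1(y',0)\Phi_1(y',0)dy'$, where $\mathsf{V}_1(y',0)$ is $\mathsf{V}_1$ with $1/\lambda$ replaced by $0$. At $k=1$ one has $\lambda(x,0,1)=0$, and $\Phi_0(x,1)$ denotes the solution of $\Phi_0(x,1)=I+\int_0^x\mathsf{U}_0(x',1)\Phi_0(x',1)dx'$, where $\mathsf{U}_0(x',1)$ is $\mathsf{U}_0$ with $\lambda=0$. *)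

(* Defs.v *)
From Stdlib Require Import Reals.
From Coquelicot Require Import Coquelicot.
Open Scope R_scope.

(* Complex-valued functions of one or two real variables.  Derivatives are
   taken on real and imaginary parts; [Derive] is total, and differentiability
   is carried by the C^n hypotheses below. *)
Definition dC (f : R -> C) (t : R) : C :=
  (Derive (fun s => Re (f s)) t, Derive (fun s => Im (f s)) t).

Definition dx (F : R -> R -> C) (x y : R) : C := dC (fun s => F s y) x.
Definition dy (F : R -> R -> C) (x y : R) : C := dC (fun s => F x s) y.
Definition dxy (F : R -> R -> C) (x y : R) : C := dy (dx F) x y.

Definition Cexp (z : C) : C :=
  (exp (Re z) * cos (Im z), exp (Re z) * sin (Im z)).

Definition Ico01 (x : R) : Prop := 0 <= x < 1.
Definition Ioo01 (x : R) : Prop := 0 < x < 1.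

Definition D (p : R * R) : Prop :=
  0 <= fst p /\ 0 <= snd p /\ fst p + snd p < 1.
Definition intD (p : R * R) : Prop :=
  0 < fst p /\ 0 < snd p /\ fst p + snd p < 1.

Definition Cn_Ioo01 (n : nat) (f : R -> C) : Prop :=
  forall x, Ioo01 x -> forall k, (k <= n)%nat ->
    ex_derive_n (fun t => Re (f t)) k x /\
    ex_derive_n (fun t => Im (f t)) k x /\
    continuous (Derive_n (fun t => Re (f t)) k) x /\
    continuous (Derive_n (fun t => Im (f t)) k) x.

Definition Cn_intD (n : nat) (F : R -> R -> C) : Prop :=
  forall x y, intD (x, y) ->
    ex_diff_n (fun u v => Re (F u v)) n x y /\
    ex_diff_n (fun u v => Im (F u v)) n x y.

(* [f], given on [S], is the restriction of a continuous function on [T]. *)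
Definition extends_continuously {U : UniformSpace} (S T : U -> Prop)
    (f : U -> C) : Prop :=
  exists g : U -> C, continuous_on T g /\ forall p, S p -> g p = f p.

Definition C_Ico01 (f : R -> C) : Prop := continuous_on Ico01 f.
Definition C_D (F : R -> R -> C) : Prop :=
  continuous_on D (fun p : R * R => F (fst p) (snd p)).
Definition extends_to_D (F : R -> R -> C) : Prop :=
  extends_continuously intD D (fun p : R * R => F (fst p) (snd p)).

(* The quantity Re E - |H|^2. *)
Definition fEH (E H : C) : R := Re E - Cmod H ^ 2.

Definition ernst_maxwell_at (E H : R -> R -> C) (x y : R) : Prop :=
  ((RtoC (Re (E x y)) - H x y * Cconj (H x y)) *
     (dxy E x y - (dx E x y + dy E x y) / RtoC (2 * (1 - x - y)))
   = dx E x y * dy E x y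
     - Cconj (H x y) * (dx E x y * dy H x y + dy E x y * dx H x y))%C /\
  ((RtoC (Re (E x y)) - H x y * Cconj (H x y)) *
     (dxy H x y - (dx H x y + dy H x y) / RtoC (2 * (1 - x - y)))
   = RtoC (/ 2) * (dx E x y * dy H x y + dy E x y * dx H x y)
     - RtoC 2 * Cconj (H x y) * dx H x y * dy H x y)%C.

Record admissible_data (n : nat) (alpha : R) (E0 H0 E1 H1 : R -> C) : Prop := {
  adm_cont : C_Ico01 E0 /\ C_Ico01 H0 /\ C_Ico01 E1 /\ C_Ico01 H1;
  adm_Cn : Cn_Ioo01 n E0 /\ Cn_Ioo01 n H0 /\ Cn_Ioo01 n E1 /\ Cn_Ioo01 n H1;
  adm_sing : forall f : R -> C, f = E0 \/ f = H0 \/ f = E1 \/ f = H1 ->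
    extends_continuously Ioo01 Ico01
      (fun x => (RtoC (Rpower x alpha) * dC f x)%C);
  adm_E_origin : E0 0 = RtoC 1 /\ E1 0 = RtoC 1;
  adm_H_origin : H0 0 = RtoC 0 /\ H1 0 = RtoC 0;
  adm_pos : forall x, Ico01 x -> 0 < fEH (E0 x) (H0 x) /\ 0 < fEH (E1 x) (H1 x)
}.

Record Cn_solution (n : nat) (E0 H0 E1 H1 : R -> C) (E H : R -> R -> C)
    : Prop := {
  sol_cont : C_D E /\ C_D H;
  sol_Cn : Cn_intD n E /\ Cn_intD n H;
  sol_eq : forall x y, intD (x, y) -> ernst_maxwell_at E H x y;
  sol_sing : exists beta, 0 <= beta < 1 /\
    forall F : R -> R -> C, F = E \/ F = H ->
      extends_to_D (fun x y => RtoC (Rpower x beta) * dx F x y)%C /\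
      extends_to_D (fun x y => RtoC (Rpower y beta) * dy F x y)%C /\
      extends_to_D
        (fun x y => RtoC (Rpower x beta * Rpower y beta) * dxy F x y)%C;
  sol_bdry0 : forall x, Ico01 x -> E x 0 = E0 x /\ H x 0 = H0 x;
  sol_bdry1 : forall y, Ico01 y -> E 0 y = E1 y /\ H 0 y = H1 y;
  sol_pos : forall x y, D (x, y) -> 0 < fEH (E x y) (H x y)
}.

(* A_0 when applied to (E0, H0), and B_1 when applied to (E1, H1). *)
Definition log_coef (E H : R -> C) (t : R) : C :=
  ((dC E t - RtoC 2 * Cconj (H t) * dC H t) / RtoC (2 * fEH (E t) (H t)))%C.

(* The matrices U_0 and V_1 have the same form in their respective data, with
   [mu] = lambda for U_0 and [mu] = 1/lambda for V_1. *)
Definition lax_matrix (E H : R -> C) (mu : C) (t : R) : @matrix C 3 3 :=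
  let A := log_coef E H t in
  let h := dC H t in
  let s := RtoC (sqrt (fEH (E t) (H t))) in
  [ [ Cconj A, mu * Cconj A, Ci / s * h ],
    [ mu * A, A, - (Ci * mu / s * h) ],
    [ Ci / s * Cconj h, Ci * mu / s * Cconj h, RtoC (/ 2) * (A + Cconj A) ] ]%C.

Definition U0 (E0 H0 : R -> C) (lambda : C) : R -> @matrix C 3 3 :=
  lax_matrix E0 H0 lambda.
Definition V1 (E1 H1 : R -> C) (inv_lambda : C) : R -> @matrix C 3 3 :=
  lax_matrix E1 H1 inv_lambda.

(* Integral of [f] from 0 to [t] >= 0, improper at 0: the integrands below are
   in general unbounded there. *)
Definition is_int0 (f : R -> C) (t : R) (l : C) : Prop :=
  (t = 0 -> l = RtoC 0) /\
  (0 < t -> is_RInt_gen (V := C_R_NormedModule) f (at_right 0) (at_point t) l).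

(* Matrix entries are numbered from 0. *)
Definition entry (M : @matrix C 3 3) (i j : nat) : C :=
  coeff_mat (RtoC 0) M i j.

(* Phi(t) = I + int_0^t W Phi on [0,1). *)
Definition volterra_solution (W Phi : R -> @matrix C 3 3) : Prop :=
  forall t, Ico01 t -> forall i j, (i < 3)%nat -> (j < 3)%nat ->
    is_int0 (fun s => entry (Mmult (T := C_Ring) (W s) (Phi s)) i j) t
      (entry (Phi t) i j - entry (Mone (T := C_Ring)) i j)%C.

(* Phi_1(y, k = 0), where 1/lambda = 0, and Phi_0(x, k = 1), where lambda = 0. *)
Definition is_Phi1_at_0 (E1 H1 : R -> C) (Phi : R -> @matrix C 3 3) : Prop :=
  volterra_solution (V1 E1 H1 (RtoC 0)) Phi.
Definition is_Phi0_at_1 (E0 H0 : R -> C) (Phi : R -> @matrix C 3 3) : Prop :=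
  volterra_solution (U0 E0 H0 (RtoC 0)) Phi.

Definition lim0 (f : R -> C) (l : C) : Prop :=
  filterlim f (at_right 0) (locally l).

(* Main.v *)
Require Import Defs.
From Stdlib Require Import Reals Lra Lia ClassicalEpsilon.
From Coquelicot Require Import Coquelicot.
Open Scope R_scope.

(* Multiply the Ernst-Maxwell equations by [x^alpha] and set
   [p = sqrt (1 - x - y) x^alpha E_x], [q = sqrt (1 - x - y) x^alpha H_x].  For
   fixed [x] these solve a linear system in [y]; the factor [sqrt (1 - x - y)]
   absorbs the term [E_x / (2 (1 - x - y))], so that every coefficient is
   [y^(-beta)] times a function continuous up to the edge [x = 0].  As [x -> 0]
   the coefficients converge uniformly for [y] in compact subsets of [[0, 1)] and
   the initial values at [y = 0] converge to [(m1, n1)]; since [y^(-beta)] is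
   integrable, Gronwall's inequality shows that [(p, q)] converges to the solution
   of the limit system on the edge.  That solution is explicit in the entries of
   [Phi_1], because [Phi_1 / sqrt f1] restricted to the first and third coordinates
   is unitary with determinant [conj c1 / sqrt f1]; unitarity also gives the norm
   identity for [alpha = 1/2].  The limits [y -> 0] follow by exchanging the
   variables.  *)

(** * Limits and derivatives of complex-valued functions *)

(** The definition of a solution does not say what the extensions of [y^beta E_y] and [y^beta H_y]
    are on the edge [x = 0]. That their traces are [y^beta] times the derivatives of [E1] and [H1]
    has to be proved; only then is the limit system expressed by the boundary data. The exponent
    [beta] of the solution is not tied to [alpha]: [beta] governs every integration in [y], also on
    the edge and in the equations for the eigenfunctions, while [alpha] only scales in [x]. After
    scaling, the term with [E_y / (2 (1 - x - y))] survives as an inhomogeneity with the factor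
    [x^alpha], which tends to 0 because [alpha > 0]. The limit system becomes tractable in the
    unknowns [E_x - 2 conj(H) H_x] and [H_x], the first being the combination that occurs in
    [log_coef]. Its solution is built from the third row of [Phi_1], whose equations involve the
    first row; unitarity expresses the first row by conjugates of the third and so closes the
    system. Algebraic identities between solutions are obtained from uniqueness: the difference of
    the two sides solves a homogeneous linear system with zero initial value. *)

Lemma filterlim_Rplus {T} (F : (T -> Prop) -> Prop) {FF : Filter F}
    (f g : T -> R) (a b : R) :
  filterlim f F (locally a) -> filterlim g F (locally b) ->
  filterlim (fun x => f x + g x) F (locally (a + b)).
Proof.
  intros Hf Hg.
  exact (filterlim_comp_2 f g Rplus Hf Hg (filterlim_plus a b)).
Qed.

Lemma filterlim_Rmult {T} (F : (T -> Prop) -> Prop) {FF : Filter F}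
    (f g : T -> R) (a b : R) :
  filterlim f F (locally a) -> filterlim g F (locally b) ->
  filterlim (fun x => f x * g x) F (locally (a * b)).
Proof.
  intros Hf Hg.
  exact (filterlim_comp_2 f g Rmult Hf Hg (filterlim_mult (K := R_AbsRing) a b)).
Qed.

Lemma filterlim_Ropp {T} (F : (T -> Prop) -> Prop) {FF : Filter F}
    (f : T -> R) (a : R) :
  filterlim f F (locally a) -> filterlim (fun x => - f x) F (locally (- a)).
Proof.
  intros Hf.
  exact (filterlim_comp _ _ _ _ _ _ _ _ Hf (filterlim_opp (V := R_NormedModule) a)).
Qed.

Lemma filterlim_Rcont {T} (F : (T -> Prop) -> Prop) {FF : Filter F}
    (h : R -> R) (f : T -> R) (a : R) :
  continuous h a -> filterlim f F (locally a) ->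
  filterlim (fun x => h (f x)) F (locally (h a)).
Proof. intros Hh Hf. exact (filterlim_comp _ _ _ _ _ _ _ _ Hf Hh). Qed.

Lemma filterlim_ReIm {T} (F : (T -> Prop) -> Prop) {FF : Filter F}
    (f : T -> C) (l : C) :
  filterlim f F (locally l) ->
  filterlim (fun x => Re (f x)) F (locally (Re l)) /\
  filterlim (fun x => Im (f x)) F (locally (Im l)).
Proof.
  intros Hf; split.
  - exact (filterlim_comp _ _ _ _ _ _ _ _ Hf
             (continuous_fst (U := R_UniformSpace) (V := R_UniformSpace) (fst l) (snd l))).
  - exact (filterlim_comp _ _ _ _ _ _ _ _ Hf
             (continuous_snd (U := R_UniformSpace) (V := R_UniformSpace) (fst l) (snd l))).
Qed.

Lemma filterlim_C_of_ReIm {T} (F : (T -> Prop) -> Prop) {FF : Filter F}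
    (f : T -> C) (l : C) :
  filterlim (fun x => Re (f x)) F (locally (Re l)) ->
  filterlim (fun x => Im (f x)) F (locally (Im l)) ->
  filterlim f F (locally l).
Proof.
  intros H1 H2 P [eps HP].
  refine (filter_imp (fun x => ball (Re l) eps (Re (f x)) /\ ball (Im l) eps (Im (f x))) _ _ _).
  - intros x Hx; apply HP, Hx.
  - apply filter_and; [apply H1 | apply H2]; apply locally_ball.
Qed.

Lemma im_le_Cmod (c : C) : Rabs (Im c) <= Cmod c.
Proof. eapply Rle_trans; [apply Rmax_r | apply Rmax_Cmod]. Qed.

Lemma Cmod_le_ReIm (c : C) : Cmod c <= Rabs (Re c) + Rabs (Im c).
Proof.
  assert (Hre := Rabs_pos (Re c)); assert (Him := Rabs_pos (Im c)).
  unfold Cmod, Re, Im in *. rewrite <- (sqrt_Rsqr (Rabs (fst c) + Rabs (snd c))) by lra.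
  apply sqrt_le_1_alt. unfold Rsqr.
  rewrite <- (pow2_abs (fst c)), <- (pow2_abs (snd c)).
  nra.
Qed.

Lemma filterlim_Cmod {T} (F : (T -> Prop) -> Prop) {FF : Filter F}
    (f : T -> C) (l : C) :
  filterlim f F (locally l) ->
  forall eps, 0 < eps -> F (fun x => Cmod (f x - l)%C < eps).
Proof.
  intros Hf eps Heps. apply filterlim_ReIm in Hf as [Hr Hi]; [|exact FF].
  assert (He2 : 0 < eps / 2) by lra.
  refine (filter_imp (fun x => ball (Re l) (mkposreal _ He2) (Re (f x)) /\
    ball (Im l) (mkposreal _ He2) (Im (f x))) _ _ _).
  - intros x [A B]. change (Rabs (Re (f x) - Re l) < eps / 2) in A.
    change (Rabs (Im (f x) - Im l) < eps / 2) in B.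
    eapply Rle_lt_trans; [apply Cmod_le_ReIm|].
    change (Rabs (Re (f x) - Re l) + Rabs (Im (f x) - Im l) < eps). lra.
  - apply filter_and; [apply Hr | apply Hi]; apply locally_ball.
Qed.

Lemma filterlim_of_Cmod {T} (F : (T -> Prop) -> Prop) {FF : Filter F}
    (f : T -> C) (l : C) :
  (forall eps, 0 < eps -> F (fun x => Cmod (f x - l)%C < eps)) ->
  filterlim f F (locally l).
Proof.
  intros Hf. apply (filterlim_C_of_ReIm F); intros P [eps HP];
    refine (filter_imp _ (fun x => P (_ (f x))) _ (Hf eps (cond_pos eps))); intros x Hx; apply HP.
  - eapply Rle_lt_trans; [apply (re_le_Cmod (f x - l)%C) | exact Hx].
  - eapply Rle_lt_trans; [apply (im_le_Cmod (f x - l)%C) | exact Hx].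
Qed.

Lemma filterlim_Cplus {T} (F : (T -> Prop) -> Prop) {FF : Filter F}
    (f g : T -> C) (a b : C) :
  filterlim f F (locally a) -> filterlim g F (locally b) ->
  filterlim (fun x => f x + g x)%C F (locally (a + b)%C).
Proof.
  intros Hf Hg. apply filterlim_ReIm in Hf as [? ?], Hg as [? ?]; try exact FF.
  apply (filterlim_C_of_ReIm F); apply (filterlim_Rplus F); assumption.
Qed.

Lemma filterlim_Copp {T} (F : (T -> Prop) -> Prop) {FF : Filter F}
    (f : T -> C) (a : C) :
  filterlim f F (locally a) -> filterlim (fun x => - f x)%C F (locally (- a)%C).
Proof.
  intros Hf. apply filterlim_ReIm in Hf as [? ?]; [|exact FF].
  apply (filterlim_C_of_ReIm F); apply (filterlim_Ropp F); assumption.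
Qed.

Lemma filterlim_Cminus {T} (F : (T -> Prop) -> Prop) {FF : Filter F}
    (f g : T -> C) (a b : C) :
  filterlim f F (locally a) -> filterlim g F (locally b) ->
  filterlim (fun x => f x - g x)%C F (locally (a - b)%C).
Proof. intros Hf Hg. apply (filterlim_Cplus F); [|apply (filterlim_Copp F)]; assumption. Qed.

Lemma filterlim_Cmult {T} (F : (T -> Prop) -> Prop) {FF : Filter F}
    (f g : T -> C) (a b : C) :
  filterlim f F (locally a) -> filterlim g F (locally b) ->
  filterlim (fun x => f x * g x)%C F (locally (a * b)%C).
Proof.
  intros Hf Hg. apply filterlim_ReIm in Hf as [? ?], Hg as [? ?]; try exact FF.
  apply (filterlim_C_of_ReIm F); simpl;
    (apply (filterlim_Rplus F); [|try apply (filterlim_Ropp F)]; apply (filterlim_Rmult F); assumption).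
Qed.

Lemma filterlim_Cconj {T} (F : (T -> Prop) -> Prop) {FF : Filter F}
    (f : T -> C) (a : C) :
  filterlim f F (locally a) -> filterlim (fun x => Cconj (f x)) F (locally (Cconj a)).
Proof.
  intros Hf. apply filterlim_ReIm in Hf as [? ?]; [|exact FF].
  apply (filterlim_C_of_ReIm F); [|apply (filterlim_Ropp F)]; assumption.
Qed.

Lemma filterlim_RtoC {T} (F : (T -> Prop) -> Prop) {FF : Filter F}
    (f : T -> R) (a : R) :
  filterlim f F (locally a) -> filterlim (fun x => RtoC (f x)) F (locally (RtoC a)).
Proof.
  intros Hf. apply (filterlim_C_of_ReIm F); simpl; [assumption | apply filterlim_const].
Qed.

Lemma Cmod_sqr (c : C) : Cmod c ^ 2 = Re c ^ 2 + Im c ^ 2.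
Proof.
  unfold Cmod, Re, Im. rewrite pow2_sqrt; [reflexivity|].
  assert (H1 := pow2_ge_0 (fst c)); assert (H2 := pow2_ge_0 (snd c)); lra.
Qed.

Lemma filterlim_Cmod_sqr {T} (F : (T -> Prop) -> Prop) {FF : Filter F}
    (f : T -> C) (a : C) :
  filterlim f F (locally a) ->
  filterlim (fun x => Cmod (f x) ^ 2) F (locally (Cmod a ^ 2)).
Proof.
  intros Hf. apply filterlim_ReIm in Hf as [Hr Hi]; [|exact FF].
  rewrite Cmod_sqr. simpl.
  apply (filterlim_ext (fun x => Re (f x) * (Re (f x) * 1) + Im (f x) * (Im (f x) * 1))).
  - intros x. symmetry. exact (Cmod_sqr (f x)).
  - apply (filterlim_Rplus F); repeat (apply (filterlim_Rmult F); try assumption); apply filterlim_const.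
Qed.

(** [dC] is total and carries no differentiability, so the calculus is done with this relation;
    [is_dC_unique] leads back to [dC]. *)
Definition is_dC (f : R -> C) (t : R) (l : C) : Prop :=
  is_derive (fun s => Re (f s)) t (Re l) /\ is_derive (fun s => Im (f s)) t (Im l).

Lemma is_dC_unique (f : R -> C) (t : R) (l : C) : is_dC f t l -> dC f t = l.
Proof.
  intros [H1 H2]. apply injective_projections; apply is_derive_unique; assumption.
Qed.

Lemma is_dC_eq (f : R -> C) (t : R) (l l' : C) : is_dC f t l -> l = l' -> is_dC f t l'.
Proof. intros H <-; exact H. Qed.

Lemma is_dC_ext_loc (f g : R -> C) (t : R) (l : C) :
  locally t (fun s => f s = g s) -> is_dC f t l -> is_dC g t l.
Proof.
  intros He [H1 H2].
  split; [refine (is_derive_ext_loc _ _ _ _ _ H1) | refine (is_derive_ext_loc _ _ _ _ _ H2)];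
    refine (filter_imp _ _ _ He); intros s ->; reflexivity.
Qed.

Lemma dC_ext_loc (f g : R -> C) (t : R) :
  locally t (fun s => f s = g s) -> dC f t = dC g t.
Proof.
  intros He. unfold dC.
  f_equal; apply Derive_ext_loc; refine (filter_imp _ _ _ He); intros s ->; reflexivity.
Qed.

Lemma is_derive_Rmult (f g : R -> R) (t a b : R) :
  is_derive f t a -> is_derive g t b ->
  is_derive (fun s => f s * g s) t (a * g t + f t * b).
Proof. intros Hf Hg. exact (is_derive_mult f g t a b Hf Hg Rmult_comm). Qed.

Lemma is_dC_const (c : C) (t : R) : is_dC (fun _ => c) t (RtoC 0).
Proof. split; apply (is_derive_const (V := R_NormedModule)). Qed.

Lemma is_dC_plus (f g : R -> C) (t : R) (a b : C) :
  is_dC f t a -> is_dC g t b -> is_dC (fun s => f s + g s)%C t (a + b)%C.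
Proof.
  intros [? ?] [? ?]; split; apply (is_derive_plus (V := R_NormedModule)); assumption.
Qed.

Lemma is_dC_opp (f : R -> C) (t : R) (a : C) :
  is_dC f t a -> is_dC (fun s => - f s)%C t (- a)%C.
Proof. intros [? ?]; split; apply (is_derive_opp (V := R_NormedModule)); assumption. Qed.

Lemma is_dC_minus (f g : R -> C) (t : R) (a b : C) :
  is_dC f t a -> is_dC g t b -> is_dC (fun s => f s - g s)%C t (a - b)%C.
Proof. intros Hf Hg. apply is_dC_plus; [|apply is_dC_opp]; assumption. Qed.

Lemma is_dC_mult (f g : R -> C) (t : R) (a b : C) :
  is_dC f t a -> is_dC g t b -> is_dC (fun s => f s * g s)%C t (a * g t + f t * b)%C.
Proof.
  intros [Fr Fi] [Gr Gi]; split.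
  - evar_last.
    + apply (is_derive_minus (V := R_NormedModule)); apply is_derive_Rmult; eassumption.
    + unfold minus, plus, opp, Re, Im; simpl. ring.
  - evar_last.
    + apply (is_derive_plus (V := R_NormedModule)); apply is_derive_Rmult; eassumption.
    + unfold plus, Re, Im; simpl. ring.
Qed.

Lemma is_dC_conj (f : R -> C) (t : R) (a : C) :
  is_dC f t a -> is_dC (fun s => Cconj (f s)) t (Cconj a).
Proof.
  intros [? ?]; split; [|apply (is_derive_opp (V := R_NormedModule))]; assumption.
Qed.

Lemma is_dC_RtoC (f : R -> R) (t a : R) :
  is_derive f t a -> is_dC (fun s => RtoC (f s)) t (RtoC a).
Proof.
  intros Hf; split; [exact Hf | exact (is_derive_const (V := R_NormedModule) 0 t)].
Qed.

Lemma is_dC_continuous (f : R -> C) (t : R) (a : C) : is_dC f t a -> continuous f t.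
Proof.
  intros [H1 H2]. apply (filterlim_C_of_ReIm (locally t)); apply (ex_derive_continuous (V := R_NormedModule)); eexists; eassumption.
Qed.

Lemma is_derive_Cmod_sqr (f : R -> C) (t : R) (a : C) :
  is_dC f t a -> is_derive (fun s => Cmod (f s) ^ 2) t (2 * Re (Cconj (f t) * a)%C).
Proof.
  intros [H1 H2].
  apply (is_derive_ext (fun s => Re (f s) * Re (f s) + Im (f s) * Im (f s))).
  - intros s. change (Re (f s) * Re (f s) + Im (f s) * Im (f s) = Cmod (f s) ^ 2).
    rewrite Cmod_sqr. ring.
  - evar_last.
    + apply (is_derive_plus (V := R_NormedModule)); apply is_derive_Rmult; eassumption.
    + unfold plus, Re, Im; simpl. ring.
Qed.

(** * Gronwall inequalities with an integrable singularity *)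

(** Nothing is assumed at 0, where the weights [t^(-b)] blow up; the behaviour there enters later
    through one-sided limits. *)
Lemma is_derive_nonpos_decreasing (phi dphi : R -> R) (T : R) :
  (forall t, 0 < t <= T -> is_derive phi t (dphi t) /\ dphi t <= 0) ->
  forall s t, 0 < s <= t -> t <= T -> phi t <= phi s.
Proof.
  intros H s t Hs Ht.
  destruct (MVT_gen phi s t dphi) as [c [Hc Heq]].
  - intros x Hx. rewrite Rmin_left, Rmax_right in Hx by lra. apply H; lra.
  - intros x Hx. rewrite Rmin_left, Rmax_right in Hx by lra.
    apply continuity_pt_filterlim, (ex_derive_continuous (V := R_NormedModule)).
    eexists. apply H; lra.
  - rewrite Rmin_left, Rmax_right in Hc by lra.
    destruct (H c) as [_ Hn]; [lra|]. nra.
Qed.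

Lemma at_right_0_small (d : R) : 0 < d -> at_right 0 (fun s => 0 < s < d).
Proof.
  intros Hd. exists (mkposreal d Hd). intros s Hs Hpos.
  change (Rabs (s - 0) < d) in Hs. rewrite Rminus_0_r, Rabs_right in Hs; lra.
Qed.

Lemma at_right_0_elim (P : R -> Prop) :
  at_right 0 P -> exists d, 0 < d /\ forall s, 0 < s < d -> P s.
Proof.
  intros [d Hd]. exists d. split; [apply cond_pos|]. intros s Hs. apply Hd; [|apply Hs].
  change (Rabs (s - 0) < d). rewrite Rminus_0_r, Rabs_right; lra.
Qed.

Lemma at_right_0_intro (P : R -> Prop) (d : R) :
  0 < d -> (forall s, 0 < s < d -> P s) -> at_right 0 P.
Proof.
  intros Hd HP. generalize (at_right_0_small d Hd). apply filter_imp. exact HP.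
Qed.

Lemma filterlim_at_right_0_le (phi : R -> R) (l M d : R) :
  0 < d -> filterlim phi (at_right 0) (locally l) ->
  (forall s, 0 < s < d -> M <= phi s) -> M <= l.
Proof.
  intros Hd Hl Hphi.
  refine (filterlim_le (F := at_right 0) (fun _ => M) phi M l _ _ Hl).
  - exact (at_right_0_intro _ d Hd Hphi).
  - apply filterlim_const.
Qed.

Lemma is_derive_Rpower (b t : R) :
  0 < t -> is_derive (fun s => Rpower s b) t (b * Rpower t (b - 1)).
Proof. intros Ht. apply is_derive_Reals, derivable_pt_lim_power, Ht. Qed.

Lemma exp_le (x y : R) : x <= y -> exp x <= exp y.
Proof. intros [H | ->]; [left; apply exp_increasing, H | right; reflexivity]. Qed.

Lemma exp_le_1 (x : R) : x <= 0 -> exp x <= 1.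
Proof. intros H. rewrite <- exp_0. apply exp_le, H. Qed.

Lemma Rpower_le_1 (t b : R) : 0 < t <= 1 -> 0 <= b -> 0 < Rpower t b <= 1.
Proof.
  intros Ht Hb. split; [apply exp_pos|].
  unfold Rpower.
  assert (Hln : ln t <= 0) by (rewrite <- ln_1; apply ln_le; lra).
  apply exp_le_1. nra.
Qed.

Lemma filterlim_Rpower_0 (b : R) :
  0 < b -> filterlim (fun t => Rpower t b) (at_right 0) (locally 0).
Proof.
  intros Hb P [eps HP].
  apply (at_right_0_intro _ (Rpower eps (/ b))); [apply exp_pos|].
  intros s Hs. apply HP. change (Rabs (Rpower s b - 0) < eps).
  assert (Hpos : 0 < Rpower s b) by apply exp_pos.
  rewrite Rminus_0_r, Rabs_right by lra.
  assert (He := cond_pos eps).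
  replace (pos eps) with (Rpower (Rpower eps (/ b)) b).
  - unfold Rpower at 1. unfold Rpower at 1. apply exp_increasing.
    apply Rmult_lt_compat_l; [exact Hb|]. apply ln_increasing; apply Hs.
  - rewrite Rpower_mult, Rinv_l, Rpower_1; lra.
Qed.

(** With [k = L / (1 - b)], the function [k t^(1-b)] is a primitive of [L t^(-b)], so
    [(N + eta) exp (- k t^(1-b))] decreases. Since [t <= 1], the integrating factor costs at most
    [exp k], uniformly in [t]. *)
Lemma gronwall (N dN : R -> R) (T b L eta N0 : R) :
  0 < T <= 1 -> 0 <= b < 1 -> 0 <= L -> 0 <= eta ->
  (forall t, 0 < t <= T -> 0 <= N t /\ is_derive N t (dN t) /\
     dN t <= Rpower t (- b) * (L * (N t + eta))) ->
  filterlim N (at_right 0) (locally N0) ->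
  forall t, 0 < t <= T -> N t + eta <= (N0 + eta) * exp (L / (1 - b)).
Proof.
  intros HT Hb HL Heta HN Hlim t Ht.
  set (k := L / (1 - b)).
  assert (Hk : 0 <= k) by (apply Rmult_le_pos; [lra | left; apply Rinv_0_lt_compat; lra]).
  set (phi := fun s => (N s + eta) * exp (- k * Rpower s (1 - b))).
  (* The exponential factor at [s] is at most 1 and is dropped, so that letting [s] tend to 0 needs
     only the limit of [N]. *)
  assert (Hdec : forall s, 0 < s < t -> phi t <= N s + eta).
  { intros s Hs. transitivity (phi s).
    - apply (is_derive_nonpos_decreasing phi
        (fun s => (dN s - L * Rpower s (- b) * (N s + eta)) * exp (- k * Rpower s (1 - b))) T);
        [|lra|lra].
      intros r Hr. destruct (HN r Hr) as [Hpos [Hder Hle]]. split.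
      + assert (Hp := is_derive_Rpower (1 - b) r (proj1 Hr)).
        replace (1 - b - 1) with (- b) in Hp by ring.
        assert (He := is_derive_comp (V := R_NormedModule) exp (fun s => - k * Rpower s (1 - b)) r _ _
          (is_derive_exp _) (is_derive_scal _ _ (- k) _ Hp)).
        assert (HNe := is_derive_plus (V := R_NormedModule) N (fun _ => eta) r _ _ Hder
          (is_derive_const (V := R_NormedModule) eta r)).
        evar_last; [exact (is_derive_Rmult _ _ _ _ _ HNe He)|].
        unfold plus, scal, zero; simpl. unfold mult; simpl. unfold k. field. lra.
      + assert (Hexp := exp_pos (- k * Rpower r (1 - b))). nra.
    - destruct (HN s) as [Hpos _]; [lra|].
      assert (Hp : 0 < Rpower s (1 - b)) by apply exp_pos.
      assert (H : exp (- k * Rpower s (1 - b)) <= 1).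
      { apply exp_le_1.
        assert (0 <= k * Rpower s (1 - b)) by (apply Rmult_le_pos; [exact Hk | lra]). lra. }
      unfold phi. rewrite <- (Rmult_1_r (N s + eta)) at 2. apply Rmult_le_compat_l; lra. }
  assert (Hphi : phi t <= N0 + eta).
  { apply (filterlim_at_right_0_le (fun s => N s + eta) _ _ t); [lra| |exact Hdec].
    apply (filterlim_Rplus (at_right 0)); [exact Hlim | apply filterlim_const]. }
  unfold phi in Hphi.
  destruct (HN t Ht) as [Hpos _].
  destruct (Rpower_le_1 t (1 - b)) as [Hp1 Hp2]; [lra|lra|].
  assert (Hinv : exp (- k * Rpower t (1 - b)) * exp (k * Rpower t (1 - b)) = 1).
  { rewrite <- exp_plus, <- exp_0. f_equal. ring. }
  assert (Hle : exp (k * Rpower t (1 - b)) <= exp k) 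
    by (apply exp_le; rewrite <- (Rmult_1_r k) at 2; apply Rmult_le_compat_l; [exact Hk | exact Hp2]).
  assert (He1 := exp_pos (k * Rpower t (1 - b))).
  assert (N0 + eta >= 0).
  { apply Rle_ge. eapply Rle_trans; [|exact Hphi].
    apply Rmult_le_pos; [lra | left; apply exp_pos]. }
  replace (N t + eta) with
    ((N t + eta) * exp (- k * Rpower t (1 - b)) * exp (k * Rpower t (1 - b)))
    by (rewrite Rmult_assoc, Hinv; ring).
  apply Rle_trans with ((N0 + eta) * exp (k * Rpower t (1 - b))).
  - apply Rmult_le_compat_r; lra.
  - apply Rmult_le_compat_l; lra.
Qed.

(** Gronwall's inequality for [|u|^2 + |v|^2], which is differentiable where the moduli need not be.
    The constants come from [2 (x + y) (K x + K y + eps) <= (4 K + 1) (x^2 + y^2 + 2 eps^2)], that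
    is from [2 K (x + y)^2 <= 4 K (x^2 + y^2)] and [2 eps x <= x^2 + eps^2]. *)
Lemma gronwall_C2 (u v du dv : R -> C) (u0 v0 : C) (T b K eps : R) :
  0 < T <= 1 -> 0 <= b < 1 -> 0 <= K -> 0 <= eps ->
  (forall t, 0 < t <= T ->
     is_dC u t (du t) /\ is_dC v t (dv t) /\
     Cmod (du t) <= Rpower t (- b) * (K * Cmod (u t) + K * Cmod (v t) + eps) /\
     Cmod (dv t) <= Rpower t (- b) * (K * Cmod (u t) + K * Cmod (v t) + eps)) ->
  filterlim u (at_right 0) (locally u0) ->
  filterlim v (at_right 0) (locally v0) ->
  forall t, 0 < t <= T ->
    Cmod (u t) ^ 2 + Cmod (v t) ^ 2 <=
    (Cmod u0 ^ 2 + Cmod v0 ^ 2 + 2 * eps ^ 2) * exp ((4 * K + 1) / (1 - b)).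
Proof.
  intros HT Hb HK Heps H Hu Hv t Ht.
  apply Rle_trans with (Cmod (u t) ^ 2 + Cmod (v t) ^ 2 + 2 * eps ^ 2);
    [assert (0 <= eps ^ 2) by apply pow2_ge_0; lra|].
  apply (gronwall (fun s => Cmod (u s) ^ 2 + Cmod (v s) ^ 2)
    (fun s => 2 * Re (Cconj (u s) * du s)%C + 2 * Re (Cconj (v s) * dv s)%C) T);
    try assumption; [lra | nra | |].
  - intros s Hs. destruct (H s Hs) as [Du [Dv [Bu Bv]]].
    assert (Hu2 := pow2_ge_0 (Cmod (u s))). assert (Hv2 := pow2_ge_0 (Cmod (v s))).
    split; [lra | split].
    + apply (is_derive_plus (V := R_NormedModule)); apply is_derive_Cmod_sqr; assumption.
    + assert (Hre : forall a c : C, Re (Cconj a * c)%C <= Cmod a * Cmod c).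
      { intros a c. eapply Rle_trans; [apply Rle_abs|]. eapply Rle_trans; [apply re_le_Cmod|].
        rewrite Cmod_mult, Cmod_conj. lra. }
      assert (H1 := Hre (u s) (du s)). assert (H2 := Hre (v s) (dv s)).
      assert (Hp : 0 < Rpower s (- b)) by apply exp_pos.
      assert (Pu := Cmod_ge_0 (u s)). assert (Pv := Cmod_ge_0 (v s)).
      revert H1 H2 Bu Bv Hp Pu Pv Hu2 Hv2.
      generalize (Re (Cconj (u s) * du s)%C), (Re (Cconj (v s) * dv s)%C), (Cmod (du s)),
        (Cmod (dv s)), (Rpower s (- b)), (Cmod (u s)), (Cmod (v s)).
      intros ru rv mu mv p x y H1 H2 Bu Bv Hp Pu Pv Hu2 Hv2.
      apply Rle_trans with (p * (2 * (x + y) * (K * x + K * y + eps))).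
      * assert (x * mu <= x * (p * (K * x + K * y + eps))) by (apply Rmult_le_compat_l; assumption).
        assert (y * mv <= y * (p * (K * x + K * y + eps))) by (apply Rmult_le_compat_l; assumption).
        lra.
      * apply Rmult_le_compat_l; [lra|].
        assert (0 <= K * (x - y) ^ 2) by (apply Rmult_le_pos; [assumption | apply pow2_ge_0]).
        assert (0 <= (x - eps) ^ 2) by apply pow2_ge_0.
        assert (0 <= (y - eps) ^ 2) by apply pow2_ge_0.
        assert (0 <= K * eps ^ 2) by (apply Rmult_le_pos; [assumption | apply pow2_ge_0]).
        nra.
  - apply (filterlim_Rplus (at_right 0)); apply (filterlim_Cmod_sqr (at_right 0)); assumption.
Qed.

(** * Improper integrals at 0 *)

Lemma is_RInt_gen_at_right_0_elim (f : R -> C) (t : R) (l : C) :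
  is_RInt_gen (V := C_R_NormedModule) f (at_right 0) (at_point t) l ->
  forall eps, 0 < eps -> exists d, 0 < d /\ forall s, 0 < s < d ->
    exists v, is_RInt (V := C_R_NormedModule) f s t v /\ Cmod (v - l)%C < eps.
Proof.
  intros H eps Heps.
  assert (Hl : locally (T := C_UniformSpace) l (fun v => Cmod (v - l)%C < eps)).
  { exact (filterlim_Cmod (locally (T := C_UniformSpace) l) (fun v => v) l (fun P HP => HP) eps Heps). }
  destruct (H _ Hl) as [Q R HQ HR HQR].
  apply at_right_0_elim in HQ as [d [Hd HQ]].
  exists d. split; [exact Hd|]. intros s Hs. exact (HQR s t (HQ s Hs) HR).
Qed.

Lemma is_RInt_C_unique (f : R -> C) (a b : R) (v w : C) :
  is_RInt (V := C_R_NormedModule) f a b v ->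
  is_RInt (V := C_R_NormedModule) f a b w -> v = w.
Proof.
  intros Hv Hw.
  rewrite <- (is_RInt_unique (V := C_R_CompleteNormedModule) _ _ _ _ Hv).
  exact (is_RInt_unique (V := C_R_CompleteNormedModule) _ _ _ _ Hw).
Qed.

Lemma Cmod_small_eq (z w : C) : (forall eps, 0 < eps -> Cmod (z - w)%C < eps) -> z = w.
Proof.
  intros H. assert (Hz : Cmod (z - w)%C = 0).
  { destruct (Cmod_ge_0 (z - w)%C) as [Hlt | <-]; [|reflexivity].
    exfalso. exact (Rlt_irrefl _ (H _ Hlt)). }
  apply Cmod_eq_0 in Hz. replace z with ((z - w) + w)%C by ring. rewrite Hz. ring.
Qed.

(** For small [s] the integrals from [s] to [a] and from [s] to [b] exist, and by Chasles their
    difference is the integral from [a] to [b], which does not depend on [s]. Integrability on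
    [[a, b]] is thus a conclusion, with no continuity of [f] assumed. *)
Lemma is_RInt_gen_at_right_0_diff (f : R -> C) (a b : R) (la lb : C) :
  0 < a -> 0 < b ->
  is_RInt_gen (V := C_R_NormedModule) f (at_right 0) (at_point a) la ->
  is_RInt_gen (V := C_R_NormedModule) f (at_right 0) (at_point b) lb ->
  is_RInt (V := C_R_NormedModule) f a b (lb - la)%C.
Proof.
  intros Ha Hb Hla Hlb.
  assert (HI : forall eps, 0 < eps ->
    exists v, is_RInt (V := C_R_NormedModule) f a b v /\ Cmod (v - (lb - la))%C < eps).
  { intros eps Heps.
    destruct (is_RInt_gen_at_right_0_elim _ _ _ Hla (eps / 2)) as [d1 [Hd1 H1]]; [lra|].
    destruct (is_RInt_gen_at_right_0_elim _ _ _ Hlb (eps / 2)) as [d2 [Hd2 H2]]; [lra|].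
    set (s := Rmin d1 d2 / 2).
    assert (Hs : 0 < s /\ s < d1 /\ s < d2).
    { unfold s. assert (Hm1 := Rmin_l d1 d2). assert (Hm2 := Rmin_r d1 d2).
      assert (Hm := Rmin_glb_lt d1 d2 0 Hd1 Hd2). lra. }
    destruct (H1 s) as [va [Iva Bva]]; [lra|].
    destruct (H2 s) as [vb [Ivb Bvb]]; [lra|].
    exists (vb - va)%C. split.
    - replace (vb - va)%C with (- va + vb)%C by ring.
      exact (is_RInt_Chasles (V := C_R_NormedModule) f a s b _ _ (is_RInt_swap _ _ _ _ Iva) Ivb).
    - replace (vb - va - (lb - la))%C with ((vb - lb) + - (va - la))%C by ring.
      eapply Rle_lt_trans; [apply Cmod_triangle|]. rewrite Cmod_opp. lra. }
  destruct (HI 1 Rlt_0_1) as [v [Iv _]].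
  replace (lb - la)%C with v; [exact Iv|].
  apply Cmod_small_eq. intros eps Heps. destruct (HI eps Heps) as [w [Iw Hw]].
  rewrite (is_RInt_C_unique _ _ _ _ _ Iv Iw). exact Hw.
Qed.

Lemma locally_Ioo01 (t : R) : Ioo01 t -> locally t Ioo01.
Proof.
  intros [H1 H2]. exact (open_and _ _ (open_gt 0) (open_lt 1) t (conj H1 H2)).
Qed.

(** [L s] is [L t0] minus the integral from [s] to [t0], and that integral tends to [L t0] by the
    definition of the improper integral. *)
Lemma primitive_lim0 (f L : R -> C) (t0 : R) :
  0 < t0 ->
  (forall t, 0 < t <= t0 ->
     is_RInt_gen (V := C_R_NormedModule) f (at_right 0) (at_point t) (L t)) ->
  lim0 L (RtoC 0).
Proof.
  intros Ht0 H. apply (filterlim_of_Cmod (at_right 0)). intros eps Heps.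
  destruct (is_RInt_gen_at_right_0_elim _ _ _ (H t0 (conj Ht0 (Rle_refl _))) eps Heps)
    as [d [Hd Hs]].
  apply (at_right_0_intro _ (Rmin d t0)); [apply Rmin_glb_lt; assumption|].
  intros s [Hs1 Hs2].
  assert (s < d) by (eapply Rlt_le_trans; [exact Hs2 | apply Rmin_l]).
  assert (s < t0) by (eapply Rlt_le_trans; [exact Hs2 | apply Rmin_r]).
  destruct (Hs s) as [v [Iv Bv]]; [lra|].
  rewrite (is_RInt_C_unique _ _ _ _ _ Iv
    (is_RInt_gen_at_right_0_diff f s t0 (L s) (L t0) Hs1 Ht0
       (H s ltac:(lra)) (H t0 ltac:(lra)))) in Bv.
  replace (L s - RtoC 0)%C with (- (L t0 - L s - L t0))%C by ring.
  rewrite Cmod_opp. exact Bv.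
Qed.

Lemma primitive_is_RInt_components (f L : R -> C) (t : R) :
  (forall s, Ioo01 s ->
     is_RInt_gen (V := C_R_NormedModule) f (at_right 0) (at_point s) (L s)) ->
  Ioo01 t ->
  locally t (fun s => is_RInt (fun r => Re (f r)) t s (Re (L s) - Re (L t))) /\
  locally t (fun s => is_RInt (fun r => Im (f r)) t s (Im (L s) - Im (L t))).
Proof.
  intros H Ht.
  split; generalize (locally_Ioo01 t Ht); apply filter_imp; intros s Hs;
    assert (I := is_RInt_gen_at_right_0_diff f t s (L t) (L s) (proj1 Ht) (proj1 Hs) (H t Ht) (H s Hs)).
  - exact (is_RInt_fct_extend_fst (U := R_NormedModule) (V := R_NormedModule) f t s _ I).
  - exact (is_RInt_fct_extend_snd (U := R_NormedModule) (V := R_NormedModule) f t s _ I).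
Qed.

Lemma continuous_minus_const (f : R -> R) (c t : R) :
  continuous (fun s => f s - c) t -> continuous f t.
Proof.
  intros H.
  apply (continuous_ext (fun s => plus (f s - c) c)); [intros s; unfold plus; simpl; ring|].
  apply (continuous_plus (V := R_NormedModule)); [exact H | apply continuous_const].
Qed.

(** Integrability of [f] suffices, so this applies to a Volterra integrand before the integrand is
    known to be continuous. *)
Lemma primitive_continuous (f L : R -> C) (t : R) :
  (forall s, Ioo01 s ->
     is_RInt_gen (V := C_R_NormedModule) f (at_right 0) (at_point s) (L s)) ->
  Ioo01 t -> continuous L t.
Proof.
  intros H Ht. destruct (primitive_is_RInt_components f L t H Ht) as [Ir Ii].
  apply (filterlim_C_of_ReIm (locally t)); eapply continuous_minus_const.
  - exact (continuous_RInt_1 (V := R_NormedModule) _ _ _ _ Ir).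
  - exact (continuous_RInt_1 (V := R_NormedModule) _ _ _ _ Ii).
Qed.

Lemma is_derive_minus_const (f : R -> R) (c t l : R) :
  is_derive (fun s => f s - c) t l -> is_derive f t l.
Proof.
  intros H.
  apply (is_derive_ext (fun s => plus (f s - c) c)); [intros s; unfold plus; simpl; ring|].
  evar_last; [apply (is_derive_plus (V := R_NormedModule)); [exact H | apply is_derive_const]|].
  apply plus_zero_r.
Qed.

Lemma primitive_derive (f L : R -> C) (t : R) :
  (forall s, Ioo01 s ->
     is_RInt_gen (V := C_R_NormedModule) f (at_right 0) (at_point s) (L s)) ->
  Ioo01 t -> continuous f t -> is_dC L t (f t).
Proof.
  intros H Ht Hc. destruct (primitive_is_RInt_components f L t H Ht) as [Ir Ii].
  apply (filterlim_ReIm (locally t)) in Hc as [Hr Hi].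
  split; eapply is_derive_minus_const.
  - exact (is_derive_RInt (V := R_NormedModule) _ _ _ _ Ir Hr).
  - exact (is_derive_RInt (V := R_NormedModule) _ _ _ _ Ii Hi).
Qed.

(** Cauchy criterion at 0. With [k = K / (1 - b)], both functions [± RInt g s T - k s^(1-b)] are
    decreasing near 0, which bounds the integral over [[u, v]] by [k v^(1-b)]. *)
Lemma improper_RInt_cv (g : R -> R) (T d K b : R) :
  0 < T < 1 -> 0 < d <= T -> 0 <= b < 1 -> 0 <= K ->
  (forall t, Ioo01 t -> continuous g t) ->
  (forall t, 0 < t <= d -> Rabs (g t) <= K * Rpower t (- b)) ->
  exists l : R, filterlim (fun s => RInt g s T) (at_right 0) (locally l).
Proof.
  intros HT Hd Hb HK Hc Hg.
  set (k := K / (1 - b)).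
  assert (Hk : 0 <= k) by (apply Rmult_le_pos; [lra | left; apply Rinv_0_lt_compat; lra]).
  assert (HG : forall s, Ioo01 s -> is_derive (fun s => RInt g s T) s (- g s)).
  { intros s Hs. apply (is_derive_RInt' (V := R_NormedModule) g _ s T); [|exact (Hc s Hs)].
    generalize (locally_Ioo01 s Hs). apply filter_imp. intros r Hr.
    apply (RInt_correct (V := R_CompleteNormedModule)), (ex_RInt_continuous (V := R_CompleteNormedModule)).
    intros z Hz. apply Hc. unfold Ioo01 in *.
    assert (0 < Rmin r T) by (apply Rmin_glb_lt; lra).
    assert (Rmax r T < 1) by (apply Rmax_lub_lt; lra). lra. }
  assert (Hp : forall s, 0 < s -> is_derive (fun s => k * Rpower s (1 - b)) s (K * Rpower s (- b))).
  { intros s Hs. evar_last; [apply is_derive_scal, (is_derive_Rpower (1 - b) s Hs)|].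
    replace (1 - b - 1) with (- b) by ring. unfold k. simpl. field. lra. }
  assert (Hdiff : forall u v, 0 < u <= v -> v <= d ->
    Rabs (RInt g v T - RInt g u T) <= k * Rpower v (1 - b)).
  { intros u v Hu Hv.
    assert (Hpu : 0 <= k * Rpower u (1 - b))
      by (apply Rmult_le_pos; [exact Hk | left; apply exp_pos]).
    apply Rabs_le. split.
    - enough (- RInt g v T - k * Rpower v (1 - b) <= - RInt g u T - k * Rpower u (1 - b)) by lra.
      apply (is_derive_nonpos_decreasing (fun s => - RInt g s T - k * Rpower s (1 - b))
        (fun s => g s - K * Rpower s (- b)) d); try assumption.
      intros t Ht. split.
      + evar_last.
        * apply (is_derive_minus (V := R_NormedModule));
            [apply (is_derive_opp (V := R_NormedModule)), HG; unfold Ioo01; lra | apply Hp, Ht].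
        * unfold minus, plus, opp; simpl. ring.
      + specialize (Hg t Ht). assert (H := Rle_abs (g t)). lra.
    - enough (RInt g v T - k * Rpower v (1 - b) <= RInt g u T - k * Rpower u (1 - b)) by lra.
      apply (is_derive_nonpos_decreasing (fun s => RInt g s T - k * Rpower s (1 - b))
        (fun s => - g s - K * Rpower s (- b)) d); try assumption.
      intros t Ht. split.
      + apply (is_derive_minus (V := R_NormedModule));
            [apply HG; unfold Ioo01; lra | apply Hp, Ht].
      + specialize (Hg t Ht). assert (H := Rle_abs (- g t)). rewrite Rabs_Ropp in H. lra. }
  apply (filterlim_locally_cauchy (U := R_CompleteSpace)). intros eps.
  assert (Hz : filterlim (fun s => k * Rpower s (1 - b)) (at_right 0) (locally (k * 0))).
  { apply (filterlim_Rmult (at_right 0)); [apply filterlim_const | apply filterlim_Rpower_0; lra]. }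
  rewrite Rmult_0_r in Hz.
  exists (fun s => 0 < s < d /\ ball 0 eps (k * Rpower s (1 - b))). split.
  - apply filter_and; [apply at_right_0_small, Hd | apply Hz, locally_ball].
  - assert (Hball : forall s, ball 0 eps (k * Rpower s (1 - b)) -> k * Rpower s (1 - b) < eps).
    { intros s Hs. change (Rabs (k * Rpower s (1 - b) - 0) < eps) in Hs.
      assert (H := Rle_abs (k * Rpower s (1 - b) - 0)). lra. }
    intros u v [Hu Bu] [Hv Bv]. apply Hball in Bu, Bv.
    change (Rabs (RInt g v T - RInt g u T) < eps).
    destruct (Rle_dec u v) as [Huv | Huv].
    + eapply Rle_lt_trans; [apply Hdiff; lra | exact Bv].
    + rewrite Rabs_minus_sym. eapply Rle_lt_trans; [apply Hdiff; lra | exact Bu].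
Qed.

Lemma primitive_exists (f : R -> C) (d K b : R) :
  0 < d -> 0 <= b < 1 -> 0 <= K ->
  (forall t, Ioo01 t -> continuous f t) ->
  (forall t, 0 < t <= d -> Cmod (f t) <= K * Rpower t (- b)) ->
  exists L : R -> C, forall t, Ioo01 t ->
    is_RInt_gen (V := C_R_NormedModule) f (at_right 0) (at_point t) (L t).
Proof.
  intros Hd Hb HK Hc Hf.
  set (e := Rmin d (/ 2)).
  assert (He : 0 < e <= / 2 /\ e <= d).
  { unfold e. repeat split; [apply Rmin_glb_lt; lra | apply Rmin_r | apply Rmin_l]. }
  assert (Hcr : forall t, Ioo01 t -> continuous (fun s => Re (f s)) t)
    by (intros t Ht; exact (proj1 (filterlim_ReIm (locally t) _ _ (Hc t Ht)))).
  assert (Hci : forall t, Ioo01 t -> continuous (fun s => Im (f s)) t)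
    by (intros t Ht; exact (proj2 (filterlim_ReIm (locally t) _ _ (Hc t Ht)))).
  destruct (improper_RInt_cv (fun s => Re (f s)) (/ 2) e K b) as [lr Hlr]; try assumption; try lra.
  { intros t Ht. eapply Rle_trans; [apply re_le_Cmod | apply Hf; lra]. }
  destruct (improper_RInt_cv (fun s => Im (f s)) (/ 2) e K b) as [li Hli]; try assumption; try lra.
  { intros t Ht. eapply Rle_trans; [apply im_le_Cmod | apply Hf; lra]. }
  assert (Hex : forall g : R -> R, (forall t, Ioo01 t -> continuous g t) ->
    forall s t, Ioo01 s -> Ioo01 t -> is_RInt g s t (RInt g s t)).
  { intros g Hg s t Hs Ht.
    apply (RInt_correct (V := R_CompleteNormedModule)), (ex_RInt_continuous (V := R_CompleteNormedModule)).
    intros z Hz. apply Hg. unfold Ioo01 in *.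
    assert (0 < Rmin s t) by (apply Rmin_glb_lt; lra).
    assert (Rmax s t < 1) by (apply Rmax_lub_lt; lra). lra. }
  assert (Hhalf : Ioo01 (/ 2)) by (unfold Ioo01; lra).
  (* The improper integral over [(0, 1/2]] plus the proper integral from [1/2] to [t], on either
     side of [1/2]; the base point is arbitrary in [(0, 1)]. *)
  exists (fun t => (lr + RInt (fun s => Re (f s)) (/ 2) t, li + RInt (fun s => Im (f s)) (/ 2) t)).
  intros t Ht P HP.
  set (J := fun s : R => ((RInt (fun s => Re (f s)) s (/ 2) + RInt (fun s => Re (f s)) (/ 2) t,
      RInt (fun s => Im (f s)) s (/ 2) + RInt (fun s => Im (f s)) (/ 2) t) : C)).
  assert (HJ : at_right 0 (fun s => P (J s))).
  { revert P HP. change (filterlim J (at_right 0) (locally (T := C_UniformSpace)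
      (lr + RInt (fun s => Re (f s)) (/ 2) t, li + RInt (fun s => Im (f s)) (/ 2) t))).
    apply (filterlim_C_of_ReIm (at_right 0)); simpl; apply (filterlim_Rplus (at_right 0));
      try assumption; apply filterlim_const. }
  apply (Filter_prod _ _ _ (fun s => 0 < s < 1 /\ P (J s)) (fun s => s = t)).
  - apply filter_and; [apply at_right_0_small; lra | exact HJ].
  - reflexivity.
  - intros s r [Hs HPs] ->. exists (J s). split; [|exact HPs]. simpl fst; simpl snd.
    apply (is_RInt_fct_extend_pair (U := R_NormedModule) (V := R_NormedModule) f).
    + exact (is_RInt_Chasles (V := R_NormedModule) _ _ _ _ _ _
        (Hex _ Hcr s (/ 2) Hs Hhalf) (Hex _ Hcr (/ 2) t Hhalf Ht)).
    + exact (is_RInt_Chasles (V := R_NormedModule) _ _ _ _ _ _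
        (Hex _ Hci s (/ 2) Hs Hhalf) (Hex _ Hci (/ 2) t Hhalf Ht)).
Qed.

(** * Behaviour near the edge x = 0 *)

Lemma continuous_on_D_eps (g : R * R -> C) (x y eps : R) :
  continuous_on Defs.D g -> Defs.D (x, y) -> 0 < eps ->
  exists d, 0 < d /\ forall u v, Defs.D (u, v) -> Rabs (u - x) < d -> Rabs (v - y) < d ->
    Cmod (g (u, v) - g (x, y))%C < eps.
Proof.
  intros Hg Hxy Heps.
  destruct (filterlim_Cmod (within Defs.D (locally (x, y))) g _ (Hg (x, y) Hxy) eps Heps) as [d Hd].
  exists d. split; [apply cond_pos|]. intros u v Huv Hu Hv.
  apply (Hd (u, v)); [split; assumption | exact Huv].
Qed.

(** Compactness of the segment [{0} x [0, y0]] makes the width of the strip independent of [y].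
    Stopping at [y0 < 1] is essential: near [(0, 1)] continuity on [D] gives no uniformity. *)
Lemma continuous_on_D_near_edge (g : R * R -> C) (y0 eps : R) :
  continuous_on Defs.D g -> 0 <= y0 < 1 -> 0 < eps ->
  exists d K, 0 < d < 1 - y0 /\ 0 <= K /\
    forall x y, 0 <= x < d -> 0 <= y <= y0 ->
      Cmod (g (x, y) - g (0, y))%C < eps /\ Cmod (g (x, y)) <= K.
Proof.
  intros Hg Hy0 Heps.
  (* The last clause makes the Lebesgue number of the cover bound [g] as well. *)
  set (P := fun (t : R) (d : posreal) => 0 <= t <= y0 ->
    (forall u v, Defs.D (u, v) -> Rabs u < d -> Rabs (v - t) < d ->
      Cmod (g (u, v) - g (0, t))%C < eps / 2) /\ d * (1 + Cmod (g (0, t))) <= 1).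
  assert (HP : forall t, exists d, P t d).
  { intros t. destruct (Rle_dec 0 t) as [H0|H0]; [destruct (Rle_dec t y0) as [H1|H1]|].
    - destruct (continuous_on_D_eps g 0 t (eps / 2) Hg) as [d [Hd Hgd]];
        [unfold Defs.D; simpl; lra | lra|].
      assert (Hpos := Cmod_ge_0 (g (0, t))).
      assert (Hinv : 0 < / (1 + Cmod (g (0, t)))) by (apply Rinv_0_lt_compat; lra).
      assert (Hmin : 0 < Rmin d (/ (1 + Cmod (g (0, t))))) by (apply Rmin_glb_lt; assumption).
      exists (mkposreal _ Hmin). intros _. simpl. split.
      + intros u v Huv Hu Hv. apply Hgd; [exact Huv| |].
        * rewrite Rminus_0_r. eapply Rlt_le_trans; [exact Hu | apply Rmin_l].
        * eapply Rlt_le_trans; [exact Hv | apply Rmin_l].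
      + apply Rle_trans with (/ (1 + Cmod (g (0, t))) * (1 + Cmod (g (0, t)))).
        * apply Rmult_le_compat_r; [lra | apply Rmin_r].
        * right. apply Rinv_l. lra.
    - exists (mkposreal 1 Rlt_0_1). intros [_ H]; lra.
    - exists (mkposreal 1 Rlt_0_1). intros [H _]; lra. }
  pose (delta := fun t => proj1_sig (constructive_indefinite_description _ (HP t))).
  assert (Hdelta : forall t, P t (delta t))
    by (intros t; exact (proj2_sig (constructive_indefinite_description _ (HP t)))).
  destruct (compactness_value_1d 0 y0 delta) as [d Hcov].
  assert (Hdpos := cond_pos d).
  (* The second bound keeps the strip [x < e], [y <= y0] inside [D]. *)
  set (e := Rmin d ((1 - y0) / 2)).
  assert (He : 0 < e <= d /\ e < 1 - y0).
  { assert (0 < e) by (apply Rmin_glb_lt; lra).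
    assert (e <= (1 - y0) / 2) by apply Rmin_r.
    assert (e <= d) by apply Rmin_l. lra. }
  (* [/ d] bounds [|g (0, t)|] at the centres [t] used below, since [d <= delta t] and
     [delta t (1 + |g (0, t)|) <= 1]. *)
  exists e, (/ d + eps).
  split; [lra|]. split; [assert (0 < / d) by (apply Rinv_0_lt_compat; lra); lra|].
  intros x y Hx Hy.
  assert (Hgoal : Cmod (g (x, y) - g (0, y))%C < eps /\ Cmod (g (x, y)) < / d + eps).
  (* [compactness_value_1d] provides the centre [t] near [y] only under a double negation. *)
  { apply NNPP. intros Hn. apply (Hcov y Hy). intros [t [Ht [Hyt Hdt]]]. apply Hn.
    destruct (Hdelta t Ht) as [Hclose Hbd].
    assert (B1 : Cmod (g (x, y) - g (0, t))%C < eps / 2).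
    { apply Hclose; [unfold Defs.D; simpl; lra| rewrite Rabs_right; lra | exact Hyt]. }
    assert (B2 : Cmod (g (0, y) - g (0, t))%C < eps / 2).
    { apply Hclose; [unfold Defs.D; simpl; lra| rewrite Rabs_R0; apply cond_pos | exact Hyt]. }
    split.
    - replace (g (x, y) - g (0, y))%C
        with ((g (x, y) - g (0, t)) + - (g (0, y) - g (0, t)))%C by ring.
      eapply Rle_lt_trans; [apply Cmod_triangle|]. rewrite Cmod_opp. lra.
    - replace (g (x, y)) with ((g (x, y) - g (0, t)) + g (0, t))%C by ring.
      eapply Rle_lt_trans; [apply Cmod_triangle|].
      assert (Hpos := Cmod_ge_0 (g (0, t))).
      assert (Cmod (g (0, t)) <= / d).
      { apply Rmult_le_reg_l with d; [exact Hdpos|]. rewrite Rinv_r by lra.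
        assert (Hm : d * (1 + Cmod (g (0, t))) <= delta t * (1 + Cmod (g (0, t))))
          by (apply Rmult_le_compat_r; lra). lra. }
      lra. }
  split; [apply Hgoal | left; apply Hgoal].
Qed.

(* Mean value argument: [phi] is only differentiated off the edge [x = 0]. *)
Lemma is_derive_on_edge (phi psi : R -> R -> R) (y l : R) :
  0 < y < 1 ->
  (forall u v, intD (u, v) -> is_derive (fun s => phi u s) v (psi u v)) ->
  (forall v, 0 < v < 1 -> forall eps, 0 < eps -> exists d, 0 < d /\
     forall u, 0 < u < d -> Rabs (phi u v - phi 0 v) < eps) ->
  (forall eps, 0 < eps -> exists d, 0 < d /\ forall u v, intD (u, v) ->
     u < d -> Rabs (v - y) < d -> Rabs (psi u v - l) < eps) ->
  is_derive (fun s => phi 0 s) y l.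
Proof.
  intros Hy Hder Hphi Hpsi. apply is_derive_Reals. intros eps Heps.
  destruct (Hpsi (eps / 2)) as [d [Hd Hl]]; [lra|].
  (* For [u < e] and [|v - y| < e] the point [(u, v)] satisfies [v > 0] and [u + v < y + 2 e <= 1],
     so the mean value theorem is applied inside the open triangle. *)
  set (e := Rmin d (Rmin y (1 - y) / 2)).
  assert (He : 0 < e /\ e <= d /\ e <= y / 2 /\ e <= (1 - y) / 2).
  { assert (Hm1 := Rmin_l y (1 - y)). assert (Hm2 := Rmin_r y (1 - y)).
    assert (Hm3 := Rmin_l d (Rmin y (1 - y) / 2)). assert (Hm4 := Rmin_r d (Rmin y (1 - y) / 2)).
    assert (0 < Rmin y (1 - y)) by (apply Rmin_glb_lt; lra).
    assert (0 < e) by (apply Rmin_glb_lt; lra). unfold e in *. lra. }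
  exists (mkposreal e (proj1 He)). simpl. intros h Hh Hhe.
  assert (Hh2 := Rabs_def2 _ _ Hhe).
  assert (Hah : 0 < Rabs h) by (apply Rabs_pos_lt, Hh).
  enough (Hle : Rabs (phi 0 (y + h) - phi 0 y - l * h) <= eps / 2 * Rabs h).
  { replace ((phi 0 (y + h) - phi 0 y) / h - l) with ((phi 0 (y + h) - phi 0 y - l * h) / h)
      by (field; exact Hh).
    unfold Rdiv. rewrite Rabs_mult, Rabs_inv.
    apply Rle_lt_trans with (eps / 2 * Rabs h * / Rabs h).
    - apply Rmult_le_compat_r; [left; apply Rinv_0_lt_compat, Hah | exact Hle].
    - rewrite Rmult_assoc, Rinv_r by lra. lra. }
  (* [eta] pays for replacing the edge by a line [u > 0] at the two end points. The range of [h] was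
     fixed before [u] was chosen, so [u] may depend on [h] and [eta], and [eta] disappears at the
     end. *)
  apply Rle_plus_epsilon. intros eta Heta.
  destruct (Hphi y Hy (eta / 2)) as [d1 [Hd1 B1]]; [lra|].
  destruct (Hphi (y + h) ltac:(lra) (eta / 2)) as [d2 [Hd2 B2]]; [lra|].
  set (u := Rmin (Rmin d1 d2) e / 2).
  assert (Hu : 0 < u /\ u < d1 /\ u < d2 /\ u < e).
  { assert (Hm1 := Rmin_l d1 d2). assert (Hm2 := Rmin_r d1 d2).
    assert (Hm3 := Rmin_l (Rmin d1 d2) e). assert (Hm4 := Rmin_r (Rmin d1 d2) e).
    assert (0 < Rmin d1 d2) by (apply Rmin_glb_lt; lra).
    assert (0 < Rmin (Rmin d1 d2) e) by (apply Rmin_glb_lt; lra). unfold u. lra. }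
  assert (Hbox : forall v, Rmin y (y + h) <= v <= Rmax y (y + h) ->
    intD (u, v) /\ Rabs (v - y) < d).
  { intros v Hv.
    assert (Hv' : y - e < v < y + e).
    { assert (y - e < Rmin y (y + h)) by (apply Rmin_glb_lt; lra).
      assert (Rmax y (y + h) < y + e) by (apply Rmax_lub_lt; lra). lra. }
    split; [unfold intD; simpl; lra | apply Rabs_def1; lra]. }
  destruct (MVT_gen (fun s => phi u s) y (y + h) (psi u)) as [c [Hc Heq]].
  - intros v Hv. apply Hder, Hbox. lra.
  - intros v Hv. apply continuity_pt_filterlim, (ex_derive_continuous (V := R_NormedModule)).
    eexists. apply Hder, Hbox, Hv.
  - destruct (Hbox c Hc) as [HcD Hcy].
    specialize (B1 u ltac:(lra)). specialize (B2 u ltac:(lra)).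
    specialize (Hl u c HcD ltac:(lra) Hcy).
    replace (phi 0 (y + h) - phi 0 y - l * h) with
      (- (phi u (y + h) - phi 0 (y + h)) + (phi u y - phi 0 y) + (psi u c - l) * h)
      by (replace (y + h - y) with h in Heq by ring; lra).
    eapply Rle_trans; [apply Rabs_triang|]. rewrite Rabs_mult.
    assert (Rabs (- (phi u (y + h) - phi 0 (y + h)) + (phi u y - phi 0 y)) <= eta).
    { eapply Rle_trans; [apply Rabs_triang|]. rewrite Rabs_Ropp. lra. }
    assert (Rabs (psi u c - l) * Rabs h <= eps / 2 * Rabs h)
      by (apply Rmult_le_compat_r; lra).
    lra.
Qed.

Lemma filterlim_within_of {T U} (S : T -> Prop) (F : (T -> Prop) -> Prop) {FF : Filter F}
    (G : (U -> Prop) -> Prop) (f : T -> U) :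
  filterlim f F G -> filterlim f (within S F) G.
Proof. intros Hf P HP. exact (filter_imp (fun x => P (f x)) _ (fun x h _ => h) (Hf P HP)). Qed.

(** Identifies the trace of the extension [g] with the weighted derivative of the boundary values:
    on [0 < y] the weight can be divided out, so [dy F] itself extends continuously up to the edge,
    and [is_derive_on_edge] applies to real and imaginary parts. *)
Lemma is_dC_on_edge (F : R -> R -> C) (g : R * R -> C) (b : R) :
  C_D F -> continuous_on Defs.D g ->
  (forall u v, intD (u, v) -> is_dC (F u) v (dy F u v)) ->
  (forall p, intD p -> g p = (RtoC (Rpower (snd p) b) * dy F (fst p) (snd p))%C) ->
  forall y, Ioo01 y -> is_dC (F 0) y (RtoC (Rpower y (- b)) * g (0, y))%C.
Proof.
  intros HF Hg Hder Hgw y Hy. unfold Ioo01 in Hy.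
  set (w := fun p : R * R => (RtoC (Rpower (snd p) (- b)) * g p)%C).
  assert (Hw : filterlim w (within Defs.D (locally (0, y))) (locally (w (0, y)))).
  { apply (filterlim_Cmult (within Defs.D (locally (0, y)))).
    - apply (filterlim_RtoC (within Defs.D (locally (0, y)))).
      apply (filterlim_Rcont (within Defs.D (locally (0, y))) (fun s => Rpower s (- b)) snd y).
      + apply (ex_derive_continuous (V := R_NormedModule)). eexists.
        apply is_derive_Rpower, Hy.
      + exact (filterlim_within_of Defs.D (locally (0, y)) _ _
          (continuous_snd (U := R_UniformSpace) (V := R_UniformSpace) 0 y)).
    - apply Hg. unfold Defs.D; simpl; lra. }
  assert (Hdw : forall u v, intD (u, v) -> dy F u v = w (u, v)).
  { intros u v Huv. unfold w. rewrite (Hgw _ Huv). simpl.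
    rewrite Cmult_assoc, <- RtoC_mult, <- Rpower_plus.
    replace (- b + b) with 0 by ring. rewrite Rpower_O by apply Huv. ring. }
  assert (HlimF : forall v, 0 < v < 1 -> forall eps, 0 < eps -> exists d, 0 < d /\
    forall u, 0 < u < d -> Cmod (F u v - F 0 v)%C < eps).
  { intros v Hv eps Heps.
    destruct (continuous_on_D_eps _ 0 v eps HF) as [d [Hd H]];
      [unfold Defs.D; simpl; lra | exact Heps|].
    exists (Rmin d (1 - v)). split; [apply Rmin_glb_lt; lra|]. intros u Hu.
    assert (u < d) by (eapply Rlt_le_trans; [apply Hu | apply Rmin_l]).
    assert (u < 1 - v) by (eapply Rlt_le_trans; [apply Hu | apply Rmin_r]).
    apply (H u v); [unfold Defs.D; simpl; lra | rewrite Rabs_right; lra |].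
    rewrite Rminus_diag, Rabs_R0. exact Hd. }
  assert (Hlimw : forall eps, 0 < eps -> exists d, 0 < d /\ forall u v, intD (u, v) ->
     u < d -> Rabs (v - y) < d -> Cmod (dy F u v - w (0, y))%C < eps).
  { intros eps Heps.
    destruct (filterlim_Cmod (within Defs.D (locally (0, y))) _ _ Hw eps Heps) as [d Hd].
    exists d. split; [apply cond_pos|]. intros u v Huv Hu Hv. rewrite (Hdw u v Huv).
    unfold intD in Huv; simpl in Huv.
    apply (Hd (u, v)); [split | unfold Defs.D; simpl; lra].
    - change (Rabs (u - 0) < d). rewrite Rminus_0_r, Rabs_right; lra.
    - exact Hv. }
  change (RtoC (Rpower y (- b)) * g (0%R, y))%C with (w (0, y)).
  split.
  - apply (is_derive_on_edge (fun u v => Re (F u v)) (fun u v => Re (dy F u v))); [exact Hy| | |].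
    + intros u v Huv. apply (Hder u v Huv).
    + intros v Hv eps Heps. destruct (HlimF v Hv eps Heps) as [d [Hd H]].
      exists d. split; [exact Hd|]. intros u Hu.
      eapply Rle_lt_trans; [apply (re_le_Cmod (F u v - F 0 v)%C) | apply H, Hu].
    + intros eps Heps. destruct (Hlimw eps Heps) as [d [Hd H]].
      exists d. split; [exact Hd|]. intros u v Huv Hu Hv.
      eapply Rle_lt_trans; [apply (re_le_Cmod (dy F u v - w (0%R, y))%C) | apply H; assumption].
  - apply (is_derive_on_edge (fun u v => Im (F u v)) (fun u v => Im (dy F u v))); [exact Hy| | |].
    + intros u v Huv. apply (Hder u v Huv).
    + intros v Hv eps Heps. destruct (HlimF v Hv eps Heps) as [d [Hd H]].
      exists d. split; [exact Hd|]. intros u Hu.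
      eapply Rle_lt_trans; [apply (im_le_Cmod (F u v - F 0 v)%C) | apply H, Hu].
    + intros eps Heps. destruct (Hlimw eps Heps) as [d [Hd H]].
      exists d. split; [exact Hd|]. intros u v Huv Hu Hv.
      eapply Rle_lt_trans; [apply (im_le_Cmod (dy F u v - w (0%R, y))%C) | apply H; assumption].
Qed.

Lemma near_edge_bounded (g : R * R -> C) (y0 : R) :
  continuous_on Defs.D g -> 0 <= y0 < 1 ->
  exists K, 0 <= K /\ (forall y, 0 <= y <= y0 -> Cmod (g (0, y)) <= K) /\
    at_right 0 (fun x => forall y, 0 <= y <= y0 -> Cmod (g (x, y)) <= K).
Proof.
  intros Hg Hy0.
  destruct (continuous_on_D_near_edge g y0 1 Hg Hy0 Rlt_0_1) as [d [K [Hd [HK H]]]].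
  exists K. split; [exact HK|]. split.
  - intros y Hy. apply H; lra.
  - apply (at_right_0_intro _ d); [lra|]. intros x Hx y Hy. apply H; lra.
Qed.

Lemma near_edge_close (g : R * R -> C) (y0 eps : R) :
  continuous_on Defs.D g -> 0 <= y0 < 1 -> 0 < eps ->
  at_right 0 (fun x => forall y, 0 <= y <= y0 -> Cmod (g (x, y) - g (0, y))%C < eps).
Proof.
  intros Hg Hy0 Heps.
  destruct (continuous_on_D_near_edge g y0 eps Hg Hy0 Heps) as [d [K [Hd [_ H]]]].
  apply (at_right_0_intro _ d); [lra|]. intros x Hx y Hy. apply H; lra.
Qed.

Lemma Cmod_scal_le (r M : R) (z : C) :
  0 <= r -> Cmod z <= M -> Cmod (RtoC r * z)%C <= r * M.
Proof.
  intros Hr Hz. rewrite Cmod_mult, Cmod_R, Rabs_right by lra.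
  apply Rmult_le_compat_l; assumption.
Qed.

Lemma Cmod_mult_le (z w : C) (a b : R) : Cmod z <= a -> Cmod w <= b -> Cmod (z * w)%C <= a * b.
Proof.
  intros Hz Hw. rewrite Cmod_mult. apply Rmult_le_compat; try apply Cmod_ge_0; assumption.
Qed.

(** Gronwall is used twice: on the edge system alone to bound [(pe, qe)] on [(0, T]], then on the
    difference from [(p x, q x)]. The second application compares directly with the given edge
    solution, so no compactness or uniqueness argument for the limit is involved. *)
Lemma linear_system_edge_limit (b alpha : R) (A11 A12 A21 A22 G1 G2 : R * R -> C)
    (p q : R -> R -> C) (p0 q0 pe qe : R -> C) (m n : C) :
  0 <= b < 1 -> 0 < alpha ->
  continuous_on Defs.D A11 -> continuous_on Defs.D A12 ->
  continuous_on Defs.D A21 -> continuous_on Defs.D A22 ->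
  continuous_on Defs.D G1 -> continuous_on Defs.D G2 ->
  (forall x y, intD (x, y) ->
     is_dC (p x) y (RtoC (Rpower y (- b)) * (A11 (x, y) * p x y + A12 (x, y) * q x y
        + RtoC (Rpower x alpha) * G1 (x, y)))%C /\
     is_dC (q x) y (RtoC (Rpower y (- b)) * (A21 (x, y) * p x y + A22 (x, y) * q x y
        + RtoC (Rpower x alpha) * G2 (x, y)))%C) ->
  (forall y, Ioo01 y ->
     is_dC pe y (RtoC (Rpower y (- b)) * (A11 (0, y) * pe y + A12 (0, y) * qe y))%C /\
     is_dC qe y (RtoC (Rpower y (- b)) * (A21 (0, y) * pe y + A22 (0, y) * qe y))%C) ->
  (forall x, Ioo01 x -> lim0 (p x) (p0 x) /\ lim0 (q x) (q0 x)) ->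
  lim0 p0 m -> lim0 q0 n -> lim0 pe m -> lim0 qe n ->
  forall T, Ioo01 T -> lim0 (fun x => p x T) (pe T) /\ lim0 (fun x => q x T) (qe T).
Proof.
  intros Hb Halpha C11 C12 C21 C22 CG1 CG2 Hpq Hedge Hlim Hp0 Hq0 Hpe Hqe T HT.
  unfold Ioo01 in HT.
  destruct (near_edge_bounded A11 T C11) as [K1 [K1p [B11 N11]]]; [lra|].
  destruct (near_edge_bounded A12 T C12) as [K2 [K2p [B12 N12]]]; [lra|].
  destruct (near_edge_bounded A21 T C21) as [K3 [K3p [B21 N21]]]; [lra|].
  destruct (near_edge_bounded A22 T C22) as [K4 [K4p [B22 N22]]]; [lra|].
  destruct (near_edge_bounded G1 T CG1) as [K5 [K5p [_ NG1]]]; [lra|].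
  destruct (near_edge_bounded G2 T CG2) as [K6 [K6p [_ NG2]]]; [lra|].
  set (K := K1 + K2 + K3 + K4 + K5 + K6).
  assert (HK : K1 <= K /\ K2 <= K /\ K3 <= K /\ K4 <= K /\ K5 <= K /\ K6 <= K /\ 0 <= K)
    by (unfold K; lra).
  clearbody K.
  set (Ex := exp ((4 * K + 1) / (1 - b))).
  assert (HEx : 1 <= Ex).
  { unfold Ex. rewrite <- exp_0 at 1. apply exp_le. apply Rmult_le_pos; [lra|].
    left; apply Rinv_0_lt_compat; lra. }
  assert (Hw : forall y, 0 < Rpower y (- b)) by (intros y; apply exp_pos).
  (* The second summand is the Gronwall bound for [|pe|^2 + |qe|^2]; the inequality [s <= 1 + s^2]
     turns it into a bound for the moduli. *)
  set (M := 1 + (Cmod m ^ 2 + Cmod n ^ 2 + 2 * 0 ^ 2) * Ex).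
  assert (HM : forall y, 0 < y <= T -> Cmod (pe y) <= M /\ Cmod (qe y) <= M).
  { intros y Hy.
    assert (HN : Cmod (pe y) ^ 2 + Cmod (qe y) ^ 2 <= (Cmod m ^ 2 + Cmod n ^ 2 + 2 * 0 ^ 2) * Ex).
    { refine (gronwall_C2 pe qe _ _ m n T b K 0 _ Hb _ _ _ Hpe Hqe y Hy); try lra.
      intros t Ht. destruct (Hedge t) as [D1 D2]; [unfold Ioo01; lra|].
      split; [exact D1|]. split; [exact D2|].
      assert (P1 := Cmod_ge_0 (pe t)). assert (P2 := Cmod_ge_0 (qe t)).
      specialize (B11 t ltac:(lra)). specialize (B12 t ltac:(lra)).
      specialize (B21 t ltac:(lra)). specialize (B22 t ltac:(lra)).
      split; apply Cmod_scal_le; try (left; apply Hw); rewrite Rplus_0_r;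
        (eapply Rle_trans; [apply Cmod_triangle|]); apply Rplus_le_compat;
        apply Cmod_mult_le; lra. }
    assert (P1 := pow2_ge_0 (Cmod (pe y))). assert (P2 := pow2_ge_0 (Cmod (qe y))).
    unfold M. split.
    - assert (0 <= (Cmod (pe y) - 1) ^ 2) by apply pow2_ge_0. nra.
    - assert (0 <= (Cmod (qe y) - 1) ^ 2) by apply pow2_ge_0. nra. }
  assert (HM1 : 1 <= M).
  { unfold M. assert (P1 := pow2_ge_0 (Cmod m)). assert (P2 := pow2_ge_0 (Cmod n)).
    assert (0 <= (Cmod m ^ 2 + Cmod n ^ 2 + 2 * 0 ^ 2) * Ex) by (apply Rmult_le_pos; lra). lra. }
  clearbody M.
  assert (Hmain : forall eta, 0 < eta -> at_right 0 (fun x =>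
    Cmod (p x T - pe T)%C < eta /\ Cmod (q x T - qe T)%C < eta)).
  { intros eta Heta.
    (* [z] bounds each initial error and the inhomogeneity of the difference system, so the squared
       difference stays below [4 z^2 Ex = eta^2 / Ex <= eta^2]. The inhomogeneity is shared in
       thirds: two coefficient errors multiplied by [M], and the source multiplied by [x^alpha]. *)
    set (z := eta / (2 * Ex)).
    assert (Hz : 0 < z) by (apply Rdiv_lt_0_compat; lra).
    assert (Hz3 : 0 < z / (3 * M)) by (apply Rdiv_lt_0_compat; lra).
    assert (Hpow : at_right 0 (fun x => Rpower x alpha < z / (3 * (K + 1)))).
    { assert (Hpos : 0 < z / (3 * (K + 1))) by (apply Rdiv_lt_0_compat; lra).
      assert (HB : at_right 0 (fun x => ball 0 (mkposreal _ Hpos) (Rpower x alpha)))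
        by exact (filterlim_Rpower_0 alpha Halpha _ (locally_ball 0 (mkposreal _ Hpos))).
      revert HB. apply filter_imp. intros x Hx. change (Rabs (Rpower x alpha - 0) < z / (3 * (K + 1))) in Hx.
      assert (H := Rle_abs (Rpower x alpha - 0)). lra. }
    assert (HT0 : 0 <= T < 1) by lra. assert (HT1 : 0 < 1 - T) by lra.
    assert (L11 := near_edge_close A11 T _ C11 HT0 Hz3).
    assert (L12 := near_edge_close A12 T _ C12 HT0 Hz3).
    assert (L21 := near_edge_close A21 T _ C21 HT0 Hz3).
    assert (L22 := near_edge_close A22 T _ C22 HT0 Hz3).
    assert (Bp0 := filterlim_Cmod (at_right 0) p0 m Hp0 z Hz).
    assert (Bq0 := filterlim_Cmod (at_right 0) q0 n Hq0 z Hz).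
    assert (Hx := at_right_0_small (1 - T) HT1).
    generalize (filter_and _ _ (filter_and _ _ N11 (filter_and _ _ N12 (filter_and _ _ N21 N22)))
      (filter_and _ _ (filter_and _ _ NG1 NG2)
      (filter_and _ _ (filter_and _ _ L11 (filter_and _ _ L12 (filter_and _ _ L21 L22)))
      (filter_and _ _ Hpow (filter_and _ _ (filter_and _ _ Bp0 Bq0) Hx))))).
    apply filter_imp. clear N11 N12 N21 N22 NG1 NG2 Hpow L11 L12 L21 L22 Bp0 Bq0 Hx.
    intros x [[N11 [N12 [N21 N22]]] [[NG1 NG2] [[L11 [L12 [L21 L22]]] [Hpow [[Bp0 Bq0] Hx]]]]].
    assert (Hxp : 0 < Rpower x alpha) by apply exp_pos.
    assert (HxI : Ioo01 x) by (unfold Ioo01; lra).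
    destruct (Hlim x HxI) as [Hpx Hqx].
    set (u := fun y => (p x y - pe y)%C). set (v := fun y => (q x y - qe y)%C).
    assert (HN : Cmod (u T) ^ 2 + Cmod (v T) ^ 2 <=
      (Cmod (p0 x - m)%C ^ 2 + Cmod (q0 x - n)%C ^ 2 + 2 * z ^ 2) * Ex).
    { refine (gronwall_C2 u v _ _ _ _ T b K z _ Hb _ _ _
        (filterlim_Cminus (at_right 0) _ _ _ _ Hpx Hpe)
        (filterlim_Cminus (at_right 0) _ _ _ _ Hqx Hqe) T _); try lra.
      intros t Ht. destruct (Hedge t) as [D1 D2]; [unfold Ioo01; lra|].
      destruct (Hpq x t) as [D3 D4]; [unfold intD; simpl; lra|].
      split; [exact (is_dC_minus _ _ _ _ _ D3 D1)|].
      split; [exact (is_dC_minus _ _ _ _ _ D4 D2)|].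
      destruct (HM t Ht) as [M1 M2].
      assert (Htt : 0 <= t <= T) by lra.
      specialize (N11 t Htt). specialize (N12 t Htt). specialize (N21 t Htt).
      specialize (N22 t Htt). specialize (L11 t Htt). specialize (L12 t Htt).
      specialize (L21 t Htt). specialize (L22 t Htt). specialize (NG1 t Htt). specialize (NG2 t Htt).
      (* Splitting [a p - a' pe = a (p - pe) + (a - a') pe] puts the coefficient error on the edge
         solution, so only that solution needs an a priori bound. *)
      assert (Hest : forall a a' c c' g : C, Cmod a <= K -> Cmod c <= K -> Cmod g <= K ->
        Cmod (a - a')%C < z / (3 * M) -> Cmod (c - c')%C < z / (3 * M) ->
        Cmod (RtoC (Rpower t (- b)) * (a * p x t + c * q x t + RtoC (Rpower x alpha) * g) -
          RtoC (Rpower t (- b)) * (a' * pe t + c' * qe t))%C <=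
        Rpower t (- b) * (K * Cmod (u t) + K * Cmod (v t) + z)).
      { intros a a' c c' g Ha Hc Hg Haa Hcc.
        replace (RtoC (Rpower t (- b)) * (a * p x t + c * q x t + RtoC (Rpower x alpha) * g) -
          RtoC (Rpower t (- b)) * (a' * pe t + c' * qe t))%C
          with (RtoC (Rpower t (- b)) * (a * u t + c * v t +
            ((a - a') * pe t + (c - c') * qe t + RtoC (Rpower x alpha) * g)))%C
          by (unfold u, v; ring).
        apply Cmod_scal_le; [left; apply Hw|].
        assert (Pu := Cmod_ge_0 (u t)). assert (Pv := Cmod_ge_0 (v t)).
        eapply Rle_trans; [apply Cmod_triangle|]. apply Rplus_le_compat.
        - eapply Rle_trans; [apply Cmod_triangle|].
          apply Rplus_le_compat; apply Cmod_mult_le; lra.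
        - replace z with (z / (3 * M) * M + z / (3 * M) * M + z / (3 * (K + 1)) * (K + 1))
            by (field; lra).
          eapply Rle_trans; [apply Cmod_triangle|]. apply Rplus_le_compat.
          + eapply Rle_trans; [apply Cmod_triangle|].
            apply Rplus_le_compat; apply Cmod_mult_le; lra.
          + apply Cmod_mult_le; [rewrite Cmod_R, Rabs_right; lra | lra]. }
      split; apply Hest; lra. }
    assert (P1 := Cmod_ge_0 (p0 x - m)%C). assert (P2 := Cmod_ge_0 (q0 x - n)%C).
    assert (P3 := Cmod_ge_0 (u T)). assert (P4 := Cmod_ge_0 (v T)).
    assert (Hsq : Cmod (p0 x - m)%C ^ 2 + Cmod (q0 x - n)%C ^ 2 + 2 * z ^ 2 < 4 * z ^ 2) by nra.
    assert (Heta2 : 4 * z ^ 2 * Ex <= eta ^ 2).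
    { replace (4 * z ^ 2 * Ex) with (eta ^ 2 * / Ex) by (unfold z; field; lra).
      rewrite <- (Rmult_1_r (eta ^ 2)) at 2. apply Rmult_le_compat_l; [apply pow2_ge_0|].
      rewrite <- Rinv_1. apply Rinv_le_contravar; lra. }
    assert (HN2 : Cmod (u T) ^ 2 + Cmod (v T) ^ 2 < eta ^ 2).
    { eapply Rle_lt_trans; [exact HN|]. eapply Rlt_le_trans; [|exact Heta2].
      apply Rmult_lt_compat_r; lra. }
    change (Cmod (u T) < eta /\ Cmod (v T) < eta).
    split; apply Rnot_le_lt; intros Hc; nra. }
  split; apply (filterlim_of_Cmod (at_right 0)); intros eta Heta;
    generalize (Hmain eta Heta); apply filter_imp; intros x Hx; apply Hx.
Qed.

(** * The eigenfunctions on the edge *)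

Lemma Cconj_RtoC (x : R) : Cconj (RtoC x) = RtoC x.
Proof. unfold Cconj, RtoC; simpl. rewrite Ropp_0. reflexivity. Qed.

Lemma Cconj_Ci : Cconj Ci = (- Ci)%C.
Proof. unfold Cconj, Ci, Copp; simpl. rewrite Ropp_0. reflexivity. Qed.

Lemma C_Re_twice (z : C) : z = (RtoC (Re z) + RtoC (Re z) - Cconj z)%C.
Proof.
  destruct z as [x y]. unfold RtoC, Cconj, Cplus, Cminus, Copp, Re; simpl.
  apply injective_projections; simpl; ring.
Qed.

(** Uniqueness for singular linear systems. The right-hand sides enter through their moduli only, so
    systems that also contain conjugates of the unknowns are covered. *)
Lemma gronwall_C2_zero (u v du dv : R -> C) (T b K : R) :
  0 < T <= 1 -> 0 <= b < 1 -> 0 <= K ->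
  (forall t, 0 < t <= T ->
     is_dC u t (du t) /\ is_dC v t (dv t) /\
     Cmod (du t) <= Rpower t (- b) * (K * Cmod (u t) + K * Cmod (v t)) /\
     Cmod (dv t) <= Rpower t (- b) * (K * Cmod (u t) + K * Cmod (v t))) ->
  lim0 u (RtoC 0) -> lim0 v (RtoC 0) ->
  forall t, 0 < t <= T -> u t = RtoC 0 /\ v t = RtoC 0.
Proof.
  intros HT Hb HK H Hu Hv t Ht.
  assert (HN : Cmod (u t) ^ 2 + Cmod (v t) ^ 2 <=
    (Cmod (RtoC 0) ^ 2 + Cmod (RtoC 0) ^ 2 + 2 * 0 ^ 2) * exp ((4 * K + 1) / (1 - b))).
  { refine (gronwall_C2 u v du dv (RtoC 0) (RtoC 0) T b K 0 HT Hb HK (Rle_refl 0) _ Hu Hv t Ht).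
    intros s Hs. rewrite Rplus_0_r. exact (H s Hs). }
  rewrite Cmod_0 in HN.
  assert (P1 := Cmod_ge_0 (u t)). assert (P2 := Cmod_ge_0 (v t)).
  split; apply Cmod_eq_0; nra.
Qed.

Lemma linear_ode_zero (L u : R -> C) (b : R) :
  0 <= b < 1 ->
  (forall T, Ioo01 T -> exists K, 0 <= K /\
     forall t, 0 < t <= T -> Cmod (L t) <= K * Rpower t (- b)) ->
  (forall t, Ioo01 t -> is_dC u t (L t * u t)%C) ->
  lim0 u (RtoC 0) ->
  forall t, Ioo01 t -> u t = RtoC 0.
Proof.
  intros Hb HL Hu Hlim t Ht. destruct (HL t Ht) as [K [HK HLK]]. unfold Ioo01 in Ht.
  refine (proj1 (gronwall_C2_zero u (fun _ => RtoC 0) (fun s => L s * u s)%C (fun _ => RtoC 0)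
    t b K _ Hb HK _ Hlim _ t _)); [lra| |apply filterlim_const|lra].
  intros s Hs. rewrite Cmod_0.
  assert (P := Cmod_ge_0 (u s)). assert (Hw : 0 < Rpower s (- b)) by apply exp_pos.
  split; [apply Hu; unfold Ioo01; lra|]. split; [apply is_dC_const|]. split.
  - rewrite Cmod_mult. specialize (HLK s Hs). nra.
  - assert (0 <= K * Cmod (u s)) by (apply Rmult_le_pos; assumption). nra.
Qed.

(** * The Lax system at [mu = 0]: first and third coordinates, and the decoupled second one *)

Section LaxColumns.

(** To be read with [f = fEH], [L = log_coef] and [h] the derivative of [H] divided by [sqrt f]. The
    pairs [(a, d)] and [(b, e)] are the entries in rows 0 and 2 of columns 0 and 2 of [Phi], and [c]
    is the entry [(1, 1)]. *)
Context (beta : R) (f : R -> R) (L h a b c d e : R -> C).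
Context (Hbeta : 0 <= beta < 1)
  (Hbound : forall T, Ioo01 T -> exists K, 0 <= K /\ forall t, 0 < t <= T ->
     Cmod (L t) <= K * Rpower t (- beta) /\ Cmod (h t) <= K * Rpower t (- beta))
  (Hf : forall t, Ioo01 t -> 0 < f t /\ is_derive f t (2 * Re (L t) * f t))
  (Hf0 : filterlim f (at_right 0) (locally 1))
  (Da : forall t, Ioo01 t -> is_dC a t (Cconj (L t) * a t + Ci * h t * d t)%C)
  (Dd : forall t, Ioo01 t -> is_dC d t (Ci * Cconj (h t) * a t + RtoC (Re (L t)) * d t)%C)
  (Db : forall t, Ioo01 t -> is_dC b t (Cconj (L t) * b t + Ci * h t * e t)%C)
  (De : forall t, Ioo01 t -> is_dC e t (Ci * Cconj (h t) * b t + RtoC (Re (L t)) * e t)%C)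
  (Dc : forall t, Ioo01 t -> is_dC c t (L t * c t)%C)
  (a0 : lim0 a (RtoC 1)) (d0 : lim0 d (RtoC 0)) (b0 : lim0 b (RtoC 0))
  (e0 : lim0 e (RtoC 1)) (c0 : lim0 c (RtoC 1)).

Lemma scalar_bound (r : R) (T : R) : 0 <= r -> Ioo01 T -> exists K, 0 <= K /\
  forall t, 0 < t <= T -> Cmod (RtoC (r * Re (L t))) <= K * Rpower t (- beta).
Proof.
  intros Hr HT. destruct (Hbound T HT) as [K [HK H]]. exists (r * K).
  split; [apply Rmult_le_pos; assumption|]. intros t Ht. destruct (H t Ht) as [HL _].
  rewrite Cmod_R, Rabs_mult, Rabs_right by lra. rewrite Rmult_assoc.
  apply Rmult_le_compat_l; [exact Hr|]. eapply Rle_trans; [apply re_le_Cmod | exact HL].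
Qed.

(** Both sides solve [N' = 2 Re(L) N] and tend to 1 at 0. *)
Lemma lax_c_modulus (t : R) : Ioo01 t -> (c t * Cconj (c t))%C = RtoC (f t).
Proof.
  intros Ht.
  enough (H : (c t * Cconj (c t) - RtoC (f t))%C = RtoC 0).
  { replace (c t * Cconj (c t))%C with ((c t * Cconj (c t) - RtoC (f t)) + RtoC (f t))%C by ring.
    rewrite H. ring. }
  refine (linear_ode_zero (fun t => RtoC (2 * Re (L t)))
    (fun t => c t * Cconj (c t) - RtoC (f t))%C beta Hbeta _ _ _ t Ht).
  - intros T HT. apply scalar_bound; [lra | exact HT].
  - intros s Hs. destruct (Hf s Hs) as [_ Dfs].
    eapply is_dC_eq.
    + apply is_dC_minus; [apply is_dC_mult; [|apply is_dC_conj]; apply Dc, Hs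
      | apply is_dC_RtoC, Dfs].
    + rewrite Cmult_conj, !RtoC_mult. rewrite (C_Re_twice (L s)) at 1. ring.
  - replace (RtoC 0) with (RtoC 1 * Cconj (RtoC 1) - RtoC 1)%C by (rewrite Cconj_RtoC; ring).
    apply (filterlim_Cminus (at_right 0)); [|apply (filterlim_RtoC (at_right 0)), Hf0].
    apply (filterlim_Cmult (at_right 0)); [|apply (filterlim_Cconj (at_right 0))]; exact c0.
Qed.

Let g (t : R) : C := RtoC (/ sqrt (f t)).

Lemma is_dC_inv_sqrt (t : R) : Ioo01 t -> is_dC g t (- RtoC (Re (L t)) * g t)%C.
Proof.
  intros Ht. destruct (Hf t Ht) as [Hpos Dft].
  rewrite <- RtoC_opp. unfold g. rewrite <- RtoC_mult. apply is_dC_RtoC.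
  assert (Hs := sqrt_lt_R0 _ Hpos).
  evar_last.
  - apply (is_derive_inv (fun s => sqrt (f s))); [|lra].
    exact (is_derive_sqrt f t _ Dft Hpos).
  - simpl.
    rewrite <- (sqrt_sqrt (f t)) at 1 by lra. field. lra.
Qed.

Lemma lax_c_g (t : R) : Ioo01 t -> (c t * Cconj (c t) * (g t * g t))%C = RtoC 1.
Proof.
  intros Ht. destruct (Hf t Ht) as [Hpos _]. rewrite (lax_c_modulus t Ht). unfold g.
  rewrite <- !RtoC_mult. f_equal. assert (Hs := sqrt_lt_R0 _ Hpos).
  rewrite <- (sqrt_sqrt (f t)) at 1 by lra. field. lra.
Qed.

Lemma Cmod_c_g (t : R) : Ioo01 t -> Cmod (Cconj (c t) * g t)%C = 1.
Proof.
  intros Ht.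
  assert (H : Cmod (Cconj (c t) * g t)%C ^ 2 = 1).
  { apply RtoC_inj. rewrite Cmod2_conj, Cmult_conj, Cconj_conj, <- (lax_c_g t Ht).
    unfold g. rewrite Cconj_RtoC. ring. }
  assert (P := Cmod_ge_0 (Cconj (c t) * g t)%C). nra.
Qed.

(* [Phi / sqrt f] is unitary, so its first and third columns determine each other. *)
Lemma lax_columns_conj (t : R) : Ioo01 t ->
  a t = (Cconj (e t) * Cconj (c t) * g t)%C /\ b t = (- (Cconj (c t) * Cconj (d t) * g t))%C.
Proof.
  intros Ht.
  set (u := fun s => (a s - Cconj (e s) * Cconj (c s) * g s)%C).
  set (v := fun s => (b s + Cconj (c s) * Cconj (d s) * g s)%C).
  assert (Du : forall s, Ioo01 s ->
    is_dC u s (Cconj (L s) * u s + Ci * h s * (Cconj (c s) * g s) * Cconj (v s))%C).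
  { intros s Hs. eapply is_dC_eq.
    - apply is_dC_minus; [apply Da, Hs|].
      apply is_dC_mult; [|apply is_dC_inv_sqrt, Hs].
      apply is_dC_mult; apply is_dC_conj; [apply De | apply Dc]; exact Hs.
    - unfold u, v.
      rewrite !Cplus_conj, !Cmult_conj, !Cconj_conj, Cconj_Ci, Cconj_RtoC.
      replace (Cconj (g s)) with (g s) by (symmetry; apply Cconj_RtoC).
      (* [RtoC 1] marks where [lax_c_g] inserts [|c|^2 / f]; with this factor the lone term in [d]
         combines with [Cconj (b s)] into a multiple of [Cconj (v s)], and the system for [(u, v)]
         closes. The computation for [v] uses the same device. *)
      transitivity (Cconj (L s) * (a s - Cconj (e s) * Cconj (c s) * g s) +
        Ci * h s * (d s * RtoC 1 + Cconj (b s) * Cconj (c s) * g s))%C; [ring|].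
      rewrite <- (lax_c_g s Hs). ring. }
  assert (Dv : forall s, Ioo01 s ->
    is_dC v s (Cconj (L s) * v s - Ci * h s * (Cconj (c s) * g s) * Cconj (u s))%C).
  { intros s Hs. eapply is_dC_eq.
    - apply is_dC_plus; [apply Db, Hs|].
      apply is_dC_mult; [|apply is_dC_inv_sqrt, Hs].
      apply is_dC_mult; apply is_dC_conj; [apply Dc | apply Dd]; exact Hs.
    - unfold u, v.
      rewrite !Cminus_conj, !Cplus_conj, !Cmult_conj, !Cconj_conj, Cconj_Ci, Cconj_RtoC.
      replace (Cconj (g s)) with (g s) by (symmetry; apply Cconj_RtoC).
      transitivity (Cconj (L s) * (b s + Cconj (c s) * Cconj (d s) * g s) +
        Ci * h s * (e s * RtoC 1 - Cconj (a s) * Cconj (c s) * g s))%C; [ring|].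
      rewrite <- (lax_c_g s Hs). ring. }
  assert (Hg0 : lim0 g (RtoC 1)).
  { unfold g. apply (filterlim_RtoC (at_right 0)).
    replace 1 with (/ sqrt 1) by (rewrite sqrt_1; field).
    apply (filterlim_Rcont (at_right 0) Rinv).
    - rewrite sqrt_1. apply continuous_Rinv. lra.
    - apply (filterlim_Rcont (at_right 0) sqrt); [apply continuous_sqrt | exact Hf0]. }
  destruct (Hbound t Ht) as [K [HK HLh]]. unfold Ioo01 in Ht.
  assert (Huv : u t = RtoC 0 /\ v t = RtoC 0).
  { refine (gronwall_C2_zero u v _ _ t beta K _ Hbeta HK _ _ _ t _); try lra.
    - intros s Hs. assert (Hs' : Ioo01 s) by (unfold Ioo01; lra).
      split; [apply Du, Hs'|]. split; [apply Dv, Hs'|].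
      destruct (HLh s Hs) as [BL Bh].
      assert (HB : forall z w : C, Cmod (Cconj (L s) * z)%C +
          Cmod (Ci * h s * (Cconj (c s) * g s) * Cconj w)%C <=
          Rpower s (- beta) * (K * Cmod z + K * Cmod w)).
      { intros z w. rewrite !Cmod_mult, !Cmod_conj, Cmod_Ci.
        assert (H1 := Cmod_c_g s Hs'). rewrite Cmod_mult, Cmod_conj in H1. rewrite H1.
        assert (P1 := Cmod_ge_0 z). assert (P2 := Cmod_ge_0 w). nra. }
      split.
      + eapply Rle_trans; [apply Cmod_triangle | apply HB].
      + rewrite (Rplus_comm (K * Cmod (u s))).
        eapply Rle_trans; [apply Cmod_triangle|]. rewrite Cmod_opp. apply HB.
    - replace (RtoC 0) with (RtoC 1 - Cconj (RtoC 1) * Cconj (RtoC 1) * RtoC 1)%C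
        by (rewrite Cconj_RtoC; ring).
      apply (filterlim_Cminus (at_right 0)); [exact a0|].
      apply (filterlim_Cmult (at_right 0)); [|exact Hg0].
      apply (filterlim_Cmult (at_right 0)); apply (filterlim_Cconj (at_right 0)); assumption.
    - replace (RtoC 0) with (RtoC 0 + Cconj (RtoC 1) * Cconj (RtoC 0) * RtoC 1)%C
        by (rewrite !Cconj_RtoC; ring).
      apply (filterlim_Cplus (at_right 0)); [exact b0|].
      apply (filterlim_Cmult (at_right 0)); [|exact Hg0].
      apply (filterlim_Cmult (at_right 0)); apply (filterlim_Cconj (at_right 0)); assumption. }
  destruct Huv as [Hu Hv]. split.
  - replace (a t) with (u t + Cconj (e t) * Cconj (c t) * g t)%C by (unfold u; ring).
    rewrite Hu. ring.
  - replace (b t) with (v t - Cconj (c t) * Cconj (d t) * g t)%C by (unfold v; ring).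
    rewrite Hv. ring.
Qed.

Lemma lax_d_derive (t : R) : Ioo01 t ->
  is_dC d t (Ci * Cconj (h t) * (Cconj (e t) * Cconj (c t) * RtoC (/ sqrt (f t)))
    + RtoC (Re (L t)) * d t)%C.
Proof.
  intros Ht. change (RtoC (/ sqrt (f t))) with (g t).
  rewrite <- (proj1 (lax_columns_conj t Ht)). exact (Dd t Ht).
Qed.

Lemma lax_e_derive (t : R) : Ioo01 t ->
  is_dC e t (- (Ci * Cconj (h t) * (Cconj (c t) * Cconj (d t) * RtoC (/ sqrt (f t))))
    + RtoC (Re (L t)) * e t)%C.
Proof.
  intros Ht. change (RtoC (/ sqrt (f t))) with (g t).
  eapply is_dC_eq; [exact (De t Ht)|]. rewrite (proj2 (lax_columns_conj t Ht)). ring.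
Qed.

(** The norm of the last row of [sqrt f] times a unitary matrix. In the derivative the coupling
    terms of [d] and [e] cancel, leaving [2 Re(L)] times the sum, which is also the equation of
    [f]. *)
Lemma lax_de_modulus (t : R) : Ioo01 t ->
  (d t * Cconj (d t) + e t * Cconj (e t))%C = RtoC (f t).
Proof.
  intros Ht.
  enough (H : (d t * Cconj (d t) + e t * Cconj (e t) - RtoC (f t))%C = RtoC 0).
  { replace (d t * Cconj (d t) + e t * Cconj (e t))%C
      with ((d t * Cconj (d t) + e t * Cconj (e t) - RtoC (f t)) + RtoC (f t))%C by ring.
    rewrite H. ring. }
  refine (linear_ode_zero (fun t => RtoC (2 * Re (L t)))
    (fun t => d t * Cconj (d t) + e t * Cconj (e t) - RtoC (f t))%C beta Hbeta _ _ _ t Ht).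
  - intros T HT. apply scalar_bound; [lra | exact HT].
  - intros s Hs. destruct (Hf s Hs) as [_ Dfs].
    eapply is_dC_eq.
    + apply is_dC_minus; [apply is_dC_plus | apply is_dC_RtoC, Dfs];
        (apply is_dC_mult; [|apply is_dC_conj]); (apply lax_d_derive || apply lax_e_derive); exact Hs.
    + rewrite !Cplus_conj, !Copp_conj, !Cmult_conj, !Cconj_conj, !Cconj_RtoC, !RtoC_mult, Cconj_Ci.
      ring.
  - replace (RtoC 0) with (RtoC 0 * Cconj (RtoC 0) + RtoC 1 * Cconj (RtoC 1) - RtoC 1)%C
      by (rewrite !Cconj_RtoC; ring).
    apply (filterlim_Cminus (at_right 0)); [|apply (filterlim_RtoC (at_right 0)), Hf0].
    apply (filterlim_Cplus (at_right 0)); apply (filterlim_Cmult (at_right 0));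
      try apply (filterlim_Cconj (at_right 0)); assumption.
Qed.

End LaxColumns.

(** * From the Volterra equation to differential equations for the entries *)

Lemma entry_Mmult (A B : @matrix C 3 3) (i j : nat) : (i < 3)%nat -> (j < 3)%nat ->
  entry (Mmult (T := C_Ring) A B) i j =
  (entry A i 0 * entry B 0 j + entry A i 1 * entry B 1 j + entry A i 2 * entry B 2 j)%C.
Proof.
  intros Hi Hj. unfold entry at 1, Mmult. rewrite coeff_mat_bij by assumption.
  simpl Init.Nat.pred. rewrite 2 sum_Sn, sum_O. reflexivity.
Qed.

Lemma continuous_C_ext_loc (f g : R -> C) (t : R) :
  locally t (fun s => f s = g s) -> continuous f t -> continuous g t.
Proof. intros H. apply continuous_ext_loc. revert H. apply filter_imp.
  intros s ->. reflexivity. Qed.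

Lemma continuous_C_ext (f g : R -> C) (t : R) :
  (forall s, f s = g s) -> continuous f t -> continuous g t.
Proof. intros H. exact (continuous_ext f g t H). Qed.

Lemma lim0_of_minus (f : R -> C) (k : C) : lim0 (fun s => f s - k)%C (RtoC 0) -> lim0 f k.
Proof.
  intros H. apply (filterlim_of_Cmod (at_right 0)). intros eps Heps.
  generalize (filterlim_Cmod (at_right 0) _ _ H eps Heps). apply filter_imp. intros x Hx.
  replace (f x - k)%C with (f x - k - RtoC 0)%C by ring. exact Hx.
Qed.

(** A bootstrap: [Phi] is not assumed continuous, but as an improper primitive it is; hence the
    integrand is continuous, and the primitive is differentiable. *)
Lemma volterra_entries (W Phi : R -> @matrix C 3 3) :
  (forall i j, (i < 3)%nat -> (j < 3)%nat -> forall t, Ioo01 t ->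
     continuous (fun s => entry (W s) i j) t) ->
  volterra_solution W Phi ->
  forall i j, (i < 3)%nat -> (j < 3)%nat ->
    (forall t, Ioo01 t -> is_dC (fun s => entry (Phi s) i j) t
       (entry (W t) i 0 * entry (Phi t) 0 j + entry (W t) i 1 * entry (Phi t) 1 j
        + entry (W t) i 2 * entry (Phi t) 2 j)%C) /\
    lim0 (fun s => entry (Phi s) i j) (entry (Mone (T := C_Ring)) i j) /\
    entry (Phi 0) i j = entry (Mone (T := C_Ring)) i j.
Proof.
  intros HW HPhi.
  set (F := fun i j s => entry (Mmult (T := C_Ring) (W s) (Phi s)) i j).
  set (L := fun i j t => (entry (Phi t) i j - entry (Mone (T := C_Ring)) i j)%C).
  assert (HL : forall i j, (i < 3)%nat -> (j < 3)%nat -> forall t, Ioo01 t ->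
    is_RInt_gen (V := C_R_NormedModule) (F i j) (at_right 0) (at_point t) (L i j t)).
  { intros i j Hi Hj t Ht. apply (HPhi t); [unfold Ico01, Ioo01 in *; lra | exact Hi | exact Hj | apply Ht]. }
  assert (Hcont : forall i j, (i < 3)%nat -> (j < 3)%nat -> forall t, Ioo01 t ->
    continuous (fun s => entry (Phi s) i j) t).
  { intros i j Hi Hj t Ht.
    apply (continuous_C_ext (fun s => L i j s + entry (Mone (T := C_Ring)) i j)%C).
    { intros s. unfold L. ring. }
    apply (filterlim_Cplus (locally t)); [|apply filterlim_const].
    exact (primitive_continuous _ _ t (HL i j Hi Hj) Ht). }
  assert (HF : forall i j, (i < 3)%nat -> (j < 3)%nat -> forall s, F i j s =
    (entry (W s) i 0 * entry (Phi s) 0 j + entry (W s) i 1 * entry (Phi s) 1 j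
        + entry (W s) i 2 * entry (Phi s) 2 j)%C) by (intros; apply entry_Mmult; assumption).
  intros i j Hi Hj. split; [|split].
  - intros t Ht. rewrite <- (HF i j Hi Hj).
    apply (is_dC_ext_loc (fun s => L i j s + entry (Mone (T := C_Ring)) i j)%C).
    { apply filter_forall. intros s. unfold L. ring. }
    eapply is_dC_eq; [apply is_dC_plus; [|apply is_dC_const]|].
    + apply (primitive_derive (F i j) (L i j) t (HL i j Hi Hj) Ht).
      apply (continuous_C_ext (fun s => entry (W s) i 0 * entry (Phi s) 0 j
        + entry (W s) i 1 * entry (Phi s) 1 j + entry (W s) i 2 * entry (Phi s) 2 j)%C).
      { intros s. symmetry. apply HF; assumption. }
      assert (Hterm : forall k, (k < 3)%nat ->
        continuous (fun s => entry (W s) i k * entry (Phi s) k j)%C t).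
      { intros k Hk. apply (filterlim_Cmult (locally t)).
        - exact (HW i k Hi Hk t Ht).
        - exact (Hcont k j Hk Hj t Ht). }
      apply (filterlim_Cplus (locally t)); [apply (filterlim_Cplus (locally t))|];
        apply Hterm; lia.
    + simpl. ring.
  - apply lim0_of_minus.
    apply (primitive_lim0 (F i j) _ (/ 2)); [lra|].
    intros t Ht. apply HL; [exact Hi | exact Hj | unfold Ioo01; lra].
  - destruct (HPhi 0 ltac:(unfold Ico01; lra) i j Hi Hj) as [H0 _].
    specialize (H0 eq_refl).
    replace (entry (Phi 0) i j)
      with ((entry (Phi 0) i j - entry (Mone (T := C_Ring)) i j) + entry (Mone (T := C_Ring)) i j)%C
      by ring.
    rewrite H0. ring.
Qed.

Lemma Cdiv_RtoC (z : C) (r : R) : r <> 0 -> (z / RtoC r)%C = (RtoC (/ r) * z)%C.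
Proof. intros Hr. unfold Cdiv. rewrite <- RtoC_inv by exact Hr. apply Cmult_comm. Qed.

Lemma C_half_conj (z : C) : (RtoC (/ 2) * (z + Cconj z))%C = RtoC (Re z).
Proof.
  destruct z as [x y]. unfold RtoC, Cconj, Cplus, Cmult, Re; simpl.
  apply injective_projections; simpl; field.
Qed.

Lemma Re_RtoC_mult (r : R) (z : C) : Re (RtoC r * z)%C = r * Re z.
Proof. unfold Re, Cmult, RtoC; simpl. ring. Qed.

Lemma filterlim_fEH {T} (F : (T -> Prop) -> Prop) {FF : Filter F} (E H : T -> C) (e h : C) :
  filterlim E F (locally e) -> filterlim H F (locally h) ->
  filterlim (fun x => fEH (E x) (H x)) F (locally (fEH e h)).
Proof.
  intros HE HH. unfold fEH, Rminus. apply (filterlim_Rplus F).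
  - exact (proj1 (filterlim_ReIm F E e HE)).
  - exact (filterlim_Ropp F _ _ (filterlim_Cmod_sqr F H h HH)).
Qed.

Lemma filterlim_Rinv {T} (F : (T -> Prop) -> Prop) {FF : Filter F} (f : T -> R) (a : R) :
  a <> 0 -> filterlim f F (locally a) -> filterlim (fun x => / f x) F (locally (/ a)).
Proof. intros Ha. apply (filterlim_Rcont F Rinv), continuous_Rinv, Ha. Qed.

Lemma filterlim_sqrt {T} (F : (T -> Prop) -> Prop) {FF : Filter F} (f : T -> R) (a : R) :
  filterlim f F (locally a) -> filterlim (fun x => sqrt (f x)) F (locally (sqrt a)).
Proof. apply (filterlim_Rcont F sqrt), continuous_sqrt. Qed.

Lemma log_coef_alt (E H : R -> C) (t : R) : 0 < fEH (E t) (H t) ->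
  log_coef E H t =
  (RtoC (/ (2 * fEH (E t) (H t))) * (dC E t - RtoC 2 * Cconj (H t) * dC H t))%C.
Proof. intros Hf. apply Cdiv_RtoC. lra. Qed.

Lemma is_derive_fEH (E H : R -> C) (t : R) :
  0 < fEH (E t) (H t) -> is_dC E t (dC E t) -> is_dC H t (dC H t) ->
  is_derive (fun s => fEH (E s) (H s)) t (2 * Re (log_coef E H t) * fEH (E t) (H t)).
Proof.
  intros Hf HE HH. evar_last.
  - exact (is_derive_minus (V := R_NormedModule) _ _ t _ _ (proj1 HE)
      (is_derive_Cmod_sqr H t _ HH)).
  - rewrite log_coef_alt, Re_RtoC_mult by exact Hf.
    unfold minus, plus, opp; simpl. field. lra.
Qed.

(** What the study of the eigenfunctions knows of one edge. The two quantities in [ed_bound] are the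
    coefficients of the Lax matrix at [mu = 0]; their weight makes the singular Gronwall inequality
    applicable. *)
Record edge_data (beta : R) (E H : R -> C) : Prop := {
  ed_derive : forall t, Ioo01 t -> is_dC E t (dC E t) /\ is_dC H t (dC H t);
  ed_cont : forall t, Ioo01 t -> continuous (dC E) t /\ continuous (dC H) t;
  ed_lim0 : lim0 E (RtoC 1) /\ lim0 H (RtoC 0);
  ed_pos : forall t, Ico01 t -> 0 < fEH (E t) (H t);
  ed_bound : forall T, Ioo01 T -> exists K, 0 <= K /\ forall t, 0 < t <= T ->
    Cmod (log_coef E H t) <= K * Rpower t (- beta) /\
    Cmod (RtoC (/ sqrt (fEH (E t) (H t))) * dC H t)%C <= K * Rpower t (- beta)
}.

Lemma Ioo_Ico (t : R) : Ioo01 t -> Ico01 t.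
Proof. unfold Ioo01, Ico01. lra. Qed.

Lemma is_dC_Cexp (b : R -> C) (t : R) (l : C) :
  is_dC b t l -> is_dC (fun s => Cexp (b s)) t (l * Cexp (b t))%C.
Proof.
  intros [Hr Hi].
  assert (De := is_derive_comp (V := R_NormedModule) exp _ t _ _ (is_derive_exp _) Hr).
  assert (Dcos := is_derive_comp (V := R_NormedModule) cos _ t _ _ (is_derive_cos _) Hi).
  assert (Dsin := is_derive_comp (V := R_NormedModule) sin _ t _ _ (is_derive_sin _) Hi).
  split.
  - evar_last; [exact (is_derive_Rmult _ _ _ _ _ De Dcos)|].
    unfold scal; simpl. unfold mult, Re, Im; simpl. ring.
  - evar_last; [exact (is_derive_Rmult _ _ _ _ _ De Dsin)|].
    unfold scal; simpl. unfold mult, Re, Im; simpl. ring.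
Qed.

Lemma Cexp_0 : Cexp (RtoC 0) = RtoC 1.
Proof.
  unfold Cexp; simpl. rewrite exp_0, cos_0, sin_0.
  apply injective_projections; simpl; ring.
Qed.

Lemma lim0_Cexp (b : R -> C) : lim0 b (RtoC 0) -> lim0 (fun t => Cexp (b t)) (RtoC 1).
Proof.
  intros Hb. destruct (filterlim_ReIm (at_right 0) _ _ Hb) as [Hr Hi].
  assert (Ce := filterlim_Rcont (at_right 0) exp _ _ (continuous_exp _) Hr).
  assert (Ccos := filterlim_Rcont (at_right 0) cos _ _ (continuous_cos _) Hi).
  assert (Csin := filterlim_Rcont (at_right 0) sin _ _ (continuous_sin _) Hi).
  rewrite <- Cexp_0. apply (filterlim_C_of_ReIm (at_right 0)).
  - exact (filterlim_Rmult (at_right 0) _ _ _ _ Ce Ccos).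
  - exact (filterlim_Rmult (at_right 0) _ _ _ _ Ce Csin).
Qed.

Section EdgeData.

Context (beta : R) (Hbeta : 0 <= beta < 1) (E H : R -> C) (HD : edge_data beta E H)
  (Phi : R -> @matrix C 3 3) (HPhi : volterra_solution (lax_matrix E H (RtoC 0)) Phi).

Let f (t : R) : R := fEH (E t) (H t).
Let L : R -> C := log_coef E H.
Let h (t : R) : C := (RtoC (/ sqrt (f t)) * dC H t)%C.
Let c (t : R) : C := entry (Phi t) 1 1.
Let d (t : R) : C := entry (Phi t) 2 0.
Let e (t : R) : C := entry (Phi t) 2 2.

Lemma edge_f_pos (t : R) : Ioo01 t -> 0 < f t.
Proof. intros Ht. apply (ed_pos _ _ _ HD), Ioo_Ico, Ht. Qed.

Lemma edge_f_derive (t : R) : Ioo01 t -> 0 < f t /\ is_derive f t (2 * Re (L t) * f t).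
Proof.
  intros Ht. assert (Hf := edge_f_pos t Ht). split; [exact Hf|].
  destruct (ed_derive _ _ _ HD t Ht). apply is_derive_fEH; assumption.
Qed.

Lemma edge_f_lim0 : filterlim f (at_right 0) (locally 1).
Proof.
  replace 1 with (fEH (RtoC 1) (RtoC 0)) by (unfold fEH; rewrite Cmod_0; simpl; ring).
  exact (filterlim_fEH (at_right 0) E H _ _ (proj1 (ed_lim0 _ _ _ HD)) (proj2 (ed_lim0 _ _ _ HD))).
Qed.

Lemma edge_H_continuous (t : R) : Ioo01 t -> continuous H t.
Proof. intros Ht. exact (is_dC_continuous H t _ (proj2 (ed_derive _ _ _ HD t Ht))). Qed.

Lemma edge_f_continuous (t : R) : Ioo01 t -> continuous f t.
Proof.
  intros Ht. exact (filterlim_fEH (locally t) E H _ _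
    (is_dC_continuous E t _ (proj1 (ed_derive _ _ _ HD t Ht))) (edge_H_continuous t Ht)).
Qed.

Lemma edge_L_continuous (t : R) : Ioo01 t -> continuous L t.
Proof.
  intros Ht. assert (Hf := edge_f_pos t Ht).
  apply (continuous_C_ext_loc (fun s =>
    RtoC (/ (2 * f s)) * (dC E s - RtoC 2 * Cconj (H s) * dC H s))%C).
  { generalize (locally_Ioo01 t Ht). apply filter_imp. intros s Hs.
    symmetry. apply log_coef_alt, edge_f_pos, Hs. }
  destruct (ed_cont _ _ _ HD t Ht).
  apply (filterlim_Cmult (locally t)).
  - apply (filterlim_RtoC (locally t)), (filterlim_Rinv (locally t)); [lra|].
    apply (filterlim_Rmult (locally t)); [apply filterlim_const | apply edge_f_continuous, Ht].
  - apply (filterlim_Cminus (locally t)); [assumption|].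
    apply (filterlim_Cmult (locally t)); [|assumption].
    apply (filterlim_Cmult (locally t)); [apply filterlim_const|].
    apply (filterlim_Cconj (locally t)), edge_H_continuous, Ht.
Qed.

Lemma edge_h_continuous (t : R) : Ioo01 t -> continuous h t.
Proof.
  intros Ht. assert (Hf := sqrt_lt_R0 _ (edge_f_pos t Ht)).
  destruct (ed_cont _ _ _ HD t Ht).
  apply (filterlim_Cmult (locally t)); [|assumption].
  apply (filterlim_RtoC (locally t)), (filterlim_Rinv (locally t)); [lra|].
  apply (filterlim_sqrt (locally t)), edge_f_continuous, Ht.
Qed.

Lemma lax_matrix_entries (t : R) : Ioo01 t ->
  entry (lax_matrix E H (RtoC 0) t) 0 0 = Cconj (L t) /\
  entry (lax_matrix E H (RtoC 0) t) 0 1 = RtoC 0 /\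
  entry (lax_matrix E H (RtoC 0) t) 0 2 = (Ci * h t)%C /\
  entry (lax_matrix E H (RtoC 0) t) 1 0 = RtoC 0 /\
  entry (lax_matrix E H (RtoC 0) t) 1 1 = L t /\
  entry (lax_matrix E H (RtoC 0) t) 1 2 = RtoC 0 /\
  entry (lax_matrix E H (RtoC 0) t) 2 0 = (Ci * Cconj (h t))%C /\
  entry (lax_matrix E H (RtoC 0) t) 2 1 = RtoC 0 /\
  entry (lax_matrix E H (RtoC 0) t) 2 2 = RtoC (Re (L t)).
Proof.
  intros Ht. assert (Hf := sqrt_lt_R0 _ (edge_f_pos t Ht)).
  assert (Hs : (Ci / RtoC (sqrt (f t)) = RtoC (/ sqrt (f t)) * Ci)%C) by (apply Cdiv_RtoC; lra).
  assert (Hh : Cconj (h t) = (RtoC (/ sqrt (f t)) * Cconj (dC H t))%C)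
    by (unfold h; rewrite Cmult_conj, Cconj_RtoC; reflexivity).
  split; [reflexivity|]. split; [exact (Cmult_0_l _)|].
  split.
  { change (Ci / RtoC (sqrt (f t)) * dC H t = Ci * h t)%C. rewrite Hs. unfold h. ring. }
  split; [exact (Cmult_0_l _)|]. split; [reflexivity|].
  split.
  { change (- (Ci * RtoC 0 / RtoC (sqrt (f t)) * dC H t) = RtoC 0)%C. unfold Cdiv. ring. }
  split.
  { change (Ci / RtoC (sqrt (f t)) * Cconj (dC H t) = Ci * Cconj (h t))%C. rewrite Hs, Hh. ring. }
  split.
  { change (Ci * RtoC 0 / RtoC (sqrt (f t)) * Cconj (dC H t) = RtoC 0)%C. unfold Cdiv. ring. }
  change (RtoC (/ 2) * (L t + Cconj (L t)) = RtoC (Re (L t)))%C. apply C_half_conj.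
Qed.

Lemma lax_matrix_continuous (i j : nat) : (i < 3)%nat -> (j < 3)%nat ->
  forall t, Ioo01 t -> continuous (fun s => entry (lax_matrix E H (RtoC 0) s) i j) t.
Proof.
  intros Hi Hj t Ht.
  assert (Hloc : forall k : R -> C,
    (forall s, Ioo01 s -> k s = entry (lax_matrix E H (RtoC 0) s) i j) -> continuous k t ->
    continuous (fun s => entry (lax_matrix E H (RtoC 0) s) i j) t).
  { intros k Hk. apply continuous_C_ext_loc.
    generalize (locally_Ioo01 t Ht). apply filter_imp. exact Hk. }
  assert (CL := edge_L_continuous t Ht). assert (Ch := edge_h_continuous t Ht).
  assert (C0 : continuous (fun _ : R => RtoC 0) t) by apply filterlim_const.
  destruct i as [|[|[|i]]]; [| | |lia]; (destruct j as [|[|[|j]]]; [| | |lia]);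
    (eapply Hloc; [intros s Hs; symmetry; apply (lax_matrix_entries s Hs)|]);
    try exact C0; try exact CL.
  - exact (filterlim_Cconj (locally t) _ _ CL).
  - exact (filterlim_Cmult (locally t) _ _ _ _ (filterlim_const Ci) Ch).
  - exact (filterlim_Cmult (locally t) _ _ _ _ (filterlim_const Ci)
      (filterlim_Cconj (locally t) _ _ Ch)).
  - exact (filterlim_RtoC (locally t) _ _ (proj1 (filterlim_ReIm (locally t) _ _ CL))).
Qed.

Let a (t : R) : C := entry (Phi t) 0 0.
Let b (t : R) : C := entry (Phi t) 0 2.

Lemma edge_phi_system :
  (forall t, Ioo01 t ->
    is_dC a t (Cconj (L t) * a t + Ci * h t * d t)%C /\
    is_dC d t (Ci * Cconj (h t) * a t + RtoC (Re (L t)) * d t)%C /\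
    is_dC b t (Cconj (L t) * b t + Ci * h t * e t)%C /\
    is_dC e t (Ci * Cconj (h t) * b t + RtoC (Re (L t)) * e t)%C /\
    is_dC c t (L t * c t)%C) /\
  (lim0 a (RtoC 1) /\ lim0 d (RtoC 0) /\ lim0 b (RtoC 0) /\ lim0 e (RtoC 1) /\ lim0 c (RtoC 1)) /\
  (d 0 = RtoC 0 /\ e 0 = RtoC 1 /\ c 0 = RtoC 1).
Proof.
  assert (HV := volterra_entries _ Phi lax_matrix_continuous HPhi).
  destruct (HV 0%nat 0%nat) as [Da [La _]]; [lia|lia|].
  destruct (HV 2%nat 0%nat) as [Dd [Ld Vd]]; [lia|lia|].
  destruct (HV 0%nat 2%nat) as [Db [Lb _]]; [lia|lia|].
  destruct (HV 2%nat 2%nat) as [De [Le Ve]]; [lia|lia|].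
  destruct (HV 1%nat 1%nat) as [Dc [Lc Vc]]; [lia|lia|].
  split; [|split].
  - intros t Ht.
    destruct (lax_matrix_entries t Ht) as [W00 [W01 [W02 [W10 [W11 [W12 [W20 [W21 W22]]]]]]]].
    specialize (Da t Ht). specialize (Dd t Ht). specialize (Db t Ht).
    specialize (De t Ht). specialize (Dc t Ht).
    rewrite W00, W01, W02 in Da, Db. rewrite W20, W21, W22 in Dd, De. rewrite W10, W11, W12 in Dc.
    split; [|split; [|split; [|split]]].
    + refine (is_dC_eq _ _ _ _ Da _). unfold a, d. ring.
    + refine (is_dC_eq _ _ _ _ Dd _). unfold a, d. ring.
    + refine (is_dC_eq _ _ _ _ Db _). unfold b, e. ring.
    + refine (is_dC_eq _ _ _ _ De _). unfold b, e. ring.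
    + refine (is_dC_eq _ _ _ _ Dc _). unfold c. ring.
  - exact (conj La (conj Ld (conj Lb (conj Le Lc)))).
  - exact (conj Vd (conj Ve Vc)).
Qed.

Lemma edge_c_derive (t : R) : Ioo01 t -> is_dC c t (L t * c t)%C.
Proof. intros Ht. apply edge_phi_system, Ht. Qed.

Lemma edge_phi_facts (t : R) : Ioo01 t ->
  (c t * Cconj (c t))%C = RtoC (f t) /\
  (d t * Cconj (d t) + e t * Cconj (e t))%C = RtoC (f t) /\
  is_dC d t (Ci * Cconj (h t) * (Cconj (e t) * Cconj (c t) * RtoC (/ sqrt (f t)))
    + RtoC (Re (L t)) * d t)%C /\
  is_dC e t (- (Ci * Cconj (h t) * (Cconj (c t) * Cconj (d t) * RtoC (/ sqrt (f t))))
    + RtoC (Re (L t)) * e t)%C.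
Proof.
  intros Ht. destruct edge_phi_system as [HS [[La [Ld [Lb [Le Lc]]]] _]].
  assert (Da := fun t Ht => proj1 (HS t Ht)).
  assert (Dd := fun t Ht => proj1 (proj2 (HS t Ht))).
  assert (Db := fun t Ht => proj1 (proj2 (proj2 (HS t Ht)))).
  assert (De := fun t Ht => proj1 (proj2 (proj2 (proj2 (HS t Ht))))).
  assert (Dc := fun t Ht => proj2 (proj2 (proj2 (proj2 (HS t Ht))))).
  assert (HB := ed_bound _ _ _ HD).
  split; [|split; [|split]].
  - exact (lax_c_modulus beta f L h c Hbeta HB edge_f_derive edge_f_lim0 Dc Lc t Ht).
  - exact (lax_de_modulus beta f L h a b c d e Hbeta HB edge_f_derive edge_f_lim0
      Da Dd Db De Dc La Ld Lb Le Lc t Ht).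
  - exact (lax_d_derive beta f L h a b c d e Hbeta HB edge_f_derive edge_f_lim0
      Da Dd Db De Dc La Ld Lb Le Lc t Ht).
  - exact (lax_e_derive beta f L h a b c d e Hbeta HB edge_f_derive edge_f_lim0
      Da Dd Db De Dc La Ld Lb Le Lc t Ht).
Qed.

(** The weighted bound on [L] makes its integral converge at 0. Then [c] and the exponential solve
    the same scalar equation with the same limit at 0, so their difference vanishes. *)
Lemma edge_c_exp (y : R) : Ico01 y -> exists I, is_int0 L y I /\ c y = Cexp I.
Proof.
  intros Hy. destruct (Req_dec y 0) as [-> | Hy0].
  { exists (RtoC 0). split; [split; [reflexivity | intros Habs; lra]|].
    rewrite Cexp_0. apply edge_phi_system. }
  assert (Hyo : Ioo01 y) by (unfold Ico01, Ioo01 in *; lra).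
  destruct (ed_bound _ _ _ HD (/ 2)) as [K [HK HB]]; [unfold Ioo01; lra|].
  destruct (primitive_exists L (/ 2) K beta) as [I HI]; try assumption; [lra| | |].
  { exact edge_L_continuous. }
  { intros t Ht. apply (HB t Ht). }
  exists (I y). split; [split; [intros Habs; lra | intros _; exact (HI y Hyo)]|].
  destruct edge_phi_system as [_ [[_ [_ [_ [_ Lc]]]] _]].
  enough (Hz : (c y - Cexp (I y))%C = RtoC 0).
  { replace (c y) with ((c y - Cexp (I y)) + Cexp (I y))%C by ring. rewrite Hz. ring. }
  refine (linear_ode_zero L (fun t => c t - Cexp (I t))%C beta Hbeta _ _ _ y Hyo).
  - intros T HT. destruct (ed_bound _ _ _ HD T HT) as [K' [HK' HB']].
    exists K'. split; [exact HK'|]. intros t Ht. apply (HB' t Ht).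
  - intros t Ht. eapply is_dC_eq.
    + apply is_dC_minus; [apply edge_c_derive, Ht | apply is_dC_Cexp].
      exact (primitive_derive L I t HI Ht (edge_L_continuous t Ht)).
    + ring.
  - replace (RtoC 0) with (RtoC 1 - RtoC 1)%C by ring.
    apply (filterlim_Cminus (at_right 0)); [exact Lc|].
    apply lim0_Cexp, (primitive_lim0 L I (/ 2)); [lra|].
    intros t Ht. apply HI. unfold Ioo01; lra.
Qed.

(** * Explicit solution of the limit system *)

Section EdgeLimit.

Context (m n : C).

Let g (t : R) : C := RtoC (/ sqrt (f t)).
Let rr (t : R) : C := (Ci * m * Cconj (d t) + RtoC 2 * Cconj (e t) * n)%C.
Let ss (t : R) : C := (e t * m + RtoC 2 * Ci * d t * n)%C.
(** [qe] will be the limit of [q], and [ze] that of [p - 2 conj(H) q]. The pair [(ss, rr)] is the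
    image of [(m, 2 n)] under the matrix with rows [(e, i d)] and [(i conj(d), conj(e))], which is
    [sqrt f] times a unitary one. *)
Let qe (t : R) : C := (RtoC (/ 2) * (c t * rr t * g t))%C.
Let ze (t : R) : C := (c t * c t * ss t * g t)%C.

Lemma edge_g_derive (t : R) : Ioo01 t -> is_dC g t (- RtoC (Re (L t)) * g t)%C.
Proof. exact (is_dC_inv_sqrt f L edge_f_derive t). Qed.

Lemma edge_g_sqr (t : R) : Ioo01 t -> (g t * g t)%C = RtoC (/ f t).
Proof.
  intros Ht. unfold g. rewrite <- RtoC_mult. f_equal.
  assert (Hf := edge_f_pos t Ht). assert (Hs := sqrt_lt_R0 _ Hf).
  rewrite <- (sqrt_sqrt (f t)) at 3 by lra. field. lra.
Qed.

Lemma edge_c_g (t : R) : Ioo01 t -> (c t * Cconj (c t) * (g t * g t))%C = RtoC 1.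
Proof.
  intros Ht. destruct (edge_phi_facts t Ht) as [Hc _].
  assert (Hf := edge_f_pos t Ht).
  rewrite Hc, edge_g_sqr, <- RtoC_mult by exact Ht. f_equal. field. lra.
Qed.

(** The terms in [Re(L)] from [rr] and from [g] cancel, so the diagonal coefficient is the [L]
    contributed by [c]. The coupling terms of [d] and [e] turn [rr] into [h c g ss], which yields
    [ze]. *)
Lemma edge_qe_derive (t : R) : Ioo01 t ->
  is_dC qe t (L t * qe t + RtoC (/ 2) * RtoC (/ f t) * dC H t * ze t)%C.
Proof.
  intros Ht. destruct (edge_phi_facts t Ht) as [_ [_ [Dd De]]].
  eapply is_dC_eq.
  - apply is_dC_mult; [apply is_dC_const|].
    apply is_dC_mult; [|apply edge_g_derive, Ht].
    apply is_dC_mult; [apply edge_c_derive, Ht|].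
    apply is_dC_plus.
    + apply is_dC_mult; [apply is_dC_const | apply is_dC_conj, Dd].
    + apply is_dC_mult; [|apply is_dC_const].
      apply is_dC_mult; [apply is_dC_const | apply is_dC_conj, De].
  - unfold qe, ze, rr, ss, h. change (RtoC (/ sqrt (f t))) with (g t).
    rewrite <- (edge_g_sqr t Ht).
    rewrite !Cplus_conj, !Copp_conj, !Cmult_conj, !Cconj_conj, Cconj_Ci, !Cconj_RtoC.
    replace (Cconj (g t)) with (g t) by (symmetry; apply Cconj_RtoC).
    assert (Hi : (Ci * Ci)%C = (- RtoC 1)%C)
      by (unfold Ci, RtoC, Cmult, Copp; simpl; apply injective_projections; simpl; ring).
    (* [Ci] is an atom for [ring], so [Ci * Ci] is exposed here to be replaced by [-1]. *)
    transitivity (L t * (RtoC (/ 2) * (c t * (Ci * m * Cconj (d t) + RtoC 2 * Cconj (e t) * n) * g t))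
      + RtoC (/ 2) * (g t * g t) * dC H t * (c t * c t *
        (- (Ci * Ci) * (e t * m) + RtoC 2 * Ci * d t * n) * g t))%C; [ring|].
    rewrite Hi. ring.
Qed.

(** As for [qe], with the two factors [c] giving [2 L]. The coupling turns [ss] into
    [- conj(h) conj(c) g rr], and [|c|^2 g^2 = 1] reduces the product to [qe]. *)
Lemma edge_ze_derive (t : R) : Ioo01 t ->
  is_dC ze t (RtoC 2 * L t * ze t - RtoC 2 * Cconj (dC H t) * qe t)%C.
Proof.
  intros Ht. destruct (edge_phi_facts t Ht) as [_ [_ [Dd De]]].
  eapply is_dC_eq.
  - apply is_dC_mult; [|apply edge_g_derive, Ht].
    apply is_dC_mult; [apply is_dC_mult; apply edge_c_derive, Ht|].
    apply is_dC_plus.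
    + apply is_dC_mult; [exact De | apply is_dC_const].
    + apply is_dC_mult; [|apply is_dC_const].
      apply is_dC_mult; [apply is_dC_const | exact Dd].
  - unfold qe, ze, rr, ss, h. change (RtoC (/ sqrt (f t))) with (g t).
    rewrite !Cmult_conj.
    replace (Cconj (g t)) with (g t) by (symmetry; apply Cconj_RtoC).
    assert (Hi : (Ci * Ci)%C = (- RtoC 1)%C)
      by (unfold Ci, RtoC, Cmult, Copp; simpl; apply injective_projections; simpl; ring).
    assert (H2 : (RtoC 2 * RtoC (/ 2))%C = RtoC 1)
      by (rewrite <- RtoC_mult; f_equal; field).
    transitivity (RtoC 2 * L t * (c t * c t * (e t * m + RtoC 2 * Ci * d t * n) * g t)
      - (c t * Cconj (c t) * (g t * g t)) * Cconj (dC H t) * (c t *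
         (Ci * m * Cconj (d t) - RtoC 2 * (Ci * Ci) * Cconj (e t) * n) * g t))%C; [ring|].
    rewrite (edge_c_g t Ht), Hi.
    transitivity (RtoC 2 * L t * (c t * c t * (e t * m + RtoC 2 * Ci * d t * n) * g t)
      - (RtoC 2 * RtoC (/ 2)) * Cconj (dC H t) * (c t *
         (Ci * m * Cconj (d t) + RtoC 2 * Cconj (e t) * n) * g t))%C; [rewrite H2; ring|].
    ring.
Qed.

Lemma edge_lim0 : lim0 qe n /\ lim0 ze m.
Proof.
  destruct edge_phi_system as [_ [[_ [Ld [_ [Le Lc]]]] _]].
  assert (Lg : lim0 g (RtoC 1)).
  { unfold g. apply (filterlim_RtoC (at_right 0)).
    replace 1 with (/ sqrt 1) by (rewrite sqrt_1; field).
    apply (filterlim_Rinv (at_right 0)); [rewrite sqrt_1; lra|].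
    apply (filterlim_sqrt (at_right 0)), edge_f_lim0. }
  assert (Hk : forall k : C, lim0 (fun _ => k) k) by (intros k; apply filterlim_const).
  split.
  - assert (HR : lim0 rr (Ci * m * Cconj (RtoC 0) + RtoC 2 * Cconj (RtoC 1) * n)%C).
    { exact (filterlim_Cplus (at_right 0) _ _ _ _
        (filterlim_Cmult (at_right 0) _ _ _ _ (Hk _) (filterlim_Cconj (at_right 0) _ _ Ld))
        (filterlim_Cmult (at_right 0) _ _ _ _
          (filterlim_Cmult (at_right 0) _ _ _ _ (Hk _) (filterlim_Cconj (at_right 0) _ _ Le)) (Hk _))). }
    rewrite !Cconj_RtoC in HR.
    replace n with (RtoC (/ 2) * (RtoC 1 * (Ci * m * RtoC 0 + RtoC 2 * RtoC 1 * n) * RtoC 1))%C.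
    + exact (filterlim_Cmult (at_right 0) _ _ _ _ (Hk _)
        (filterlim_Cmult (at_right 0) _ _ _ _ (filterlim_Cmult (at_right 0) _ _ _ _ Lc HR) Lg)).
    + assert (H2 : (RtoC (/ 2) * RtoC 2)%C = RtoC 1) by (rewrite <- RtoC_mult; f_equal; field).
      transitivity ((RtoC (/ 2) * RtoC 2) * n)%C; [ring | rewrite H2; ring].
  - assert (HS : lim0 ss (RtoC 1 * m + RtoC 2 * Ci * RtoC 0 * n)%C).
    { exact (filterlim_Cplus (at_right 0) _ _ _ _
        (filterlim_Cmult (at_right 0) _ _ _ _ Le (Hk _))
        (filterlim_Cmult (at_right 0) _ _ _ _
          (filterlim_Cmult (at_right 0) _ _ _ _ (Hk _) Ld) (Hk _))). }
    replace m with (RtoC 1 * RtoC 1 * (RtoC 1 * m + RtoC 2 * Ci * RtoC 0 * n) * RtoC 1)%C by ring.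
    exact (filterlim_Cmult (at_right 0) _ _ _ _
        (filterlim_Cmult (at_right 0) _ _ _ _ (filterlim_Cmult (at_right 0) _ _ _ _ Lc Lc) HS) Lg).
Qed.

Lemma edge_modulus_Ico (t : R) : f 0 = 1 -> Ico01 t ->
  0 < f t /\ (c t * Cconj (c t))%C = RtoC (f t) /\
  (d t * Cconj (d t) + e t * Cconj (e t))%C = RtoC (f t).
Proof.
  intros Hf0 Ht. split; [apply (ed_pos _ _ _ HD), Ht|].
  destruct (Req_dec t 0) as [-> | Ht0].
  - destruct edge_phi_system as [_ [_ [-> [-> ->]]]]. rewrite Hf0, !Cconj_RtoC. split; ring.
  - assert (Hto : Ioo01 t) by (unfold Ico01, Ioo01 in *; lra).
    destruct (edge_phi_facts t Hto) as [H1 [H2 _]]. split; assumption.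
Qed.

Lemma edge_norm_identity (t : R) : f 0 = 1 -> Ico01 t ->
  Cmod (ze t) ^ 2 / f t ^ 2 + 4 * Cmod (qe t) ^ 2 / f t = Cmod m ^ 2 + 4 * Cmod n ^ 2.
Proof.
  intros Hf0 Ht. destruct (edge_modulus_Ico t Hf0 Ht) as [Hf [Hc Hde]].
  assert (Hs := sqrt_lt_R0 _ Hf).
  assert (Hg : Cmod (g t) ^ 2 = / f t).
  { unfold g. rewrite Cmod_R, pow2_abs, <- Rsqr_pow2. unfold Rsqr.
    rewrite <- (sqrt_sqrt (f t)) at 3 by lra. field. lra. }
  assert (Hcm : Cmod (c t) ^ 2 = f t) by (apply RtoC_inj; rewrite Cmod2_conj; exact Hc).
  (* The cross terms in [m] and [n] cancel, and what remains carries the factor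
     [|d|^2 + |e|^2 = f]. *)
  assert (Hrs : Cmod (ss t) ^ 2 + Cmod (rr t) ^ 2 = f t * (Cmod m ^ 2 + 4 * Cmod n ^ 2)).
  { apply RtoC_inj. rewrite RtoC_mult, !RtoC_plus, RtoC_mult, !Cmod2_conj, <- Hde.
    unfold ss, rr.
    rewrite !Cplus_conj, !Cmult_conj, !Cconj_conj, Cconj_Ci, !Cconj_RtoC.
    assert (Hi : (Ci * Ci)%C = (- RtoC 1)%C)
      by (unfold Ci, RtoC, Cmult, Copp; simpl; apply injective_projections; simpl; ring).
    replace (RtoC 4) with (RtoC 2 * RtoC 2)%C by (rewrite <- RtoC_mult; f_equal; ring).
    transitivity (e t * Cconj (e t) * (m * Cconj m) - (Ci * Ci) * (d t * Cconj (d t)) * (m * Cconj m)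
      + RtoC 2 * RtoC 2 * (e t * Cconj (e t)) * (n * Cconj n)
      - RtoC 2 * RtoC 2 * (Ci * Ci) * (d t * Cconj (d t)) * (n * Cconj n))%C; [ring|].
    rewrite Hi. ring. }
  unfold ze, qe. rewrite !Cmod_mult, !Rpow_mult_distr, Hg, Hcm, Cmod_R, pow2_abs.
  replace (f t * f t * Cmod (ss t) ^ 2 * / f t / f t ^ 2 +
    4 * ((/ 2) ^ 2 * (f t * Cmod (rr t) ^ 2 * / f t)) / f t)
    with ((Cmod (ss t) ^ 2 + Cmod (rr t) ^ 2) / f t) by (field; lra).
  rewrite Hrs. field. lra.
Qed.

End EdgeLimit.

End EdgeData.

(** * Limits of the Goursat solution *)

Lemma filterlim_at_right_within (T : R -> Prop) (t d : R) (f : R -> C) (l : C) :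
  0 < d -> (forall s, t < s < t + d -> T s) ->
  filterlim f (within T (locally t)) (locally l) -> filterlim f (at_right t) (locally l).
Proof.
  intros Hd HT Hf P HP. destruct (Hf P HP) as [e He].
  assert (Hm : 0 < Rmin d e) by (apply Rmin_glb_lt; [exact Hd | apply cond_pos]).
  exists (mkposreal _ Hm). intros s Hs Hts. change (Rabs (s - t) < Rmin d e) in Hs.
  assert (Hs2 := Rabs_def2 _ _ Hs).
  assert (M1 := Rmin_l d e). assert (M2 := Rmin_r d e).
  apply He; [|apply HT; lra]. change (Rabs (s - t) < e). lra.
Qed.

Lemma filterlim_minus_at_right_0 (k : R) :
  filterlim (fun s => k - s) (at_right 0) (locally k).
Proof.
  assert (Hid : filterlim (fun s : R => s) (at_right 0) (locally 0))
    by (apply (filterlim_within_of (fun u => 0 < u) (locally 0)); apply filterlim_id).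
  assert (Hk : k + - 0 = k) by ring. 
  refine (eq_ind _ (fun l => filterlim (fun s => k - s) (at_right 0) (locally l)) _ _ Hk).
  exact (filterlim_Rplus (at_right 0) _ _ _ _ (filterlim_const k)
    (filterlim_Ropp (at_right 0) _ _ Hid)).
Qed.

Lemma continuous_on_D_section (g : R * R -> C) (x : R) :
  continuous_on Defs.D g -> 0 <= x < 1 -> lim0 (fun y => g (x, y)) (g (x, 0)).
Proof.
  intros Hg Hx. apply (filterlim_of_Cmod (at_right 0)). intros eps Heps.
  destruct (continuous_on_D_eps g x 0 eps Hg) as [d [Hd H]];
    [unfold Defs.D; simpl; lra | exact Heps|].
  apply (at_right_0_intro _ (Rmin d (1 - x))); [apply Rmin_glb_lt; lra|].
  intros y Hy.
  assert (M1 := Rmin_l d (1 - x)). assert (M2 := Rmin_r d (1 - x)).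
  apply H; [unfold Defs.D; simpl; lra | rewrite Rminus_diag, Rabs_R0; lra |].
  rewrite Rminus_0_r, Rabs_right; lra.
Qed.

Lemma continuous_on_D_swap (g : R * R -> C) :
  continuous_on Defs.D g -> continuous_on Defs.D (fun p => g (snd p, fst p)).
Proof.
  intros Hg [x y] Hp. apply (filterlim_of_Cmod (within Defs.D (locally (x, y)))). intros eps Heps.
  destruct (continuous_on_D_eps g y x eps Hg) as [d [Hd H]];
    [unfold Defs.D in *; simpl in *; lra | exact Heps|].
  exists (mkposreal d Hd). intros [u v] [Hu Hv] Huv. simpl.
  apply H; [unfold Defs.D in *; simpl in *; lra | exact Hv | exact Hu].
Qed.

Lemma Cn_intD_is_dC (n : nat) (F : R -> R -> C) (x y : R) : (2 <= n)%nat -> Cn_intD n F ->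
  intD (x, y) ->
  is_dC (F x) y (dy F x y) /\ is_dC (fun s => F s y) x (dx F x y) /\
  is_dC (dx F x) y (dxy F x y) /\ is_dC (fun s => dy F s y) x (dx (dy F) x y).
Proof.
  intros Hn HF Hxy. destruct n as [|[|n]]; [lia|lia|].
  destruct (HF x y Hxy) as [[_ [Rx [Ry [Rxs Rys]]]] [_ [Ix [Iy [Ixs Iys]]]]].
  destruct Rxs as [_ [_ [Rxy _]]]. destruct Ixs as [_ [_ [Ixy _]]].
  destruct Rys as [_ [Ryx _]]. destruct Iys as [_ [Iyx _]].
  split; [|split; [|split]]; split; apply Derive_correct; assumption.
Qed.

Lemma Cn_Ioo01_is_dC (n : nat) (f : R -> C) (t : R) : (1 <= n)%nat -> Cn_Ioo01 n f ->
  Ioo01 t -> is_dC f t (dC f t) /\ continuous (dC f) t.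
Proof.
  intros Hn Hf Ht. destruct (Hf t Ht 1%nat Hn) as [Hr [Hi [Cr Ci]]].
  split; [split; apply Derive_correct; assumption|].
  apply (filterlim_C_of_ReIm (locally t)); assumption.
Qed.

Lemma lim0_eventually (f g : R -> C) (l : C) (d : R) :
  0 < d -> (forall s, 0 < s < d -> f s = g s) -> lim0 f l -> lim0 g l.
Proof.
  intros Hd Hfg. apply filterlim_ext_loc. exact (at_right_0_intro _ d Hd Hfg).
Qed.

Lemma C_Ico01_lim0 (f : R -> C) : C_Ico01 f -> lim0 f (f 0).
Proof.
  intros Hf. apply (filterlim_at_right_within Ico01 0 1); [lra| |apply Hf; unfold Ico01; lra].
  unfold Ico01. intros s Hs. lra.
Qed.

Lemma solve_weight (beta r : R) (z w : C) : 0 < r -> z = (RtoC (Rpower r beta) * w)%C ->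
  w = (RtoC (Rpower r (- beta)) * z)%C.
Proof.
  intros Hr ->. rewrite Cmult_assoc, <- RtoC_mult, <- Rpower_plus.
  replace (- beta + beta) with 0 by ring. rewrite Rpower_O by exact Hr. ring.
Qed.

Lemma intD_swap (u v : R) : intD (u, v) -> intD (v, u).
Proof. unfold intD; simpl. lra. Qed.

Lemma continuous_on_D_mult (g h : R * R -> C) :
  continuous_on Defs.D g -> continuous_on Defs.D h -> continuous_on Defs.D (fun p => g p * h p)%C.
Proof. intros Hg Hh p HpD. exact (filterlim_Cmult _ _ _ _ _ (Hg p HpD) (Hh p HpD)). Qed.

Lemma continuous_on_D_minus (g h : R * R -> C) :
  continuous_on Defs.D g -> continuous_on Defs.D h -> continuous_on Defs.D (fun p => g p - h p)%C.
Proof. intros Hg Hh p HpD. exact (filterlim_Cminus _ _ _ _ _ (Hg p HpD) (Hh p HpD)). Qed.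

Lemma continuous_on_D_conj (g : R * R -> C) :
  continuous_on Defs.D g -> continuous_on Defs.D (fun p => Cconj (g p)).
Proof. intros Hg p HpD. exact (filterlim_Cconj _ _ _ (Hg p HpD)). Qed.

Lemma continuous_on_D_opp (g : R * R -> C) :
  continuous_on Defs.D g -> continuous_on Defs.D (fun p => - g p)%C.
Proof. intros Hg p HpD. exact (filterlim_Copp _ _ _ (Hg p HpD)). Qed.

Lemma continuous_on_D_const (k : C) : continuous_on Defs.D (fun _ => k).
Proof. intros p HpD. apply filterlim_const. Qed.

Lemma solve_mixed (f : R) (Z W V : C) : f <> 0 -> (RtoC f * (Z - W))%C = V ->
  Z = (RtoC (/ f) * V + W)%C.
Proof.
  intros Hf <-. rewrite Cmult_assoc, <- RtoC_mult, Rinv_l by exact Hf. ring.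
Qed.

Section Goursat.

(** [gE], [gH] extend the weighted [y]-derivatives and supply the coefficients of the linear system;
    [kE], [kH] extend the weighted [x]-derivatives and supply its initial values at [y = 0]. *)
Context (n : nat) (hn : (2 <= n)%nat) (alpha : R) (halpha : 0 < alpha < 1)
  (E0 H0 E1 H1 : R -> C) (hdata : admissible_data n alpha E0 H0 E1 H1)
  (E H : R -> R -> C) (hsol : Cn_solution n E0 H0 E1 H1 E H)
  (beta : R) (Hbeta : 0 <= beta < 1) (gE gH kE kH : R * R -> C)
  (CgE : continuous_on Defs.D gE) (CgH : continuous_on Defs.D gH)
  (CkE : continuous_on Defs.D kE) (CkH : continuous_on Defs.D kH)
  (HgE : forall p, intD p -> gE p = (RtoC (Rpower (snd p) beta) * dy E (fst p) (snd p))%C)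
  (HgH : forall p, intD p -> gH p = (RtoC (Rpower (snd p) beta) * dy H (fst p) (snd p))%C)
  (HkE : forall p, intD p -> kE p = (RtoC (Rpower (fst p) beta) * dx E (fst p) (snd p))%C)
  (HkH : forall p, intD p -> kH p = (RtoC (Rpower (fst p) beta) * dx H (fst p) (snd p))%C).

Lemma edge_dC_E1 (y : R) : Ioo01 y -> dC E1 y = (RtoC (Rpower y (- beta)) * gE (0, y))%C.
Proof.
  intros Hy.
  rewrite <- (dC_ext_loc (E 0) E1 y).
  - apply is_dC_unique, (is_dC_on_edge E gE beta); try assumption; [apply hsol|].
    intros u v Huv. apply (Cn_intD_is_dC n E u v hn); [apply hsol | exact Huv].
  - generalize (locally_Ioo01 y Hy). apply filter_imp. intros s Hs.
    apply (sol_bdry1 _ _ _ _ _ _ _ hsol s (Ioo_Ico s Hs)).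
Qed.

Lemma edge_dC_H1 (y : R) : Ioo01 y -> dC H1 y = (RtoC (Rpower y (- beta)) * gH (0, y))%C.
Proof.
  intros Hy.
  rewrite <- (dC_ext_loc (H 0) H1 y).
  - apply is_dC_unique, (is_dC_on_edge H gH beta); try assumption; [apply hsol|].
    intros u v Huv. apply (Cn_intD_is_dC n H u v hn); [apply hsol | exact Huv].
  - generalize (locally_Ioo01 y Hy). apply filter_imp. intros s Hs.
    apply (sol_bdry1 _ _ _ _ _ _ _ hsol s (Ioo_Ico s Hs)).
Qed.

(** The trace on the other edge, by [is_dC_on_edge] with the variables exchanged; it identifies the
    initial values of [p] at [y = 0]. *)
Lemma edge_dC_E0 (x : R) : Ioo01 x -> dC E0 x = (RtoC (Rpower x (- beta)) * kE (x, 0))%C.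
Proof.
  intros Hx.
  rewrite <- (dC_ext_loc (fun s => E s 0) E0 x).
  - apply is_dC_unique, (is_dC_on_edge (fun a b => E b a) (fun p => kE (snd p, fst p)) beta);
      [|apply continuous_on_D_swap, CkE | | |exact Hx].
    + exact (continuous_on_D_swap _ (proj1 (sol_cont _ _ _ _ _ _ _ hsol))).
    + intros u v Huv. apply (Cn_intD_is_dC n E v u hn); [apply hsol | apply intD_swap, Huv].
    + intros [u v] Hp. apply (HkE (v, u)), intD_swap, Hp.
  - generalize (locally_Ioo01 x Hx). apply filter_imp. intros s Hs.
    apply (sol_bdry0 _ _ _ _ _ _ _ hsol s (Ioo_Ico s Hs)).
Qed.

Lemma edge_dC_H0 (x : R) : Ioo01 x -> dC H0 x = (RtoC (Rpower x (- beta)) * kH (x, 0))%C.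
Proof.
  intros Hx.
  rewrite <- (dC_ext_loc (fun s => H s 0) H0 x).
  - apply is_dC_unique, (is_dC_on_edge (fun a b => H b a) (fun p => kH (snd p, fst p)) beta);
      [|apply continuous_on_D_swap, CkH | | |exact Hx].
    + exact (continuous_on_D_swap _ (proj2 (sol_cont _ _ _ _ _ _ _ hsol))).
    + intros u v Huv. apply (Cn_intD_is_dC n H v u hn); [apply hsol | apply intD_swap, Huv].
    + intros [u v] Hp. apply (HkH (v, u)), intD_swap, Hp.
  - generalize (locally_Ioo01 x Hx). apply filter_imp. intros s Hs.
    apply (sol_bdry0 _ _ _ _ _ _ _ hsol s (Ioo_Ico s Hs)).
Qed.

(** * The linear system in [y] for the scaled [x]-derivatives *)

Let Ep (p : R * R) : C := E (fst p) (snd p).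
Let Hp (p : R * R) : C := H (fst p) (snd p).
Let fp (p : R * R) : R := fEH (Ep p) (Hp p).
Let rf (p : R * R) : C := RtoC (/ fp p).
(** Solved for [E_xy] and [H_xy], the nonlinear terms are linear in [(E_x, H_x)], with [E_y], [H_y]
    and [conj(H)] in the coefficients. The four [Aij] are these coefficients with [y^(-beta)] taken
    out. *)
Let A11 (p : R * R) : C := (rf p * (gE p - Cconj (Hp p) * gH p))%C.
Let A12 (p : R * R) : C := (- (rf p * (Cconj (Hp p) * gE p)))%C.
Let A21 (p : R * R) : C := (RtoC (/ 2) * (rf p * gH p))%C.
Let A22 (p : R * R) : C := (rf p * (RtoC (/ 2) * gE p - RtoC 2 * (Cconj (Hp p) * gH p)))%C.
(** Minus the [y]-derivative of [sqrt (1 - x - y)], and also that square root divided by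
    [2 (1 - x - y)]. *)
Let rho (p : R * R) : R := / (2 * sqrt (1 - fst p - snd p)).

Lemma fp_pos (p : R * R) : Defs.D p -> 0 < fp p.
Proof. intros HpD. apply (sol_pos _ _ _ _ _ _ _ hsol). destruct p; exact HpD. Qed.

Lemma continuous_on_Hp : continuous_on Defs.D Hp.
Proof. exact (proj2 (sol_cont _ _ _ _ _ _ _ hsol)). Qed.

Lemma filterlim_fp (p : R * R) : Defs.D p ->
  filterlim fp (within Defs.D (locally p)) (locally (fp p)).
Proof.
  intros HpD. exact (filterlim_fEH (within Defs.D (locally p)) Ep Hp _ _
    (proj1 (sol_cont _ _ _ _ _ _ _ hsol) p HpD) (continuous_on_Hp p HpD)).
Qed.

Lemma continuous_on_rf : continuous_on Defs.D rf.
Proof.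
  intros p HpD. assert (Hpos := fp_pos p HpD).
  exact (filterlim_RtoC _ _ _ (filterlim_Rinv _ _ _ (Rgt_not_eq _ _ Hpos) (filterlim_fp p HpD))).
Qed.

Lemma continuous_on_rsf : continuous_on Defs.D (fun p => RtoC (/ sqrt (fp p))).
Proof.
  intros p HpD. assert (Hpos := sqrt_lt_R0 _ (fp_pos p HpD)).
  exact (filterlim_RtoC _ _ _ (filterlim_Rinv _ _ _ (Rgt_not_eq _ _ Hpos)
    (filterlim_sqrt _ _ _ (filterlim_fp p HpD)))).
Qed.

Lemma continuous_on_rho : continuous_on Defs.D (fun p => RtoC (rho p)).
Proof.
  intros [x y] HpD.
  assert (Hpos : 0 < sqrt (1 - x - y))
    by (apply sqrt_lt_R0; destruct HpD as [_ [_ Hlt]]; simpl in Hlt; lra).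
  assert (Hfst : filterlim (fun q : R * R => fst q) (within Defs.D (locally (x, y))) (locally x))
    by exact (filterlim_within_of Defs.D (locally (x, y)) _ _
      (continuous_fst (U := R_UniformSpace) (V := R_UniformSpace) x y)).
  assert (Hsnd : filterlim (fun q : R * R => snd q) (within Defs.D (locally (x, y))) (locally y))
    by exact (filterlim_within_of Defs.D (locally (x, y)) _ _
      (continuous_snd (U := R_UniformSpace) (V := R_UniformSpace) x y)).
  assert (Hne : 2 * sqrt (1 + - x + - y) <> 0) by (apply Rgt_not_eq; unfold Rminus in Hpos; lra).
  exact (filterlim_RtoC _ _ _ (filterlim_Rinv _ (fun q : R * R => 2 * sqrt (1 + - fst q + - snd q)) _ Hne
    (filterlim_Rmult _ _ _ _ _ (filterlim_const 2) (filterlim_sqrt _ _ _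
     (filterlim_Rplus _ _ _ _ _ (filterlim_Rplus _ _ _ _ _ (filterlim_const 1)
        (filterlim_Ropp _ _ _ Hfst)) (filterlim_Ropp _ _ _ Hsnd)))))).
Qed.

Lemma coefficients_continuous :
  continuous_on Defs.D A11 /\ continuous_on Defs.D A12 /\
  continuous_on Defs.D A21 /\ continuous_on Defs.D A22 /\
  continuous_on Defs.D (fun p => RtoC (rho p) * gE p)%C /\
  continuous_on Defs.D (fun p => RtoC (rho p) * gH p)%C.
Proof.
  assert (CH := continuous_on_D_conj _ continuous_on_Hp). assert (Cr := continuous_on_rf).
  split; [|split; [|split; [|split; [|split]]]].
  - exact (continuous_on_D_mult _ _ Cr
      (continuous_on_D_minus _ _ CgE (continuous_on_D_mult _ _ CH CgH))).
  - exact (continuous_on_D_opp _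
      (continuous_on_D_mult _ _ Cr (continuous_on_D_mult _ _ CH CgE))).
  - exact (continuous_on_D_mult _ _ (continuous_on_D_const _) (continuous_on_D_mult _ _ Cr CgH)).
  - exact (continuous_on_D_mult _ _ Cr (continuous_on_D_minus _ _
      (continuous_on_D_mult _ _ (continuous_on_D_const _) CgE)
      (continuous_on_D_mult _ _ (continuous_on_D_const _) (continuous_on_D_mult _ _ CH CgH)))).
  - exact (continuous_on_D_mult _ _ continuous_on_rho CgE).
  - exact (continuous_on_D_mult _ _ continuous_on_rho CgH).
Qed.

Lemma edge_values (y : R) : Ico01 y ->
  Ep (0, y) = E1 y /\ Hp (0, y) = H1 y /\ fp (0, y) = fEH (E1 y) (H1 y).
Proof.
  intros Hy. destruct (sol_bdry1 _ _ _ _ _ _ _ hsol y Hy) as [e1 e2].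
  unfold fp, Ep, Hp; simpl. rewrite e1, e2. repeat split.
Qed.

(** The weighted bound holds because both Lax coefficients are [y^(-beta)] times the trace on
    [x = 0] of a function continuous on [D]. *)
Lemma edge_data_1 : edge_data beta E1 H1.
Proof.
  destruct (adm_cont _ _ _ _ _ _ hdata) as [_ [_ [CE CH]]].
  destruct (adm_Cn _ _ _ _ _ _ hdata) as [_ [_ [DE DH]]].
  assert (hn1 : (1 <= n)%nat) by lia.
  constructor.
  - intros t Ht. split; apply (Cn_Ioo01_is_dC n); assumption.
  - intros t Ht. split; apply (Cn_Ioo01_is_dC n); assumption.
  - split.
    + rewrite <- (proj2 (adm_E_origin _ _ _ _ _ _ hdata)). apply C_Ico01_lim0, CE.
    + rewrite <- (proj2 (adm_H_origin _ _ _ _ _ _ hdata)). apply C_Ico01_lim0, CH.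
  - intros t Ht. apply (adm_pos _ _ _ _ _ _ hdata), Ht.
  - intros T HT. unfold Ioo01 in HT.
    destruct (near_edge_bounded (fun p => RtoC (/ 2) * rf p * (gE p - RtoC 2 * Cconj (Hp p) * gH p))%C T)
      as [K1 [HK1 [B1 _]]]; [|lra|].
    { exact (continuous_on_D_mult _ _
        (continuous_on_D_mult _ _ (continuous_on_D_const _) continuous_on_rf)
        (continuous_on_D_minus _ _ CgE (continuous_on_D_mult _ _ (continuous_on_D_mult _ _
          (continuous_on_D_const _) (continuous_on_D_conj _ continuous_on_Hp)) CgH))). }
    destruct (near_edge_bounded (fun p => RtoC (/ sqrt (fp p)) * gH p)%C T)
      as [K2 [HK2 [B2 _]]]; [|lra|].
    { exact (continuous_on_D_mult _ _ continuous_on_rsf CgH). }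
    exists (K1 + K2). split; [lra|]. intros t Ht.
    assert (Hto : Ioo01 t) by (unfold Ioo01; lra).
    assert (Hw : 0 < Rpower t (- beta)) by apply exp_pos.
    specialize (B1 t ltac:(lra)). specialize (B2 t ltac:(lra)).
    destruct (edge_values t (Ioo_Ico t Hto)) as [e1 [e2 e3]].
    assert (Hf : 0 < fEH (E1 t) (H1 t)) by apply (adm_pos _ _ _ _ _ _ hdata t (Ioo_Ico t Hto)).
    unfold rf in B1. rewrite e2, e3 in B1. rewrite e3 in B2. split.
    + rewrite log_coef_alt, edge_dC_E1, edge_dC_H1 by assumption.
      replace (RtoC (/ (2 * fEH (E1 t) (H1 t))))
        with (RtoC (/ 2) * RtoC (/ fEH (E1 t) (H1 t)))%C
        by (rewrite <- RtoC_mult; f_equal; field; lra).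
      replace (RtoC (/ 2) * RtoC (/ fEH (E1 t) (H1 t)) *
        (RtoC (Rpower t (- beta)) * gE (0%R, t) -
         RtoC 2 * Cconj (H1 t) * (RtoC (Rpower t (- beta)) * gH (0%R, t))))%C
        with (RtoC (Rpower t (- beta)) * (RtoC (/ 2) * RtoC (/ fEH (E1 t) (H1 t)) *
          (gE (0%R, t) - RtoC 2 * Cconj (H1 t) * gH (0%R, t))))%C by ring.
      rewrite Rmult_comm. apply Cmod_scal_le; lra.
    + rewrite edge_dC_H1 by assumption.
      replace (RtoC (/ sqrt (fEH (E1 t) (H1 t))) * (RtoC (Rpower t (- beta)) * gH (0%R, t)))%C
        with (RtoC (Rpower t (- beta)) * (RtoC (/ sqrt (fEH (E1 t) (H1 t))) * gH (0%R, t)))%C by ring.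
      rewrite Rmult_comm. apply Cmod_scal_le; lra.
Qed.

Let p (x y : R) : C := (RtoC (sqrt (1 - x - y) * Rpower x alpha) * dx E x y)%C.
Let q (x y : R) : C := (RtoC (sqrt (1 - x - y) * Rpower x alpha) * dx H x y)%C.

Lemma is_dC_prefactor (x y : R) : intD (x, y) ->
  is_dC (fun s => RtoC (sqrt (1 - x - s) * Rpower x alpha)) y
    (- (RtoC (rho (x, y)) * RtoC (Rpower x alpha)))%C.
Proof.
  intros Hxy. unfold intD in Hxy; simpl in Hxy.
  rewrite <- RtoC_mult, <- RtoC_opp. apply is_dC_RtoC.
  assert (Hpos : 0 < sqrt (1 - x - y)) by (apply sqrt_lt_R0; lra).
  assert (D1 : is_derive (fun s => 1 - x - s) y (- 1)) by (auto_derive; [exact I | ring]).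
  assert (D2 := is_derive_sqrt (fun s => 1 - x - s) y _ D1 ltac:(lra)).
  evar_last; [exact (is_derive_Rmult _ _ _ _ _ D2 (is_derive_const (V := R_NormedModule) _ y))|].
  unfold rho; simpl. unfold zero; simpl. field. lra.
Qed.

Lemma scaled_system (x y : R) : intD (x, y) ->
  is_dC (p x) y (RtoC (Rpower y (- beta)) * (A11 (x, y) * p x y + A12 (x, y) * q x y
     + RtoC (Rpower x alpha) * (RtoC (rho (x, y)) * gE (x, y))))%C /\
  is_dC (q x) y (RtoC (Rpower y (- beta)) * (A21 (x, y) * p x y + A22 (x, y) * q x y
     + RtoC (Rpower x alpha) * (RtoC (rho (x, y)) * gH (x, y))))%C.
Proof.
  intros Hxy.
  destruct (Cn_intD_is_dC n E x y hn (proj1 (sol_Cn _ _ _ _ _ _ _ hsol)) Hxy) as [_ [_ [DE _]]].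
  destruct (Cn_intD_is_dC n H x y hn (proj2 (sol_Cn _ _ _ _ _ _ _ hsol)) Hxy) as [_ [_ [DH _]]].
  assert (Hpre := is_dC_prefactor x y Hxy).
  destruct (sol_eq _ _ _ _ _ _ _ hsol x y Hxy) as [EqE EqH].
  assert (HyE := solve_weight beta y _ _ (proj1 (proj2 Hxy)) (HgE (x, y) Hxy)).
  assert (HyH := solve_weight beta y _ _ (proj1 (proj2 Hxy)) (HgH (x, y) Hxy)).
  simpl in HyE, HyH.
  assert (HxyD : Defs.D (x, y)) by (unfold Defs.D; unfold intD in Hxy; simpl in *; lra).
  assert (Hf := fp_pos (x, y) HxyD).
  assert (HfC : (RtoC (Re (E x y)) - H x y * Cconj (H x y))%C = RtoC (fp (x, y))).
  { unfold fp, fEH, Ep, Hp. cbn [fst snd]. rewrite RtoC_minus, Cmod2_conj. reflexivity. }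
  unfold intD in Hxy; simpl in Hxy.
  assert (Hs : 0 < sqrt (1 - x - y)) by (apply sqrt_lt_R0; lra).
  (* The scaled equation contains [rho x^alpha (E_x + E_y)], and differentiating the prefactor
     contributes [- rho x^alpha E_x]; only the [E_y] part is left as a source. *)
  assert (HK : (RtoC (sqrt (1 - x - y)) * RtoC (/ (2 * (1 - x - y))))%C = RtoC (rho (x, y))).
  { rewrite <- RtoC_mult. f_equal. unfold rho; simpl.
    rewrite <- (sqrt_sqrt (1 - x - y)) at 2 by lra. field. lra. }
  rewrite HfC in EqE, EqH.
  apply solve_mixed in EqE; [|lra]. apply solve_mixed in EqH; [|lra].
  rewrite Cdiv_RtoC in EqE, EqH by lra. rewrite HyE, HyH in EqE, EqH.
  change (RtoC (/ fp (x, y))) with (rf (x, y)) in EqE, EqH.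
  assert (Hsplit : RtoC (sqrt (1 - x - y) * Rpower x alpha) =
    (RtoC (sqrt (1 - x - y)) * RtoC (Rpower x alpha))%C) by apply RtoC_mult.
  split.
  - refine (is_dC_eq _ _ _ _ (is_dC_mult _ _ _ _ _ Hpre DE) _).
    rewrite EqE. unfold p, q, A11, A12. change (Hp (x, y)) with (H x y).
    rewrite Hsplit, <- HK. ring.
  - refine (is_dC_eq _ _ _ _ (is_dC_mult _ _ _ _ _ Hpre DH) _).
    rewrite EqH. unfold p, q, A21, A22. change (Hp (x, y)) with (H x y).
    rewrite Hsplit, <- HK. ring.
Qed.

(** For fixed [x > 0] the weight [x^beta] is a nonzero constant, so the continuity of [kE], [kH] at
    [(x, 0)] gives the limit of [E_x], [H_x], and the trace lemmas recognise it as the derivative of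
    the data. *)
Lemma scaled_lim_y (x : R) : Ioo01 x ->
  lim0 (p x) (RtoC (sqrt (1 - x) * Rpower x alpha) * dC E0 x)%C /\
  lim0 (q x) (RtoC (sqrt (1 - x) * Rpower x alpha) * dC H0 x)%C.
Proof.
  intros Hx. rewrite edge_dC_E0, edge_dC_H0 by exact Hx. unfold Ioo01 in Hx.
  assert (Hpre : lim0 (fun y => RtoC (sqrt (1 - x - y) * Rpower x alpha))
    (RtoC (sqrt (1 - x) * Rpower x alpha))).
  { apply (filterlim_RtoC (at_right 0)), (filterlim_Rmult (at_right 0)); [|apply filterlim_const].
    apply (filterlim_sqrt (at_right 0)).
    apply filterlim_minus_at_right_0. }
  assert (Hgen : forall (F : R -> R -> C) (k : R * R -> C), continuous_on Defs.D k ->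
    (forall p, intD p -> k p = (RtoC (Rpower (fst p) beta) * dx F (fst p) (snd p))%C) ->
    lim0 (fun y => RtoC (sqrt (1 - x - y) * Rpower x alpha) * dx F x y)%C
      (RtoC (sqrt (1 - x) * Rpower x alpha) * (RtoC (Rpower x (- beta)) * k (x, 0)))%C).
  { intros F k Ck Hk.
    apply (lim0_eventually (fun y => RtoC (sqrt (1 - x - y) * Rpower x alpha) *
      (RtoC (Rpower x (- beta)) * k (x, y)))%C _ _ (1 - x)); [lra| |].
    - intros y Hy. f_equal. symmetry. apply (solve_weight beta x (k (x, y)) (dx F x y)); [lra|].
      apply (Hk (x, y)). unfold intD; simpl; lra.
    - exact (filterlim_Cmult (at_right 0) _ _ _ _ Hpre
        (filterlim_Cmult (at_right 0) _ _ _ _ (filterlim_const _)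
          (continuous_on_D_section k x Ck ltac:(lra)))). }
  split; apply Hgen; assumption.
Qed.

(** * Convergence to the edge solution and the limit formulas *)

Context (m1 n1 : C)
  (hm1 : lim0 (fun x => RtoC (Rpower x alpha) * dC E0 x)%C m1)
  (hn1 : lim0 (fun x => RtoC (Rpower x alpha) * dC H0 x)%C n1)
  (Phi1 : R -> @matrix C 3 3) (hPhi1 : is_Phi1_at_0 E1 H1 Phi1).

Let f1 (y : R) : R := fEH (E1 y) (H1 y).
Let c1 (y : R) : C := entry (Phi1 y) 1 1.
Let d1 (y : R) : C := entry (Phi1 y) 2 0.
Let e1 (y : R) : C := entry (Phi1 y) 2 2.
Let g1 (y : R) : C := RtoC (/ sqrt (f1 y)).
Let rr (y : R) : C := (Ci * m1 * Cconj (d1 y) + RtoC 2 * Cconj (e1 y) * n1)%C.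
Let ss (y : R) : C := (e1 y * m1 + RtoC 2 * Ci * d1 y * n1)%C.
Let qe (y : R) : C := (RtoC (/ 2) * (c1 y * rr y * g1 y))%C.
Let ze (y : R) : C := (c1 y * c1 y * ss y * g1 y)%C.
Let pe (y : R) : C := (ze y + RtoC 2 * (Cconj (H1 y) * qe y))%C.

(** Differentiating the factor [conj(H1)] in [pe] produces [2 conj(H1') qe], which cancels the last
    term in the derivative of [ze]. Substituting the traces of [gE], [gH] for the derivatives of the
    data gives the coefficients [Aij] at [x = 0]. *)
Lemma edge_system (y : R) : Ioo01 y ->
  is_dC pe y (RtoC (Rpower y (- beta)) * (A11 (0, y) * pe y + A12 (0, y) * qe y))%C /\
  is_dC qe y (RtoC (Rpower y (- beta)) * (A21 (0, y) * pe y + A22 (0, y) * qe y))%C.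
Proof.
  intros Hy.
  assert (Dq : is_dC qe y (log_coef E1 H1 y * qe y
      + RtoC (/ 2) * RtoC (/ f1 y) * dC H1 y * ze y)%C)
    by exact (edge_qe_derive beta Hbeta E1 H1 edge_data_1 Phi1 hPhi1 m1 n1 y Hy).
  assert (Dz : is_dC ze y (RtoC 2 * log_coef E1 H1 y * ze y
      - RtoC 2 * Cconj (dC H1 y) * qe y)%C)
    by exact (edge_ze_derive beta Hbeta E1 H1 edge_data_1 Phi1 hPhi1 m1 n1 y Hy).
  destruct (ed_derive _ _ _ edge_data_1 y Hy) as [_ DH].
  destruct (edge_values y (Ioo_Ico y Hy)) as [_ [v2 v3]].
  assert (Hf : 0 < f1 y) by apply (adm_pos _ _ _ _ _ _ hdata y (Ioo_Ico y Hy)).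
  assert (HL : log_coef E1 H1 y = (RtoC (/ 2) * (RtoC (/ f1 y) * (RtoC (Rpower y (- beta)) *
    (gE (0%R, y) - RtoC 2 * (Cconj (H1 y) * gH (0%R, y))))))%C).
  { rewrite (log_coef_alt E1 H1 y Hf), edge_dC_E1, edge_dC_H1 by exact Hy.
    rewrite Rinv_mult, RtoC_mult. unfold f1. ring. }
  assert (H2 : (RtoC 2 * RtoC (/ 2))%C = RtoC 1) by (rewrite <- RtoC_mult; f_equal; field).
  assert (Hrf : rf (0, y) = RtoC (/ f1 y)) by (unfold rf; rewrite v3; reflexivity).
  split.
  - assert (Dp := is_dC_plus _ _ _ _ _ Dz (is_dC_mult _ _ _ _ _ (is_dC_const (RtoC 2) y)
      (is_dC_mult _ _ _ _ _ (is_dC_conj _ _ _ DH) Dq))).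
    refine (is_dC_eq _ _ _ _ Dp _).
    unfold A11, A12. rewrite Hrf, v2, HL, (edge_dC_H1 y Hy). unfold pe.
    set (w := RtoC (Rpower y (- beta))). set (GE := gE (0%R, y)). set (GH := gH (0%R, y)).
    set (r := RtoC (/ f1 y)). set (hb := Cconj (H1 y)).
    transitivity ((RtoC 2 * RtoC (/ 2)) * (r * w * (GE - RtoC 2 * (hb * GH)) * ze y
      + hb * (r * w * (GE - RtoC 2 * (hb * GH)) * qe y) + hb * r * w * GH * ze y))%C; [ring|].
    rewrite H2. ring.
  - refine (is_dC_eq _ _ _ _ Dq _).
    unfold A21, A22. rewrite Hrf, v2, HL, (edge_dC_H1 y Hy). unfold pe.
    set (w := RtoC (Rpower y (- beta))). set (GE := gE (0%R, y)). set (GH := gH (0%R, y)).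
    set (r := RtoC (/ f1 y)). set (hb := Cconj (H1 y)).
    transitivity (w * (r * (RtoC (/ 2) * GH * ze y + RtoC (/ 2) * GE * qe y
      - (RtoC 2 * RtoC (/ 2)) * hb * GH * qe y)))%C; [ring|].
    transitivity (w * (r * (RtoC (/ 2) * GH * ze y + RtoC (/ 2) * GE * qe y
      + (RtoC 2 * RtoC (/ 2)) * hb * GH * qe y - RtoC 2 * hb * GH * qe y)))%C; [rewrite H2; ring|].
    ring.
Qed.

Lemma scaled_limits (y : R) : Ioo01 y ->
  lim0 (fun x => p x y) (pe y) /\ lim0 (fun x => q x y) (qe y).
Proof.
  intros Hy.
  destruct coefficients_continuous as [C11 [C12 [C21 [C22 [CG1 CG2]]]]].
  destruct (edge_lim0 beta E1 H1 edge_data_1 Phi1 hPhi1 m1 n1) as [Lq Lz].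
  change (lim0 qe n1) in Lq. change (lim0 ze m1) in Lz.
  assert (Lp : lim0 pe m1).
  { replace m1 with (m1 + RtoC 2 * (Cconj (RtoC 0) * n1))%C by (rewrite Cconj_RtoC; ring).
    exact (filterlim_Cplus (at_right 0) _ _ _ _ Lz (filterlim_Cmult (at_right 0) _ _ _ _
      (filterlim_const _) (filterlim_Cmult (at_right 0) _ _ _ _ (filterlim_Cconj (at_right 0) _ _
        (proj2 (ed_lim0 _ _ _ edge_data_1))) Lq))). }
  assert (Hsq : lim0 (fun x => RtoC (sqrt (1 - x))) (RtoC 1)).
  { assert (Hs := filterlim_sqrt (at_right 0) _ _ (filterlim_minus_at_right_0 1)).
    rewrite sqrt_1 in Hs. exact (filterlim_RtoC (at_right 0) _ _ Hs). }
  assert (Hp0 : forall (F0 : R -> C) (k : C), lim0 (fun x => RtoC (Rpower x alpha) * dC F0 x)%C k ->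
    lim0 (fun x => RtoC (sqrt (1 - x) * Rpower x alpha) * dC F0 x)%C k).
  { intros F0 k Hk. replace k with (RtoC 1 * k)%C by ring.
    apply (lim0_eventually (fun x => RtoC (sqrt (1 - x)) * (RtoC (Rpower x alpha) * dC F0 x))%C _ _ 1);
      [lra | intros s _; rewrite RtoC_mult; ring |].
    exact (filterlim_Cmult (at_right 0) _ _ _ _ Hsq Hk). }
  exact (linear_system_edge_limit beta alpha A11 A12 A21 A22 _ _ p q _ _ pe qe m1 n1
    Hbeta (proj1 halpha) C11 C12 C21 C22 CG1 CG2 scaled_system edge_system scaled_lim_y
    (Hp0 _ _ hm1) (Hp0 _ _ hn1) Lp Lq y Hy).
Qed.

Lemma fEH_corner : f1 0 = 1.
Proof.
  unfold f1. rewrite (proj2 (adm_E_origin _ _ _ _ _ _ hdata)), (proj2 (adm_H_origin _ _ _ _ _ _ hdata)).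
  unfold fEH. rewrite Cmod_0. simpl. ring.
Qed.

Lemma edge_pe_qe_0 : pe 0 = m1 /\ qe 0 = n1.
Proof.
  destruct (edge_phi_system beta E1 H1 edge_data_1 Phi1 hPhi1) as [_ [_ [Vd [Ve Vc]]]].
  unfold pe, ze, qe, ss, rr, g1, c1, d1, e1.
  rewrite fEH_corner, Vd, Ve, Vc, (proj2 (adm_H_origin _ _ _ _ _ _ hdata)), !Cconj_RtoC.
  rewrite sqrt_1, Rinv_1.
  assert (H2 : (RtoC 2 * RtoC (/ 2))%C = RtoC 1) by (rewrite <- RtoC_mult; f_equal; field).
  split; [ring|].
  transitivity ((RtoC 2 * RtoC (/ 2)) * n1)%C; [ring | rewrite H2; ring].
Qed.

Lemma weighted_limits (y : R) : Ico01 y ->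
  lim0 (fun x => RtoC (Rpower x alpha) * dx E x y)%C (RtoC (/ sqrt (1 - y)) * pe y)%C /\
  lim0 (fun x => RtoC (Rpower x alpha) * dx H x y)%C (RtoC (/ sqrt (1 - y)) * qe y)%C.
Proof.
  intros Hy. destruct (Req_dec y 0) as [-> | Hy0].
  (* At [y = 0] the system in [y > 0] says nothing; there [E] and [H] are the boundary data, and the
     limits are the hypotheses on [m1] and [n1]. *)
  - destruct edge_pe_qe_0 as [-> ->].
    rewrite Rminus_0_r, sqrt_1, Rinv_1, !Cmult_1_l.
    assert (Hb : forall (F : R -> R -> C) (F0 : R -> C) (k : C),
      (forall s, Ioo01 s -> F s 0 = F0 s) ->
      lim0 (fun x => RtoC (Rpower x alpha) * dC F0 x)%C k ->
      lim0 (fun x => RtoC (Rpower x alpha) * dx F x 0)%C k).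
    { intros F F0 k HF. apply (lim0_eventually _ _ _ 1); [lra|]. intros x Hx. f_equal.
      symmetry. apply dC_ext_loc. generalize (locally_Ioo01 x Hx). apply filter_imp. exact HF. }
    split; [apply (Hb E E0) | apply (Hb H H0)]; try assumption;
      intros s Hs; apply (sol_bdry0 _ _ _ _ _ _ _ hsol s (Ioo_Ico s Hs)).
  - assert (Hyo : Ioo01 y) by (unfold Ico01, Ioo01 in *; lra).
    destruct (scaled_limits y Hyo) as [Lp Lq]. unfold Ioo01 in Hyo.
    assert (Hpos : 0 < sqrt (1 - y)) by (apply sqrt_lt_R0; lra).
    assert (Hinv : lim0 (fun x => RtoC (/ sqrt (1 - x - y))) (RtoC (/ sqrt (1 - y)))).
    { apply (lim0_eventually (fun x => RtoC (/ sqrt (1 - y - x))) _ _ 1); [lra | |].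
      - intros s _. replace (1 - s - y) with (1 - y - s) by ring. reflexivity.
      - exact (filterlim_RtoC (at_right 0) _ _ (filterlim_Rinv (at_right 0) _ _
          (Rgt_not_eq _ _ Hpos) (filterlim_sqrt (at_right 0) _ _ (filterlim_minus_at_right_0 _)))). }
    assert (Hgen : forall (F : R -> R -> C) (k : C),
      lim0 (fun x => RtoC (sqrt (1 - x - y) * Rpower x alpha) * dx F x y)%C k ->
      lim0 (fun x => RtoC (Rpower x alpha) * dx F x y)%C (RtoC (/ sqrt (1 - y)) * k)%C).
    { intros F k Hk.
      apply (lim0_eventually (fun x => RtoC (/ sqrt (1 - x - y)) *
        (RtoC (sqrt (1 - x - y) * Rpower x alpha) * dx F x y))%C _ _ (1 - y)); [lra| |].
      - intros x Hx. assert (Hs : 0 < sqrt (1 - x - y)) by (apply sqrt_lt_R0; lra).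
        rewrite Cmult_assoc, <- RtoC_mult. f_equal. f_equal. field. lra.
      - exact (filterlim_Cmult (at_right 0) _ _ _ _ Hinv Hk). }
    split; apply Hgen; assumption.
Qed.

Lemma goursat_limits (y : R) : Ico01 y ->
  (exists b, is_int0 (log_coef E1 H1) y b /\ c1 y = Cexp b) /\
  lim0 (fun x => RtoC (Rpower x alpha) * dx E x y)%C
    (c1 y *
       (((Ci * m1 * Cconj (d1 y) + RtoC 2 * Cconj (e1 y) * n1) * Cconj (H1 y)
         + c1 y * (e1 y * m1 + RtoC 2 * Ci * d1 y * n1))
        / (RtoC (sqrt (f1 y)) * RtoC (sqrt (1 - y)))))%C /\
  lim0 (fun x => RtoC (Rpower x alpha) * dx H x y)%C
    (c1 y *
       ((Ci * m1 * Cconj (d1 y) + RtoC 2 * Cconj (e1 y) * n1)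
        / (RtoC 2 * RtoC (sqrt (f1 y)) * RtoC (sqrt (1 - y)))))%C.
Proof.
  intros Hy. split; [exact (edge_c_exp beta Hbeta E1 H1 edge_data_1 Phi1 hPhi1 y Hy)|].
  destruct (weighted_limits y Hy) as [LE LH].
  assert (Hf : 0 < sqrt (f1 y)) by apply sqrt_lt_R0, (adm_pos _ _ _ _ _ _ hdata y Hy).
  assert (Hs : 0 < sqrt (1 - y)) by (apply sqrt_lt_R0; unfold Ico01 in Hy; lra).
  assert (Hprod : 0 < sqrt (f1 y) * sqrt (1 - y)) by (apply Rmult_lt_0_compat; assumption).
  rewrite <- !RtoC_mult, !Cdiv_RtoC by lra. rewrite !Rinv_mult, !RtoC_mult.
  split.
  - replace (c1 y * _)%C with (RtoC (/ sqrt (1 - y)) * pe y)%C; [exact LE|].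
    assert (H2 : (RtoC 2 * RtoC (/ 2))%C = RtoC 1) by (rewrite <- RtoC_mult; f_equal; field).
    unfold pe, ze, qe. fold (g1 y) (rr y) (ss y).
    transitivity (RtoC (/ sqrt (1 - y)) * (c1 y * c1 y * ss y * g1 y
      + (RtoC 2 * RtoC (/ 2)) * (Cconj (H1 y) * (c1 y * rr y * g1 y))))%C; [ring|].
    rewrite H2. ring.
  - replace (c1 y * _)%C with (RtoC (/ sqrt (1 - y)) * qe y)%C; [exact LH|].
    unfold qe. fold (g1 y) (rr y). ring.
Qed.

(** For [alpha = 1/2] the factor [x] is the square of the weight [x^alpha]. The combination
    [E_x - 2 conj(H1) H_x] then has weighted limit [ze / sqrt (1 - y)], and the norm identity for
    [(ze, qe)] finishes. *)
Lemma goursat_norm_limit (y : R) : alpha = / 2 -> Ico01 y -> exists l : R,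
  filterlim
    (fun x => x *
       (Cmod (dx E x y - RtoC 2 * Cconj (H1 y) * dx H x y)%C ^ 2 / f1 y ^ 2
        + 4 * Cmod (dx H x y) ^ 2 / f1 y))
    (at_right 0) (locally l) /\
  (1 - y) * l = Cmod m1 ^ 2 + 4 * Cmod n1 ^ 2.
Proof.
  intros Ha Hy. destruct (weighted_limits y Hy) as [LE LH].
  assert (Hnorm := edge_norm_identity beta Hbeta E1 H1 edge_data_1 Phi1 hPhi1 m1 n1 y fEH_corner Hy).
  change (Cmod (ze y) ^ 2 / f1 y ^ 2 + 4 * Cmod (qe y) ^ 2 / f1 y = Cmod m1 ^ 2 + 4 * Cmod n1 ^ 2)
    in Hnorm.
  assert (Hf : 0 < f1 y) by apply (adm_pos _ _ _ _ _ _ hdata y Hy).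
  unfold Ico01 in Hy. assert (Hs : 0 < sqrt (1 - y)) by (apply sqrt_lt_R0; lra).
  assert (Hss : Cmod (RtoC (/ sqrt (1 - y))) ^ 2 = / (1 - y)).
  { rewrite Cmod_R, pow2_abs. rewrite <- (sqrt_sqrt (1 - y)) at 2 by lra. field. lra. }
  set (VE := (RtoC (/ sqrt (1 - y)) * pe y)%C) in LE.
  set (VH := (RtoC (/ sqrt (1 - y)) * qe y)%C) in LH.
  exists (Cmod (VE - RtoC 2 * Cconj (H1 y) * VH)%C ^ 2 * / f1 y ^ 2 + 4 * Cmod VH ^ 2 * / f1 y).
  split.
  - apply (filterlim_ext_loc (fun x =>
      Cmod (RtoC (Rpower x alpha) * dx E x y
        - RtoC 2 * Cconj (H1 y) * (RtoC (Rpower x alpha) * dx H x y))%C ^ 2 * / f1 y ^ 2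
      + 4 * Cmod (RtoC (Rpower x alpha) * dx H x y)%C ^ 2 * / f1 y)).
    { apply (at_right_0_intro _ 1); [lra|]. intros x Hx.
      assert (Hx2 : Cmod (RtoC (Rpower x alpha)) ^ 2 = x).
      { rewrite Cmod_R, pow2_abs, Ha. simpl. rewrite Rmult_1_r, <- Rpower_plus.
        replace (/ 2 + / 2) with 1 by field. apply Rpower_1; lra. }
      replace (RtoC (Rpower x alpha) * dx E x y
        - RtoC 2 * Cconj (H1 y) * (RtoC (Rpower x alpha) * dx H x y))%C
        with (RtoC (Rpower x alpha) * (dx E x y - RtoC 2 * Cconj (H1 y) * dx H x y))%C by ring.
      rewrite !(Cmod_mult (RtoC (Rpower x alpha))), !Rpow_mult_distr, Hx2. field. lra. }
    assert (Hk : forall k : R, filterlim (fun _ : R => k) (at_right 0) (locally k))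
      by (intros k; apply filterlim_const).
    assert (Hkc : forall k : C, lim0 (fun _ : R => k) k) by (intros k; apply filterlim_const).
    exact (filterlim_Rplus (at_right 0) _ _ _ _
      (filterlim_Rmult (at_right 0) _ _ _ _ (filterlim_Cmod_sqr (at_right 0) _ _
        (filterlim_Cminus (at_right 0) _ _ _ _ LE
          (filterlim_Cmult (at_right 0) _ _ _ _ (Hkc _) LH))) (Hk _))
      (filterlim_Rmult (at_right 0) _ _ _ _
        (filterlim_Rmult (at_right 0) _ _ _ _ (Hk 4) (filterlim_Cmod_sqr (at_right 0) _ _ LH)) (Hk _))).
  - replace (VE - RtoC 2 * Cconj (H1 y) * VH)%C with (RtoC (/ sqrt (1 - y)) * ze y)%C
      by (unfold VE, VH, pe; ring).
    unfold VH. rewrite !(Cmod_mult (RtoC (/ sqrt (1 - y)))), !Rpow_mult_distr, Hss, <- Hnorm.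
    field. lra.
Qed.

End Goursat.

(** * Exchange of the variables *)

Lemma extends_to_D_swap (F : R -> R -> C) :
  extends_to_D F -> extends_to_D (fun x y => F y x).
Proof.
  intros [g [Cg Hg]]. exists (fun p => g (snd p, fst p)).
  split; [exact (continuous_on_D_swap g Cg)|].
  intros [u v] Hp. exact (Hg (v, u) (intD_swap u v Hp)).
Qed.

Lemma extends_to_D_ext (F G : R -> R -> C) :
  (forall x y, intD (x, y) -> F x y = G x y) -> extends_to_D F -> extends_to_D G.
Proof.
  intros HFG [g [Cg Hg]]. exists g. split; [exact Cg|].
  intros [u v] Hp. rewrite (Hg _ Hp). exact (HFG u v Hp).
Qed.

Lemma continuity_2d_pt_swap (f : R -> R -> R) (x y : R) :
  continuity_2d_pt f x y -> continuity_2d_pt (fun u v => f v u) y x.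
Proof.
  intros Hf eps. destruct (Hf eps) as [d Hd]. exists d.
  intros u v Hu Hv. exact (Hd v u Hv Hu).
Qed.

Lemma ex_diff_n_continuity (n : nat) (f : R -> R -> R) (x y : R) :
  ex_diff_n f n x y -> continuity_2d_pt f x y.
Proof. destruct n; intros [Hc _]; exact Hc. Qed.

Lemma ex_diff_n_swap (n : nat) (f : R -> R -> R) (x y : R) :
  ex_diff_n f n x y -> ex_diff_n (fun u v => f v u) n y x.
Proof.
  revert f. induction n as [|n IHn]; intros f.
  - intros [Hc _]. split; [apply continuity_2d_pt_swap, Hc | exact I].
  - intros [Hc [Hx [Hy [Hdx Hdy]]]].
    split; [apply continuity_2d_pt_swap, Hc|]. split; [exact Hy|]. split; [exact Hx|].
    split.
    + exact (IHn (fun u v => Derive (fun z => f u z) v) Hdy).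
    + exact (IHn (fun u v => Derive (fun z => f z v) u) Hdx).
Qed.

Lemma locally_2d_intD (x y : R) : intD (x, y) -> locally_2d (fun u v => intD (u, v)) x y.
Proof.
  unfold intD; simpl. intros Hxy.
  set (d := Rmin (Rmin x y) ((1 - x - y) / 2)).
  assert (Hd : 0 < d) by (repeat apply Rmin_glb_lt; lra).
  assert (M1 : d <= Rmin x y) by apply Rmin_l.
  assert (M2 : d <= (1 - x - y) / 2) by apply Rmin_r.
  assert (M3 := Rmin_l x y). assert (M4 := Rmin_r x y).
  exists (mkposreal d Hd). simpl. intros u v Hu Hv.
  apply Rabs_def2 in Hu, Hv. lra.
Qed.

(** [dxy] fixes an order of differentiation, so exchanging the variables requires Schwarz's theorem;
    [n >= 2] gives existence near the point and continuity of both mixed derivatives. *)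
Lemma Derive_comm_intD (n : nat) (f : R -> R -> R) (x y : R) : (2 <= n)%nat ->
  (forall u v, intD (u, v) -> ex_diff_n f n u v) -> intD (x, y) ->
  Derive (fun z => Derive (fun t => f z t) y) x = Derive (fun z => Derive (fun t => f t z) x) y.
Proof.
  intros Hn Hf Hxy. destruct n as [|[|n]]; [lia|lia|].
  destruct (Hf x y Hxy) as [_ [_ [_ [[_ [_ [_ [_ Cxy]]]] [_ [_ [_ [Cyx _]]]]]]]].
  apply ex_diff_n_continuity in Cxy, Cyx.
  apply Schwarz; [|exact Cyx | exact Cxy].
  generalize (locally_2d_intD x y Hxy). apply locally_2d_impl, locally_2d_forall.
  intros u v Huv.
  destruct (Hf u v Huv) as [_ [Dx [Dy [[_ [_ [Dxy _]]] [_ [Dyx _]]]]]].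
  exact (conj Dx (conj Dy (conj Dyx Dxy))).
Qed.

Lemma dxy_comm (n : nat) (F : R -> R -> C) (x y : R) : (2 <= n)%nat ->
  Cn_intD n F -> intD (x, y) -> dx (dy F) x y = dxy F x y.
Proof.
  intros Hn HF Hxy. apply injective_projections.
  - exact (Derive_comm_intD n (fun u v => Re (F u v)) x y Hn (fun u v h => proj1 (HF u v h)) Hxy).
  - exact (Derive_comm_intD n (fun u v => Im (F u v)) x y Hn (fun u v h => proj2 (HF u v h)) Hxy).
Qed.

Lemma Cn_intD_swap (n : nat) (F : R -> R -> C) : Cn_intD n F -> Cn_intD n (fun x y => F y x).
Proof.
  intros HF x y Hxy. destruct (HF y x (intD_swap x y Hxy)) as [Hr Hi].
  split; [exact (ex_diff_n_swap n _ y x Hr) | exact (ex_diff_n_swap n _ y x Hi)].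
Qed.

Lemma admissible_data_swap (n : nat) (alpha : R) (E0 H0 E1 H1 : R -> C) :
  admissible_data n alpha E0 H0 E1 H1 -> admissible_data n alpha E1 H1 E0 H0.
Proof.
  intros [[? [? [? ?]]] [? [? [? ?]]] Hs [? ?] [? ?] Hp]. constructor; try tauto.
  - intros f Hf. apply Hs. tauto.
  - intros x Hx. destruct (Hp x Hx). tauto.
Qed.

(** The domain, the weights and the equations are symmetric in [x] and [y] up to the order of the
    mixed derivative, which [Hmix] repairs. *)
Lemma Cn_solution_swap (n : nat) (E0 H0 E1 H1 : R -> C) (E H : R -> R -> C) : (2 <= n)%nat ->
  Cn_solution n E0 H0 E1 H1 E H ->
  Cn_solution n E1 H1 E0 H0 (fun x y => E y x) (fun x y => H y x).
Proof.
  intros Hn [[CE CH] [DE DH] Heq [beta [Hbeta Hsing]] Hb0 Hb1 Hpos].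
  assert (Hmix : forall F x y, F = E \/ F = H -> intD (x, y) ->
    dxy (fun a b => F b a) x y = dxy F y x).
  { intros F x y HF Hxy. apply (dxy_comm n F y x Hn); [|apply intD_swap, Hxy].
    destruct HF as [-> | ->]; assumption. }
  constructor.
  - split; [exact (continuous_on_D_swap _ CE) | exact (continuous_on_D_swap _ CH)].
  - split; apply Cn_intD_swap; assumption.
  - intros x y Hxy. destruct (Heq y x (intD_swap x y Hxy)) as [EqE EqH].
    split; rewrite Hmix by tauto;
      change (dx (fun a b => E b a) x y) with (dy E y x);
      change (dy (fun a b => E b a) x y) with (dx E y x);
      change (dx (fun a b => H b a) x y) with (dy H y x);
      change (dy (fun a b => H b a) x y) with (dx H y x);
      replace (1 - x - y) with (1 - y - x) by ring.
    + rewrite (Cplus_comm (dy E y x)), EqE. ring.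
    + rewrite (Cplus_comm (dy H y x)), EqH. ring.
  - exists beta. split; [exact Hbeta|].
    assert (Hsw : forall F, F = E \/ F = H ->
      extends_to_D (fun x y => RtoC (Rpower x beta) * dx (fun a b => F b a) x y)%C /\
      extends_to_D (fun x y => RtoC (Rpower y beta) * dy (fun a b => F b a) x y)%C /\
      extends_to_D
        (fun x y => RtoC (Rpower x beta * Rpower y beta) * dxy (fun a b => F b a) x y)%C).
    { intros F HF. destruct (Hsing F HF) as [S1 [S2 S3]].
      split; [exact (extends_to_D_swap _ S2)|]. split; [exact (extends_to_D_swap _ S1)|].
      refine (extends_to_D_ext _ _ _ (extends_to_D_swap _ S3)).
      intros x y Hxy. cbv beta. rewrite (Hmix F x y HF Hxy), (Rmult_comm (Rpower y beta)).
      reflexivity. }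
    intros F [-> | ->]; apply Hsw; tauto.
  - exact Hb1.
  - exact Hb0.
  - intros x y Hxy. apply Hpos. unfold Defs.D in *; simpl in *; lra.
Qed.

Lemma goursat_edge_asymptotics (n : nat) (hn : (2 <= n)%nat) (alpha : R) (halpha : 0 < alpha < 1)
    (E0 H0 E1 H1 : R -> C) (hdata : admissible_data n alpha E0 H0 E1 H1)
    (E H : R -> R -> C) (hsol : Cn_solution n E0 H0 E1 H1 E H) (m1 n1 : C)
    (hm1 : lim0 (fun x => RtoC (Rpower x alpha) * dC E0 x)%C m1)
    (hn1 : lim0 (fun x => RtoC (Rpower x alpha) * dC H0 x)%C n1)
    (Phi1 : R -> @matrix C 3 3) (hPhi1 : is_Phi1_at_0 E1 H1 Phi1) :
  let c1 y := entry (Phi1 y) 1 1 in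
  let d1 y := entry (Phi1 y) 2 0 in
  let e1 y := entry (Phi1 y) 2 2 in
  let f1 y := fEH (E1 y) (H1 y) in
  (forall y, Ico01 y ->
     (exists b, is_int0 (log_coef E1 H1) y b /\ c1 y = Cexp b) /\
     lim0 (fun x => RtoC (Rpower x alpha) * dx E x y)%C
       (c1 y *
          (((Ci * m1 * Cconj (d1 y) + RtoC 2 * Cconj (e1 y) * n1)
              * Cconj (H1 y)
            + c1 y * (e1 y * m1 + RtoC 2 * Ci * d1 y * n1))
           / (RtoC (sqrt (f1 y)) * RtoC (sqrt (1 - y)))))%C /\
     lim0 (fun x => RtoC (Rpower x alpha) * dx H x y)%C
       (c1 y *
          ((Ci * m1 * Cconj (d1 y) + RtoC 2 * Cconj (e1 y) * n1)
           / (RtoC 2 * RtoC (sqrt (f1 y)) * RtoC (sqrt (1 - y)))))%C) /\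
  (alpha = / 2 -> forall y, Ico01 y -> exists L : R,
     filterlim
       (fun x => x *
          (Cmod (dx E x y - RtoC 2 * Cconj (H1 y) * dx H x y)%C ^ 2
             / f1 y ^ 2
           + 4 * Cmod (dx H x y) ^ 2 / f1 y))
       (at_right 0) (locally L) /\
     (1 - y) * L = Cmod m1 ^ 2 + 4 * Cmod n1 ^ 2).
Proof.
  destruct (sol_sing _ _ _ _ _ _ _ hsol) as [beta [Hbeta Hsing]].
  destruct (Hsing E (or_introl eq_refl)) as [[kE [CkE HkE]] [[gE [CgE HgE]] _]].
  destruct (Hsing H (or_intror eq_refl)) as [[kH [CkH HkH]] [[gH [CgH HgH]] _]].
  split.
  - intros y Hy. exact (goursat_limits n hn alpha halpha E0 H0 E1 H1 hdata E H hsol beta Hbeta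
      gE gH kE kH CgE CgH CkE CkH HgE HgH HkE HkH m1 n1 hm1 hn1 Phi1 hPhi1 y Hy).
  - intros Ha y Hy. exact (goursat_norm_limit n hn alpha halpha E0 H0 E1 H1 hdata E H hsol beta Hbeta
      gE gH kE kH CgE CgH CkE CkH HgE HgH HkE HkH m1 n1 hm1 hn1 Phi1 hPhi1 y Ha Hy).
Qed.

Theorem theorem3
  (n : nat) (hn : (2 <= n)%nat) (alpha : R) (halpha : 0 < alpha < 1)
  (E0 H0 E1 H1 : R -> C)
  (hdata : admissible_data n alpha E0 H0 E1 H1)
  (E H : R -> R -> C)
  (hsol : Cn_solution n E0 H0 E1 H1 E H)
  (m1 n1 m2 n2 : C)
  (hm1 : lim0 (fun x => RtoC (Rpower x alpha) * dC E0 x)%C m1)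
  (hn1 : lim0 (fun x => RtoC (Rpower x alpha) * dC H0 x)%C n1)
  (hm2 : lim0 (fun y => RtoC (Rpower y alpha) * dC E1 y)%C m2)
  (hn2 : lim0 (fun y => RtoC (Rpower y alpha) * dC H1 y)%C n2)
  (Phi1 Phi0 : R -> @matrix C 3 3)
  (hPhi1 : is_Phi1_at_0 E1 H1 Phi1)
  (hPhi0 : is_Phi0_at_1 E0 H0 Phi0) :
  let c1 y := entry (Phi1 y) 1 1 in
  let d1 y := entry (Phi1 y) 2 0 in
  let e1 y := entry (Phi1 y) 2 2 in
  let c2 x := entry (Phi0 x) 1 1 in
  let d2 x := entry (Phi0 x) 2 0 in
  let e2 x := entry (Phi0 x) 2 2 in
  let f0 x := fEH (E0 x) (H0 x) in
  let f1 y := fEH (E1 y) (H1 y) in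
  (forall y, Ico01 y ->
     (exists b, is_int0 (log_coef E1 H1) y b /\ c1 y = Cexp b) /\
     lim0 (fun x => RtoC (Rpower x alpha) * dx E x y)%C
       (c1 y *
          (((Ci * m1 * Cconj (d1 y) + RtoC 2 * Cconj (e1 y) * n1)
              * Cconj (H1 y)
            + c1 y * (e1 y * m1 + RtoC 2 * Ci * d1 y * n1))
           / (RtoC (sqrt (f1 y)) * RtoC (sqrt (1 - y)))))%C /\
     lim0 (fun x => RtoC (Rpower x alpha) * dx H x y)%C
       (c1 y *
          ((Ci * m1 * Cconj (d1 y) + RtoC 2 * Cconj (e1 y) * n1)
           / (RtoC 2 * RtoC (sqrt (f1 y)) * RtoC (sqrt (1 - y)))))%C) /\
  (forall x, Ico01 x ->
     (exists a, is_int0 (log_coef E0 H0) x a /\ c2 x = Cexp a) /\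
     lim0 (fun y => RtoC (Rpower y alpha) * dy E x y)%C
       (c2 x *
          (((Ci * m2 * Cconj (d2 x) + RtoC 2 * Cconj (e2 x) * n2)
              * Cconj (H0 x)
            + c2 x * (e2 x * m2 + RtoC 2 * Ci * d2 x * n2))
           / (RtoC (sqrt (f0 x)) * RtoC (sqrt (1 - x)))))%C /\
     lim0 (fun y => RtoC (Rpower y alpha) * dy H x y)%C
       (c2 x *
          ((Ci * m2 * Cconj (d2 x) + RtoC 2 * Cconj (e2 x) * n2)
           / (RtoC 2 * RtoC (sqrt (f0 x)) * RtoC (sqrt (1 - x)))))%C) /\
  (alpha = / 2 ->
     (forall y, Ico01 y -> exists L : R,
        filterlim
          (fun x => x *
             (Cmod (dx E x y - RtoC 2 * Cconj (H1 y) * dx H x y)%C ^ 2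
                / f1 y ^ 2
              + 4 * Cmod (dx H x y) ^ 2 / f1 y))
          (at_right 0) (locally L) /\
        (1 - y) * L = Cmod m1 ^ 2 + 4 * Cmod n1 ^ 2) /\
     (forall x, Ico01 x -> exists L : R,
        filterlim
          (fun y => y *
             (Cmod (dy E x y - RtoC 2 * Cconj (H0 x) * dy H x y)%C ^ 2
                / f0 x ^ 2
              + 4 * Cmod (dy H x y) ^ 2 / f0 x))
          (at_right 0) (locally L) /\
        (1 - x) * L = Cmod m2 ^ 2 + 4 * Cmod n2 ^ 2)).
Proof.
  destruct (goursat_edge_asymptotics n hn alpha halpha E0 H0 E1 H1 hdata E H hsol m1 n1 hm1 hn1
    Phi1 hPhi1) as [A1 B1].
  (* [dx] of the exchanged functions is convertible to [dy] of the original ones, and [U0] and [V1]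
     unfold to the same [lax_matrix]; hence [A2] and [B2] are the claims for [y] tending to 0 by
     conversion alone. *)
  destruct (goursat_edge_asymptotics n hn alpha halpha E1 H1 E0 H0 (admissible_data_swap _ _ _ _ _ _ hdata)
    (fun x y => E y x) (fun x y => H y x) (Cn_solution_swap n _ _ _ _ E H hn hsol) m2 n2 hm2 hn2
    Phi0 hPhi0) as [A2 B2].
  intros c1 d1 e1 c2 d2 e2 f0 f1.
  split; [exact A1|]. split; [exact A2|].
  intros Ha. split; [exact (B1 Ha) | exact (B2 Ha)].
Qed.
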